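(* Let $f \colon (\mathbb{C}^2, 0) \to (\mathbb{C}, 0)$ be an analytic function germ which is mini-regular in $x$ of order $m := \mathrm{ord}\, f$. Then the {\L}ojasiewicz gradient exponent of $f$ is given by $$\mathscr{L}(f) = \begin{cases} \frac{m - 1}{m} & \textrm{ if } \Gamma(f) = \emptyset, \\ \max\left\{ \ell(\gamma)\mid \gamma\in \Gamma(f)\right\} & \textrm{ otherwise,}\end{cases}$$ where $\Gamma(f)$ is the set of polar branches of $f$ which are not roots of $f=0$.
   Context: Germs are not assumed reduced. Write the Taylor expansion $f = f_m + f_{m+1} + \cdots$ with $f_k$ homogeneous of degree $k$ and $f_m \not\equiv 0$; then $\mathrm{ord}\, f = m$ is the multiplicity of $f$ at the origin, and $f$ is mini-regular in $x$ of order $m$ if $f_m(1,0) \neq 0$. The {\L}ojasiewicz gradient exponent $\mathscr{L}(f)$ is the minimum of the exponents $\ell \ge 0$ for which there are constants $c, \epsilon > 0$ with $\|\nabla f(z)\| \ge c\,|f(z)|^{\ell}$ for all $\|z\| < \epsilon$, where $\nabla f$ is the vector of partial derivatives (this minimum exists and is a rational number in $[0,1)$). A Newton--Puiseux root of $g=0$ (for an analytic germ $g(x,y)$ at the origin) is a convergent Puiseux series $\gamma(y) \in \mathbb{C}\{y^{1/N}\}$ (some integer $N \ge 1$) with only positive exponents (the zero series is allowed) such that $g(\gamma(y), y) \equiv 0$. A polar branch of $f$ is a Newton--Puiseux root of $\frac{\partial f}{\partial x} = 0$; $\Gamma(f)$ is the set of polar branches that are not roots of $f=0$. For an analytic arc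 $\phi(t)$ with $\phi(0)=0$ and $f\circ\phi \not\equiv 0$, the number $\ell(\phi)$ is defined by $\|\nabla f(\phi(t))\| \simeq |f(\phi(t))|^{\ell(\phi)}$ as $t \to 0$, where $A \simeq B$ means that $A/B$ lies between two positive constants. A Puiseux series $\gamma \in \mathbb{C}\{y^{1/N}\}$ is identified with the arc $t \mapsto (\gamma(t^N), t^N)$, and $\ell(\gamma)$ is the corresponding number. *)

(* Defs.v *)
From HB Require Import structures.
From mathcomp Require Import all_boot all_order all_algebra.
From mathcomp Require Import all_classical all_reals all_analysis.
From mathcomp Require Import complex.

Set Implicit Arguments.
Unset Strict Implicit.
Unset Printing Implicit Defensive.

Import Order.TTheory GRing.Theory Num.Theory numFieldNormedType.Exports.

Local Open Scope classical_set_scope.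
Local Open Scope ring_scope.
Local Open Scope complex_scope.

(* The regular module R[i]^o is the copy of R[i] on which the library infers
   the topology; as a normed module over R[i], it makes 'D_v below a complex
   derivative. *)
Notation Cplx R := (R[i]^o) (only parsing).
Notation Cplx2 R := (R[i]^o * R[i]^o)%type (only parsing).

(* The norm of R[i] takes its values in R[i], on the real axis. *)
Definition modulus (R : realType) (z : Cplx R) : R := complex.Re `|z|.

(* A germ at the origin is given by any function representing it: every notion
   below only depends on the values of the function near 0. *)

Definition hom_part (R : realType) (a : nat -> nat -> Cplx R) (k : nat)
    (z : Cplx2 R) : Cplx R :=
  \sum_(i < k.+1) a i (k - i)%N * z.1 ^+ i * z.2 ^+ (k - i).

(* The first clause makes the double series \sum_(i, j) a i j x^i y^j absolutely
   convergent on a polydisc, so that its sum may be computed degree by degree. *)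
Definition is_taylor (R : realType) (f : Cplx2 R -> Cplx R)
    (a : nat -> nat -> Cplx R) : Prop :=
  (exists r M : R,
     0 < r /\ forall i j : nat, modulus (a i j) * r ^+ (i + j) <= M) /\
  (\forall z \near (0 : Cplx2 R),
     series (fun k => hom_part a k z) @ \oo --> f z).

Definition has_order (R : realType) (a : nat -> nat -> Cplx R) (m : nat) : Prop :=
  (forall k : nat, (k < m)%N -> forall z, hom_part a k z = 0) /\
  (exists z, hom_part a m z != 0).

Definition mini_regular_x (R : realType) (a : nat -> nat -> Cplx R) (m : nat) :
    Prop :=
  has_order a m /\ hom_part a m (1, 0) != 0.

Definition grad_norm (R : realType) (f : Cplx2 R -> Cplx R) (z : Cplx2 R) : R :=
  Num.sqrt (modulus ('D_(1, 0) f z) ^+ 2 + modulus ('D_(0, 1) f z) ^+ 2).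

Definition is_minimum (R : realType) (A : set R) (x : R) : Prop :=
  A x /\ lbound A x.

Definition is_maximum (R : realType) (A : set R) (x : R) : Prop :=
  A x /\ ubound A x.

(* powR satisfies 0 `^ 0 = 1, and 0 `^ l = 0 for l != 0. *)
Definition gradient_exponents (R : realType) (f : Cplx2 R -> Cplx R) : set R :=
  [set l : R | 0 <= l /\
     exists2 c : R, 0 < c &
       \forall z \near (0 : Cplx2 R), c * modulus (f z) `^ l <= grad_norm f z].

Definition is_lojasiewicz_exponent (R : realType) (f : Cplx2 R -> Cplx R)
    (l : R) : Prop :=
  is_minimum (gradient_exponents f) l.

(* The Puiseux series \sum_(k >= 1) c_k y^(k/N).  The pair (N, c) is not unique:
   refining N only reparametrizes the arc by a power of t. *)
Record puiseux (R : realType) := Puiseux {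
  puiseux_den : nat;
  puiseux_coef : nat -> Cplx R;
  puiseux_den_gt0 : (0 < puiseux_den)%N;
  puiseux_coef0 : puiseux_coef 0%N = 0;
  puiseux_cvg : \forall t \near (0 : Cplx R),
    cvgn (series (fun k => puiseux_coef k * t ^+ k : Cplx R)) }.

(* t |-> (gamma (t^N), t^N) *)
Definition puiseux_arc (R : realType) (gamma : puiseux R) (t : Cplx R) :
    Cplx2 R :=
  (limn (series (fun k => puiseux_coef gamma k * t ^+ k : Cplx R)),
   t ^+ puiseux_den gamma).

Definition is_newton_puiseux_root (R : realType) (g : Cplx2 R -> Cplx R)
    (gamma : puiseux R) : Prop :=
  \forall t \near (0 : Cplx R), g (puiseux_arc gamma t) = 0.

Definition polar_branch (R : realType) (f : Cplx2 R -> Cplx R) :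
    set (puiseux R) :=
  [set gamma | is_newton_puiseux_root ('D_(1, 0) f) gamma].

Definition Gamma (R : realType) (f : Cplx2 R -> Cplx R) : set (puiseux R) :=
  [set gamma | polar_branch f gamma /\ ~ is_newton_puiseux_root f gamma].

(* "l(phi) = l", for an arc phi along which f does not vanish identically;
   0^' is the filter of punctured neighbourhoods of 0. *)
Definition is_arc_exponent (R : realType) (f : Cplx2 R -> Cplx R)
    (phi : Cplx R -> Cplx2 R) (l : R) : Prop :=
  exists c1 c2 : R, [/\ 0 < c1, 0 < c2 &
    \forall t \near (0 : Cplx R)^',
      c1 * modulus (f (phi t)) `^ l <= grad_norm f (phi t) <=
      c2 * modulus (f (phi t)) `^ l].

(* Main.v *)
Require Import Defs.
From HB Require Import structures.
From mathcomp Require Import all_boot all_order all_algebra.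
From mathcomp Require Import cyclic separable cyclotomic.
From mathcomp Require Import all_classical all_reals all_analysis.
From mathcomp Require Import complex zify ring lra.

(** Write m = n + 1 and factor f_x(x, t^N) = U(x, t) prod_(i < n) (x - c_i(t))
    with U a unit.  At a point (x, y) with y = t^N, let c_i(t) be the polar root
    closest to x, put k = x - c_i(t) and v(t) = f(c_i(t), t^N).  Every factor of
    f_x grows at most by a constant factor when t moves to s with |s| <= 2 |t| and
    x to the disc of radius |k| about c_i(s); hence f(x, y) - v(t) = O(|k| |f_x|),
    and by Cauchy's estimate the t-derivative of this difference is
    O(|k| |f_x| / |t|).
    If |f| = O(|k| |f_x|), then |f|^n = O(|f_x|^(n+1)) because |k|^n = O(|f_x|).
    Otherwise |f| and |v| are comparable, and |v'(t)| ~ |v(t)| / |t| bounds the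
    gradient from below by |f| / |t|^N, which is |f|^(1 - N/P) up to constants if
    v has order P; along the polar branch itself this is an equality, so
    l(c_i) = 1 - N/P.  Tangency of the polar roots, c_i(t) = O(t^N), follows from
    mini-regularity.

    Germs are treated as uniform limits of polynomials on a polydisc.  This class
    is closed under composition and uniform limits, and Cauchy's estimate
    for polynomials, an average over roots of unity, gives Taylor expansions,
    division and derivatives.  In the Newton-Puiseux theorem the usual Tschirnhaus
    shift is replaced by a shift along a root of F_x, obtained by induction on the
    order in x: it also kills a coefficient of the initial polynomial, which
    therefore has a root of smaller multiplicity. *)

Set Implicit Arguments.
Unset Strict Implicit.
Unset Printing Implicit Defensive.

Import Order.TTheory GRing.Theory Num.Theory numFieldNormedType.Exports.

Local Open Scope classical_set_scope.
Local Open Scope ring_scope.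

(** * Complex numbers *)

(** The closest root is the right centre because |c_i(t) - c_j(t)| <= 2 |x - c_j(t)| for every other
    root c_j: a bound on how c_i - c_j varies becomes a bound relative to the factor x - c_j(t)
    itself. The range |s| <= 2 |t| is what Cauchy's estimate on the disc of radius |t| about t sees.
    At fixed k, the t-derivative of f(k + c_i(t), t^N) is f_x c_i' + N t^(N-1) f_y; tangency gives t
    c_i' = O(t^N), so t times this derivative is O(|t|^N |grad f|), the source of the factor |t|^N.
    Tangency also gives P >= N m, hence 1 - N/P >= (m-1)/m: the exponent of the first alternative
    never exceeds that of a branch in Gamma. If v vanishes identically, comparability with v forces
    f(x, y) = 0, so such branches contribute nothing. Minimality of the exponent takes a single arc
    along which the gradient is O(|f|^L): the branch with the largest P, or t -> (t, 0) when Gamma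
    is empty. For an arbitrary gamma in Gamma, l(gamma) <= L follows from the same comparison, with
    the gradient inequality of exponent L tested on the arc of gamma. *)

(* [modulus] on [R[i]] itself: over [R[i]^o] the ring structure of [C] would be
   inferred in two different ways. *)
Definition cnorm (R : realType) (z : R[i]) : R := modulus z.

Reserved Notation "`‖ z ‖" (at level 0, z at level 99, format "`‖ z ‖").

Lemma cnorm_ge0 (R : realType) (z : R[i]) : 0 <= cnorm z.
Proof. by case: z => a b; apply: sqrtr_ge0. Qed.

#[local] Hint Extern 0 (is_true (@Order.le _ _ _ (cnorm _))) => exact: cnorm_ge0 : core.

Section ComplexModulus.
Variable R : realType.
Local Notation C := R[i].
Local Notation "`‖ z ‖" := (@cnorm R z).
Implicit Types (x y z : C).

Lemma cnormE (a b : R) : `‖Complex a b‖ = Num.sqrt (a ^+ 2 + b ^+ 2).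
Proof. by []. Qed.

Lemma normc_modulus z : `|z| = (`‖z‖%:C)%C.
Proof. by case: z. Qed.

Lemma cnormM x y : `‖x * y‖ = `‖x‖ * `‖y‖.
Proof. exact: Normc.normcM. Qed.

Lemma cnorm0 : `‖0‖ = 0.
Proof. exact: Normc.normc0. Qed.

Lemma cnorm1 : `‖1‖ = 1.
Proof. exact: Normc.normc1. Qed.

Lemma cnormN x : `‖- x‖ = `‖x‖.
Proof. by rewrite /cnorm /modulus normrN. Qed.

Lemma cnormD x y : `‖x + y‖ <= `‖x‖ + `‖y‖.
Proof. by have := ler_normD x y; rewrite !normc_modulus -rmorphD lecR. Qed.

Lemma cnormB x y : `‖x - y‖ <= `‖x‖ + `‖y‖.
Proof. by rewrite -(cnormN y) cnormD. Qed.

Lemma cdistC x y : `‖x - y‖ = `‖y - x‖.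
Proof. by rewrite -cnormN opprB. Qed.

Lemma cdistD z x y : `‖x - y‖ <= `‖x - z‖ + `‖z - y‖.
Proof. by rewrite -{1}(subrK z x) -addrA cnormD. Qed.

Lemma cnorm_le_dist x y : `‖x‖ <= `‖x - y‖ + `‖y‖.
Proof. by rewrite -{1}(subrK y x) cnormD. Qed.

Lemma cnorm_sum (I : Type) (s : seq I) (P : pred I) (u : I -> C) :
  `‖\sum_(i <- s | P i) u i‖ <= \sum_(i <- s | P i) `‖u i‖.
Proof.
elim/big_rec2: _ => [|i a b _ ab]; first by rewrite cnorm0.
by apply: (le_trans (cnormD _ _)); rewrite lerD2l.
Qed.

Lemma cnormX x n : `‖x ^+ n‖ = `‖x‖ ^+ n.
Proof. by elim: n => [|n IH]; rewrite ?expr0 ?cnorm1 // !exprS cnormM IH. Qed.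

Lemma cnormV x : `‖x^-1‖ = `‖x‖^-1.
Proof. exact: Normc.normcV. Qed.

Lemma cnorm_prod (I : Type) (s : seq I) (P : pred I) (u : I -> C) :
  `‖\prod_(i <- s | P i) u i‖ = \prod_(i <- s | P i) `‖u i‖.
Proof.
by elim/big_rec2: _ => [|i a b _ <-]; rewrite ?cnorm1 // cnormM.
Qed.

Definition creal (r : R) : C := (r%:C)%C.

Lemma cnorm_real (r : R) : `‖creal r‖ = `|r|.
Proof. by rewrite cnormE expr0n addr0 sqrtr_sqr. Qed.

Lemma crealM (a b : R) : creal (a * b) = creal a * creal b.
Proof. exact: (rmorphM (real_complex R)). Qed.

Lemma creal_nat n : creal n%:R = n%:R.
Proof. exact: (rmorph_nat (real_complex R)). Qed.

Lemma cnorm_nat n : `‖n%:R‖ = n%:R.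
Proof.
by rewrite -creal_nat cnorm_real ger0_norm.
Qed.

Lemma cnorm_gt0 x : (0 < `‖x‖) = (x != 0).
Proof.
by rewrite -(normr_gt0 x) normc_modulus ltcR.
Qed.

Lemma cnorm_ge_Re z : `|complex.Re z| <= `‖z‖.
Proof. by have := normc_ge_Re z; rewrite lecR. Qed.

Lemma cnorm_ge_Im z : `|complex.Im z| <= `‖z‖.
Proof.
case: z => a b; rewrite cnormE /=.
by rewrite -sqrtr_sqr ler_wsqrtr // lerDr sqr_ge0.
Qed.

Lemma cnorm_le_ReIm (a b : R) : `‖(Complex a b)‖ <= `|a| + `|b|.
Proof.
have -> : (Complex a b : C) = creal a + (Complex 0 b : C).
  by apply/eqP; rewrite eq_complex /= addr0 add0r !eqxx.
apply: (le_trans (cnormD _ _)); rewrite cnorm_real lerD2l.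
by rewrite cnormE expr0n add0r sqrtr_sqr.
Qed.

(** Weaker than convergence to 0, and exactly what it takes to pass to the limit in an inequality
    that holds at every index. *)
Definition vanishing (e : nat -> R) := forall d, 0 < d -> exists k, e k <= d.

(** The limit is the supremum of the lower bounds [u k - e k]: the hypothesis makes every
    [u l + e l] an upper bound of them. *)
Lemma vanishing_limit_real (u e : nat -> R) : vanishing e ->
  (forall k l, `|u k - u l| <= e k + e l) ->
  exists s, forall k, `|u k - s| <= e k.
Proof.
move=> e0 ue; pose A := [set u k - e k | k in setT].
have ubA l : ubound A (u l + e l).
  move=> _ [k _ <-]; have := ue k l; rewrite ler_norml => /andP[_]; lra.
have A0 : A !=set0 by exists (u 0%N - e 0%N), 0%N.
exists (sup A) => k; rewrite ler_norml; apply/andP; split.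
  have : sup A <= u k + e k by apply: sup_le_ub => //; apply: ubA.
  lra.
have : u k - e k <= sup A.
  by apply: ub_le_sup; [exists (u 0%N + e 0%N); apply: ubA|exists k].
lra.
Qed.

Lemma vanishing_le (e : nat -> R) (a b : R) : vanishing e ->
  (forall k, a <= b + e k) -> a <= b.
Proof.
move=> e0 ab; apply/ler_addgt0Pr => d /e0[k ek].
exact: (le_trans (ab k)) (lerD _ ek).
Qed.

Lemma vanishing_limit (u : nat -> C) (e : nat -> R) : vanishing e ->
  (forall k l, `‖u k - u l‖ <= e k + e l) ->
  exists s, forall k, `‖u k - s‖ <= e k.
Proof.
move=> e0 ue.
have [s1 h1] : exists s, forall k, `|complex.Re (u k) - s| <= e k.
  apply: vanishing_limit_real => // k l; apply: le_trans (ue k l).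
  rewrite -raddfB; exact: cnorm_ge_Re.
have [s2 h2] : exists s, forall k, `|complex.Im (u k) - s| <= e k.
  apply: vanishing_limit_real => // k l; apply: le_trans (ue k l).
  rewrite -raddfB; exact: cnorm_ge_Im.
exists (Complex s1 s2) => k.
have us j : `‖u j - Complex s1 s2‖ <= e j + e j.
  have -> : u j - Complex s1 s2 = Complex (complex.Re (u j) - s1) (complex.Im (u j) - s2).
    by case: (u j).
  by apply: (le_trans (cnorm_le_ReIm _ _)); apply: lerD.
(* Real and imaginary parts together only give an error [2 * e j]. Going from [u k] to the limit
   through [u j] costs [e k + 3 * e j], and [e j] can be made arbitrarily small. *)
apply: (@vanishing_le (fun j => 3 * e j)) => [d d0|j].
  by have [j ej] := e0 (d / 3) (divr_gt0 d0 (ltr0Sn _ _)); exists j; lra.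
have := cdistD (u j) (u k) (Complex s1 s2).
have := us j; have := ue k j; lra.
Qed.

Lemma vanishing_harmonic : vanishing (fun k => k.+1%:R^-1).
Proof.
move=> d d0; exists (Num.truncn d^-1).
rewrite -[leRHS]invrK lef_pV2 ?posrE ?invr_gt0 ?ltr0Sn //.
by apply/ltW; rewrite truncnS_gt.
Qed.

Lemma vanishing_geometric (c q : R) : 0 <= c -> 0 <= q <= 2^-1 ->
  vanishing (fun k => c * q ^+ k).
Proof.
move=> c0 /andP[q0 q1] d d0.
have [k hk] := vanishing_harmonic (divr_gt0 d0 (ltr_wpDl c0 ltr01)).
exists k; have : q ^+ k <= k.+1%:R^-1.
  apply: (@le_trans _ _ (2^-1 ^+ k)); first by rewrite lerXn2r ?nnegrE ?invr_ge0.
  rewrite exprVn lef_pV2 ?posrE ?exprn_gt0 ?ltr0Sn // -natrX ler_nat.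
  exact: ltn_expl.
rewrite lter_pdivlMr ?ltr_wpDl // mulrC in hk => qk.
apply: le_trans hk; apply: ler_pM; rewrite ?exprn_ge0 //; lra.
Qed.

Lemma sum_geometric_le (q : R) n N : 0 <= q <= 2^-1 ->
  \sum_(n <= i < N) q ^+ i <= 2 * q ^+ n.
Proof.
move=> /andP[q0 q1]; have [nN|Nn] := leqP n N; last first.
  by rewrite big_geq ?mulr_ge0 ?exprn_ge0 // ltnW.
(* The subtracted term makes the induction close: its step is q^N <= 2 q^N - 2 q^(N+1), that is, q
   <= 1/2. *)
suff : \sum_(n <= i < N) q ^+ i <= 2 * q ^+ n - 2 * q ^+ N.
  by have := exprn_ge0 N q0; lra.
elim: N nN => [|N IH].
  by rewrite leqn0 => /eqP ->; rewrite big_geq // subrr.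
rewrite leq_eqVlt => /orP[/eqP->|]; first by rewrite big_geq // subrr.
rewrite ltnS => nN; rewrite big_nat_recr //=.
have : 0 <= q ^+ N * (2^-1 - q) by rewrite mulr_ge0 ?exprn_ge0 ?subr_ge0.
have := IH nN; rewrite exprS; lra.
Qed.

Lemma cnth_root_exists (y : C) N : (0 < N)%N -> exists t, t ^+ N = y.
Proof.
move=> N0; pose p : {poly C} := 'X^N - y%:P.
have /closed_rootP[t] : size p != 1%N.
  by rewrite size_XnsubC // eqSS -lt0n.
by rewrite /root !hornerE subr_eq0 => /eqP <-; exists t.
Qed.

(** Since n is nonzero in C, X^n - 1 is separable and has n distinct roots; n distinct n-th roots of
    unity in a field include a primitive one. *)
Lemma C_primitive_root_exists n : (0 < n)%N -> exists w : C, n.-primitive_root w.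
Proof.
pose p : {poly C} := 'X^n - 1; have [r Dp] := closed_field_poly_normal p.
move=> n_gt0; rewrite (monicP _) ?monicXnsubC // scale1r in Dp.
have rn1 : all n.-unity_root r by apply/allP=> z; rewrite -root_prod_XsubC -Dp.
have sz_r : (n < (size r).+1)%N.
  by rewrite -(size_prod_XsubC r id) -Dp size_XnsubC.
have [|z _ hz] := hasP (has_prim_root n_gt0 rn1 _ sz_r); last by exists z.
rewrite -separable_prod_XsubC -Dp separable_Xn_sub_1 //.
by rewrite -cnorm_gt0 cnorm_nat ltr0n.
Qed.

(* Averaging p(rho w^j) w^(-jk) over the N-th roots of unity w^j isolates the
   k-th term, which gives Cauchy's estimate without integration. *)
Lemma poly_cauchy_estimate (p : {poly C}) (rho B : R) k : 0 < rho ->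
  (forall h, `‖h‖ <= rho -> `‖p.[h]‖ <= B) -> `‖p`_k‖ * rho ^+ k <= B.
Proof.
move=> rho0 pB.
have B0 : 0 <= B by apply: le_trans (cnorm_ge0 _) (pB 0 _); rewrite cnorm0 ltW.
have [kp|pk] := ltnP k (size p); last first.
  by rewrite nth_default // cnorm0 mul0r.
set N := size p in kp.
have N0 : (0 < N)%N by apply: leq_ltn_trans kp.
have [w wp] := C_primitive_root_exists N0.
have w1 : `‖w‖ = 1.
  apply/eqP; rewrite -(@pexpr_eq1 _ _ N) // -cnormX (prim_expr_order wp).
  by rewrite cnorm1.
have wn0 : w != 0 by rewrite -cnorm_gt0 w1.
pose z j : C := creal rho * w ^+ j.
have zr j : `‖z j‖ = rho.
  by rewrite /z cnormM cnormX w1 expr1n mulr1 cnorm_real gtr0_norm.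
have key : \sum_(j < N) p.[z j] * w ^- (j * k) =
    N%:R * (p`_k * creal rho ^+ k).
  under eq_bigr => j _ do rewrite horner_coef mulr_suml.
  rewrite exchange_big /= (bigD1 (Ordinal kp)) //= [X in _ + X]big1.
    rewrite addr0 (eq_bigr (fun=> p`_k * creal rho ^+ k)).
      by rewrite sumr_const card_ord mulr_natl.
    move=> j _; rewrite /z exprMn -exprM mulrA mulfK //.
    by rewrite expf_neq0.
  move=> i ik; pose q := w ^+ i / w ^+ k.
  have q1 : q != 1.
    apply/eqP => /(congr1 (fun a => a * w ^+ k)).
    rewrite /q divfK ?expf_neq0 // mul1r => /eqP.
    rewrite (eq_prim_root_expr wp) !modn_small // => /eqP e.
    by case/eqP: ik; apply: val_inj.
  have qN : q ^+ N = 1.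
    rewrite /q expr_div_n -!exprM mulnC exprM (prim_expr_order wp) expr1n.
    by rewrite mulnC exprM (prim_expr_order wp) expr1n divr1.
  have sq : \sum_(j < N) q ^+ j = 0.
    apply/eqP; rewrite -(mulrI_eq0 _ (mulfI (_ : q - 1 != 0))) ?subr_eq0 //.
    by rewrite -subrX1 qN subrr.
  rewrite (eq_bigr (fun j : 'I_N => p`_i * creal rho ^+ i * q ^+ j)).
    by rewrite -mulr_sumr sq mulr0.
  move=> j _; rewrite /z /q expr_div_n exprMn -!exprM [(j * i)%N]mulnC.
  by rewrite [(j * k)%N]mulnC !mulrA.
have := congr1 (fun y => `‖y‖) key.
rewrite !cnormM cnorm_nat cnormX cnorm_real (gtr0_norm rho0) => E.
have : N%:R * (`‖p`_k‖ * rho ^+ k) <= N%:R * B.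
  rewrite -E; apply: (le_trans (cnorm_sum _ _ _)).
  rewrite mulr_natl -[N in leRHS]card_ord -sumr_const; apply: ler_sum => j _.
  rewrite cnormM cnormV cnormX w1 expr1n invr1 mulr1.
  by apply: pB; rewrite zr.
by rewrite ler_pM2l ?ltr0n.
Qed.

End ComplexModulus.

(** * Uniform limits of polynomials *)

Section UniformApproximation.
Variable R : realType.
Local Notation C := R[i].
Local Notation "`‖ z ‖" := (@cnorm R z).
Implicit Types (x y z h : C) (F G H P Q : C -> C -> C).

Inductive polyfun : (C -> C -> C) -> Prop :=
| polyfun_const a : polyfun (fun _ _ => a)
| polyfun_fst : polyfun (fun x _ => x)
| polyfun_snd : polyfun (fun _ y => y)
| polyfunD P Q : polyfun P -> polyfun Q -> polyfun (fun x y => P x y + Q x y)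
| polyfunM P Q : polyfun P -> polyfun Q -> polyfun (fun x y => P x y * Q x y).

Lemma polyfun_sum (I : Type) (s : seq I) (P : I -> C -> C -> C) :
  (forall i, polyfun (P i)) -> polyfun (fun x y => \sum_(i <- s) P i x y).
Proof.
move=> Ps; elim: s => [|i s IH].
  suff -> : (fun x y => \sum_(i <- [::]) P i x y) = (fun _ _ => 0) by constructor.
  by apply/funext => x; apply/funext => y; rewrite big_nil.
suff -> : (fun x y => \sum_(j <- i :: s) P j x y) =
  (fun x y => P i x y + \sum_(j <- s) P j x y) by constructor.
by apply/funext => x; apply/funext => y; rewrite big_cons.
Qed.

(** Bound and Lipschitz constant are obtained in one induction, because the Lipschitz constant of a
    product involves the bounds of both factors. *)
Lemma polyfun_lipschitz P (r : R) : polyfun P -> exists M K : R, [/\ 0 <= M, 0 <= K,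
  forall x y, `‖x‖ <= r -> `‖y‖ <= r -> `‖P x y‖ <= M &
  forall x y x' y', `‖x‖ <= r -> `‖y‖ <= r -> `‖x'‖ <= r -> `‖y'‖ <= r ->
    `‖P x y - P x' y'‖ <= K * (`‖x - x'‖ + `‖y - y'‖)].
Proof.
elim => [a|||{}P Q _ [M1 [K1 [M10 K10 bP lP]]] _ [M2 [K2 [M20 K20 bQ lQ]]]
  |{}P Q _ [M1 [K1 [M10 K10 bP lP]]] _ [M2 [K2 [M20 K20 bQ lQ]]]].
- exists `‖a‖, 0; split=> // *.
  by rewrite subrr cnorm0 mul0r.
- exists `|r|, 1; split=> // [x y xr _|x y x' y' _ _ _ _].
    by apply: le_trans xr _; rewrite ler_norm.
  by rewrite mul1r lerDl.
- exists `|r|, 1; split=> // [x y _ yr|x y x' y' _ _ _ _].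
    by apply: le_trans yr _; rewrite ler_norm.
  by rewrite mul1r lerDr.
- exists (M1 + M2), (K1 + K2); split; rewrite ?addr_ge0 // => x y.
    by move=> xr yr; apply: (le_trans (cnormD _ _)); rewrite lerD ?bP ?bQ.
  move=> x' y' xr yr xr' yr'; rewrite opprD addrACA mulrDl.
  by apply: (le_trans (cnormD _ _)); rewrite lerD ?lP ?lQ.
- exists (M1 * M2), (K1 * M2 + M1 * K2); split.
  + exact: mulr_ge0.
  + by rewrite addr_ge0 ?mulr_ge0.
  + by move=> x y xr yr; rewrite cnormM ler_pM ?bP ?bQ.
  move=> x y x' y' xr yr xr' yr'.
  have -> : P x y * Q x y - P x' y' * Q x' y' =
    (P x y - P x' y') * Q x y + P x' y' * (Q x y - Q x' y') by ring.
  apply: (le_trans (cnormD _ _)); rewrite !cnormM mulrDl lerD //.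
    by rewrite mulrAC ler_pM ?lP ?bQ.
  by rewrite -mulrA ler_pM ?lQ ?bP.
Qed.

(** Re-expansion at x. The coefficients are again polynomial in (x, y), which is why the Taylor
    coefficients of a uniform limit are themselves uniform limits of polynomials. *)
Lemma polyfun_shift P : polyfun P -> exists p : C -> C -> {poly C},
  [/\ exists n, forall x y, (size (p x y) <= n)%N,
      forall i, polyfun (fun x y => (p x y)`_i) &
      forall x y h, P (x + h) y = (p x y).[h]].
Proof.
elim=> [a|||{}P Q _ [p [[n pn] pp pE]] _ [q [[m qm] qp qE]]
  |{}P Q _ [p [[n pn] pp pE]] _ [q [[m qm] qp qE]]].
- exists (fun _ _ => a%:P); split; first by exists 1%N => *; apply: size_polyC_leq1.
    by move=> i; constructor.
  by move=> x y h; rewrite hornerC.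
- exists (fun x _ => 'X + x%:P); split.
  + exists 2%N => x _; apply: (leq_trans (size_polyD _ _)).
    by rewrite size_polyX geq_max leqnn (leq_trans (size_polyC_leq1 _)).
  + move=> [|i].
      have -> : (fun x _ : C => ('X + x%:P)`_0) = (fun x _ => x).
        by apply/funext => x; apply/funext => y; rewrite coefD coefX coefC add0r.
      by constructor.
    have -> : (fun x _ : C => ('X + x%:P)`_i.+1) = (fun _ _ => ('X)`_i.+1).
      by apply/funext => x; apply/funext => y; rewrite coefD coefC addr0.
    by constructor.
  + by move=> x y h; rewrite !hornerE addrC.
- exists (fun _ y => y%:P); split; first by exists 1%N => *; apply: size_polyC_leq1.
    move=> [|i].
      have -> : (fun _ y : C => (y%:P)`_0) = (fun _ y => y).
        by apply/funext => x; apply/funext => y; rewrite coefC.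
      by constructor.
    have -> : (fun _ y : C => (y%:P)`_i.+1) = (fun _ _ => 0).
      by apply/funext => x; apply/funext => y; rewrite coefC.
    by constructor.
  by move=> x y h; rewrite hornerC.
- exists (fun x y => p x y + q x y); split.
  + exists (maxn n m) => x y; apply: (leq_trans (size_polyD _ _)).
    by rewrite geq_max !leq_max pn qm orbT.
  + move=> i; have -> : (fun x y => (p x y + q x y)`_i) =
      (fun x y => (p x y)`_i + (q x y)`_i).
      by apply/funext => x; apply/funext => y; rewrite coefD.
    by constructor.
  + by move=> x y h; rewrite pE qE hornerD.
- exists (fun x y => p x y * q x y); split.
  + exists (n + m)%N => x y; apply: (leq_trans (size_polyMleq _ _)).
    by apply: (leq_trans (leq_pred _)); rewrite leq_add.
  + move=> i; have -> : (fun x y => (p x y * q x y)`_i) =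
      (fun x y => \sum_(j < i.+1) (p x y)`_j * (q x y)`_(i - j)).
      by apply/funext => x; apply/funext => y; rewrite coefM.
    by apply: polyfun_sum => j; constructor.
  + by move=> x y h; rewrite pE qE hornerM.
Qed.

Definition uapprox (r : R) (F : C -> C -> C) := forall e, 0 < e ->
  exists2 P, polyfun P &
    forall x y, `‖x‖ <= r -> `‖y‖ <= r -> `‖F x y - P x y‖ <= e.

Lemma uapprox_polyfun r P : polyfun P -> uapprox r P.
Proof.
by move=> Pp e e0; exists P => // *; rewrite subrr cnorm0 ltW.
Qed.

Lemma uapprox_le r s F : s <= r -> uapprox r F -> uapprox s F.
Proof.
move=> sr Fr e e0; have [P Pp PF] := Fr e e0; exists P => // x y xs ys.
by apply: PF; [apply: le_trans xs sr|apply: le_trans ys sr].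
Qed.

Lemma uapprox_bounded r F : uapprox r F -> exists2 M, 0 < M &
  forall x y, `‖x‖ <= r -> `‖y‖ <= r -> `‖F x y‖ <= M.
Proof.
move=> Fr; have [P Pp PF] := Fr 1 ltr01.
have [M [_ [M0 _ bP _]]] := polyfun_lipschitz r Pp.
exists (1 + M); first lra.
move=> x y xr yr; rewrite -[F x y](subrK (P x y)).
by apply: (le_trans (cnormD _ _)); rewrite lerD ?PF ?bP.
Qed.

Lemma uapprox_lim r F : (forall e, 0 < e -> exists2 G, uapprox r G &
    forall x y, `‖x‖ <= r -> `‖y‖ <= r -> `‖F x y - G x y‖ <= e) ->
  uapprox r F.
Proof.
move=> Fl e e0; have e20 : 0 < e / 2 by rewrite divr_gt0.
have [G Gr FG] := Fl _ e20; have [P Pp GP] := Gr _ e20; exists P => // x y xr yr.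
have := cdistD (G x y) (F x y) (P x y); have := FG _ _ xr yr.
have := GP _ _ xr yr; lra.
Qed.

Lemma uapprox_comp r s F X Y : uapprox r F -> uapprox s X -> uapprox s Y ->
  (forall x y, `‖x‖ <= s -> `‖y‖ <= s -> `‖X x y‖ <= r /\ `‖Y x y‖ <= r) ->
  uapprox s (fun x y => F (X x y) (Y x y)).
Proof.
move=> Fr Xs Ys XYr e e0; have e20 : 0 < e / 2 by rewrite divr_gt0.
have [P Pp PF] := Fr _ e20.
(* The approximations of [X] and [Y] may leave the polydisc of radius [r], but by at most [d <= 1];
   hence the Lipschitz constant on radius [r + 1]. *)
have [_ [K [_ K0 _ lP]]] := polyfun_lipschitz (r + 1) Pp.
pose d := Num.min 1 (e / 4 / (K + 1)).
have d0 : 0 < d.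
  by rewrite lt_min ltr01 !divr_gt0 // ltr_wpDl.
have d1 : d <= 1 by rewrite ge_min lexx.
have Kd : K * (d + d) <= e / 2.
  have : d * (K + 1) <= e / 4.
    by rewrite -ler_pdivlMr ?ltr_wpDl // ge_min lexx orbT.
  by have := d0; nra.
have [X' Xp XX] := Xs _ d0; have [Y' Yp YY] := Ys _ d0.
have PXY : polyfun (fun x y => P (X' x y) (Y' x y)).
  by elim: Pp => [a|||? ? _ ? _ ?|? ? _ ? _ ?] //; constructor.
exists (fun x y => P (X' x y) (Y' x y)) => // x y xs ys.
have [Xr Yr] := XYr x y xs ys.
have X1 := XX _ _ xs ys; have Y1 := YY _ _ xs ys.
have Xr' : `‖X' x y‖ <= r + 1.
  have := cnormB (X x y) (X x y - X' x y); rewrite opprB addrC subrK; lra.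
have Yr' : `‖Y' x y‖ <= r + 1.
  have := cnormB (Y x y) (Y x y - Y' x y); rewrite opprB addrC subrK; lra.
apply: (le_trans (cdistD (P (X x y) (Y x y)) _ _)).
rewrite [e in leRHS](splitr e) lerD ?PF //.
apply: le_trans Kd; apply: (le_trans (lP _ _ _ _ _ _ _ _)) => //; try lra.
by rewrite ler_wpM2l // lerD.
Qed.

Lemma uapproxD r F G : uapprox r F -> uapprox r G ->
  uapprox r (fun x y => F x y + G x y).
Proof.
move=> Fr Gr; have [M M0 bF] := uapprox_bounded Fr.
have [N N0 bG] := uapprox_bounded Gr.
apply: (@uapprox_comp (Num.max M N) r (fun x y => x + y)) => //.
  by apply: uapprox_polyfun; do !constructor.
by move=> x y xr yr; rewrite !le_max bF ?bG ?orbT.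
Qed.

Lemma uapproxM r F G : uapprox r F -> uapprox r G ->
  uapprox r (fun x y => F x y * G x y).
Proof.
move=> Fr Gr; have [M M0 bF] := uapprox_bounded Fr.
have [N N0 bG] := uapprox_bounded Gr.
apply: (@uapprox_comp (Num.max M N) r (fun x y => x * y)) => //.
  by apply: uapprox_polyfun; do !constructor.
by move=> x y xr yr; rewrite !le_max bF ?bG ?orbT.
Qed.

(** The disc lies in the x-direction, with y frozen, so Cauchy's estimate stays a one-variable one;
    [rho] and [B] may depend on the point. *)
Definition locally_bounded F (rho B : R) x y :=
  forall h, `‖h‖ <= rho -> `‖F (x + h) y‖ <= B.

Lemma horner_tail_le (p : {poly C}) (rho B : R) n h : 0 < rho -> 0 <= B ->
  (forall k, `‖p`_k‖ * rho ^+ k <= B) -> `‖h‖ <= rho / 2 ->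
  `‖p.[h] - \sum_(i < n) p`_i * h ^+ i‖ <= 2 * B * (`‖h‖ / rho) ^+ n.
Proof.
move=> rho0 B0 pB hrho; set q := `‖h‖ / rho.
have q12 : 0 <= q <= 2^-1.
  by rewrite divr_ge0 ?(ltW rho0) //= /q ler_pdivrMr // mulrC.
have term i : `‖p`_i * h ^+ i‖ <= B * q ^+ i.
  rewrite cnormM cnormX /q expr_div_n mulrA [leRHS]mulrAC ler_wpM2r ?exprn_ge0 //.
  by rewrite ler_pdivlMr ?exprn_gt0.
set N := maxn n (size p).
have -> : p.[h] = \sum_(0 <= i < N) p`_i * h ^+ i.
  rewrite (horner_coef_wide _ (leq_maxr n _)).
  by rewrite big_mkord.
rewrite -(big_mkord xpredT (fun i => p`_i * h ^+ i)).
rewrite (big_cat_nat _ (leq_maxl n (size p))) //= addrAC subrr add0r.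
apply: (le_trans (cnorm_sum _ _ _)).
apply: (@le_trans _ _ (\sum_(n <= i < N) B * q ^+ i)).
  by apply: ler_sum => i _; apply: term.
by rewrite -mulr_sumr [2 * B]mulrC -mulrA ler_wpM2l // sum_geometric_le.
Qed.

End UniformApproximation.

(** * Taylor expansion in x of a uniform limit of polynomials *)

Section LocalTaylor.
Variable R : realType.
Local Notation C := R[i].
Local Notation "`‖ z ‖" := (@cnorm R z).
Implicit Types (x y z h : C) (F G H P Q : C -> C -> C).

Lemma local_cauchy_coef F (p : {poly C}) (x y : C) (rho B e : R) i : 0 < rho ->
  locally_bounded F rho B x y ->
  (forall h, `‖h‖ <= rho -> `‖F (x + h) y - p.[h]‖ <= e) ->
  `‖p`_i‖ * rho ^+ i <= B + e.
Proof.
move=> rho0 FB Fp; apply: poly_cauchy_estimate => // h hr.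
rewrite -[p.[h]](subKr (F (x + h) y)).
by apply: (le_trans (cnormB _ _)); rewrite lerD ?FB ?Fp.
Qed.

(** Two scales are kept apart: the polynomials converge on the fixed radius [r], while [rho] and [B]
    describe [F] near one point. Only the latter enter the conclusion, so that Cauchy's estimate can
    later be applied on discs shrinking with the point. *)
Lemma local_taylor_of_limit F (p : nat -> {poly C}) (a : nat -> C) (x y : C)
    (r rho B : R) (e : nat -> R) :
  0 < rho <= r -> vanishing e -> locally_bounded F rho B x y ->
  (forall k h, `‖h‖ <= r -> `‖F (x + h) y - (p k).[h]‖ <= e k) ->
  (forall k i, `‖(p k)`_i - a i‖ * r ^+ i <= e k) ->
  (forall i, `‖a i‖ * rho ^+ i <= B) /\
  forall n h, `‖h‖ <= rho / 2 ->
    `‖F (x + h) y - \sum_(i < n) a i * h ^+ i‖ <= 2 * B * (`‖h‖ / rho) ^+ n.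
Proof.
move=> /andP[rho0 rhor] ev FB Fp pa.
have r0 : 0 < r by apply: lt_le_trans rhor.
have Fp' k h : `‖h‖ <= rho -> `‖F (x + h) y - (p k).[h]‖ <= e k.
  by move=> hr; apply: Fp; apply: le_trans hr rhor.
have pB k i : `‖(p k)`_i‖ * rho ^+ i <= B + e k.
  exact: local_cauchy_coef rho0 FB (Fp' k).
have e0 k : 0 <= e k.
  by apply: le_trans (cnorm_ge0 _) (Fp k 0 _); rewrite cnorm0 ltW.
have B0 : 0 <= B.
  by apply: le_trans (cnorm_ge0 _) (FB 0 _); rewrite cnorm0 ltW.
have ev3 c : 0 <= c -> vanishing (fun k => c * e k).
  move=> c0 d d0; have [k ek] := ev (d / (c + 1)) (divr_gt0 d0 (ltr_wpDl c0 ltr01)).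
  exists k; rewrite ler_pdivlMr ?ltr_wpDl // in ek.
  have := e0 k; nra.
split=> [i|n h hr].
  apply: (vanishing_le (ev3 2 _)) => // k; rewrite mulrDl mul1r.
  have pai : `‖(p k)`_i - a i‖ * rho ^+ i <= e k.
    apply: le_trans (pa k i); rewrite ler_wpM2l // lerXn2r ?nnegrE ?(ltW rho0) //.
    exact: ltW.
  rewrite addrA -{1}[a i](subKr (p k)`_i).
  apply: le_trans (lerD (pB k i) pai).
  by rewrite -mulrDl ler_wpM2r ?exprn_ge0 ?(ltW rho0) // cnormB.
have hr' : `‖h‖ <= rho by lra.
set q := `‖h‖ / rho.
have q12 : 0 <= q <= 2^-1.
  by rewrite divr_ge0 ?(ltW rho0) //= /q ler_pdivrMr // mulrC.
have q1 : q ^+ n <= 1.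
  by case/andP: q12 => q0 q1; apply: exprn_ile1 => //; lra.
have q0 : 0 <= q ^+ n by apply: exprn_ge0; case/andP: q12.
apply: (vanishing_le (ev3 5 _)) => // k.
have T1 := Fp' k h hr'.
have T2 := horner_tail_le n rho0 (addr_ge0 B0 (e0 k)) (pB k) hr.
have T3 : `‖\sum_(i < n) (p k)`_i * h ^+ i - \sum_(i < n) a i * h ^+ i‖ <= 2 * e k.
  rewrite -sumrB; apply: (@le_trans _ _ (\sum_(i < n) e k * q ^+ i)).
    apply: (le_trans (cnorm_sum _ _ _)); apply: ler_sum => i _.
    rewrite -mulrBl cnormM cnormX /q expr_div_n mulrA [leRHS]mulrAC.
    rewrite ler_wpM2r ?exprn_ge0 // ler_pdivlMr ?exprn_gt0 //.
    apply: le_trans (pa k i); rewrite ler_wpM2l // lerXn2r ?nnegrE ?(ltW rho0) //.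
    exact: ltW.
  rewrite -mulr_sumr mulrC ler_wpM2r //.
  rewrite -(big_mkord xpredT (fun i => q ^+ i)).
  by apply: (le_trans (sum_geometric_le _ _ q12)); rewrite mulr1.
set S1 := \sum_(i < n) (p k)`_i * h ^+ i in T2 T3.
have D1 := cdistD (p k).[h] (F (x + h) y) (\sum_(i < n) a i * h ^+ i).
have D2 := cdistD S1 (p k).[h] (\sum_(i < n) a i * h ^+ i).
have : 2 * (B + e k) * q ^+ n <= 2 * B * q ^+ n + 2 * e k.
  by rewrite mulrDr mulrDl lerD2l -[leRHS]mulr1 ler_wpM2l // mulr_ge0.
rewrite -/q in T2; lra.
Qed.

(** Cauchy's estimate applied to the difference of two approximating polynomials shows that their
    i-th coefficients converge uniformly, at rate [e k / r ^+ i]. The radius [2 * r] leaves room for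
    [x + h]. *)
Theorem uapprox_taylor r F : 0 < r -> uapprox (2 * r) F ->
  exists2 a : nat -> C -> C -> C, forall i, uapprox r (a i) &
  forall x y (rho B : R), `‖x‖ <= r -> `‖y‖ <= r -> 0 < rho <= r ->
    locally_bounded F rho B x y ->
    (forall i, `‖a i x y‖ * rho ^+ i <= B) /\
    forall n h, `‖h‖ <= rho / 2 ->
      `‖F (x + h) y - \sum_(i < n) a i x y * h ^+ i‖ <= 2 * B * (`‖h‖ / rho) ^+ n.
Proof.
move=> r0 Fr; pose e k : R := k.+1%:R^-1.
have e0 k : 0 < e k by rewrite invr_gt0 ltr0Sn.
have /choice[p pP] : forall k, exists p : C -> C -> {poly C},
    (forall i, polyfun (fun x y => (p x y)`_i)) /\
    forall x y h, `‖x‖ <= r -> `‖y‖ <= r -> `‖h‖ <= r ->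
      `‖F (x + h) y - (p x y).[h]‖ <= e k.
  move=> k; have [P Pp PF] := Fr (e k) (e0 k).
  have [p [_ pp pE]] := polyfun_shift Pp; exists p; split=> // x y h xr yr hr.
  rewrite -pE; apply: PF; last by apply: le_trans yr _; lra.
  by apply: (le_trans (cnormD _ _)); lra.
(* Inside the polydisc the set is inhabited and [xget] returns a limit; the default 0 can only occur
   outside. *)
pose a i x y := xget 0 [set s : C | forall k, `‖(p k x y)`_i - s‖ <= e k / r ^+ i].
have aP i x y k : `‖x‖ <= r -> `‖y‖ <= r -> `‖(p k x y)`_i - a i x y‖ <= e k / r ^+ i.
  move=> xr yr; suff : [set s : C | forall k, `‖(p k x y)`_i - s‖ <= e k / r ^+ i] !=set0.
    by move=> /xgetPex; apply.
  apply: vanishing_limit => [d d0|j l].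
    have [j ej] := vanishing_harmonic (mulr_gt0 d0 (exprn_gt0 i r0)).
    by exists j; rewrite ler_pdivrMr ?exprn_gt0.
  rewrite -mulrDl ler_pdivlMr ?exprn_gt0 // -coefB.
  apply: poly_cauchy_estimate => // h hr; rewrite hornerD hornerN.
  apply: (le_trans (cdistD (F (x + h) y) _ _)).
  rewrite lerD //; last by apply: (pP l).2.
  by rewrite cdistC; apply: (pP j).2.
exists a => [i|x y rho B xr yr rhor FB].
  apply: uapprox_lim => d d0.
  have [k ek] := vanishing_harmonic (mulr_gt0 d0 (exprn_gt0 i r0)).
  exists (fun x y => (p k x y)`_i); first by apply: uapprox_polyfun; apply: (pP k).1.
  move=> x y xr yr; rewrite cdistC; apply: (le_trans (aP _ _ _ k xr yr)).
  by rewrite ler_pdivrMr ?exprn_gt0.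
apply: (@local_taylor_of_limit F (p^~ x ^~ y) (a^~ x ^~ y) x y r rho B e) => //.
- exact: vanishing_harmonic.
- by move=> k h hr; apply: (pP k).2.
- by move=> k i; rewrite -ler_pdivlMr ?exprn_gt0 // aP.
Qed.

End LocalTaylor.

(** * Germs of analytic functions of two variables *)

Section AnalyticGerms.
Variable R : realType.
Local Notation C := R[i].
Local Notation "`‖ z ‖" := (@cnorm R z).
Implicit Types (x y z h : C) (F G H P Q : C -> C -> C).

(** Closed discs and polydiscs of real radius are the form in which the estimates produce
    neighbourhoods; [near1P] and [near2P] translate them into the filters of the statement. *)
Definition near1 (P : C -> Prop) :=
  exists2 r : R, 0 < r & forall x, `‖x‖ <= r -> P x.

Definition near2 (P : C -> C -> Prop) :=
  exists2 r : R, 0 < r & forall x y, `‖x‖ <= r -> `‖y‖ <= r -> P x y.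

Lemma near1_and (P Q : C -> Prop) :
  near1 P -> near1 Q -> near1 (fun x => P x /\ Q x).
Proof.
move=> [r r0 Pr] [s s0 Qs]; exists (Num.min r s); first by rewrite lt_min r0.
by move=> x; rewrite le_min => /andP[xr xs]; split; [apply: Pr|apply: Qs].
Qed.

Lemma near2_and (P Q : C -> C -> Prop) :
  near2 P -> near2 Q -> near2 (fun x y => P x y /\ Q x y).
Proof.
move=> [r r0 Pr] [s s0 Qs]; exists (Num.min r s); first by rewrite lt_min r0.
move=> x y; rewrite !le_min => /andP[xr xs] /andP[yr ys].
by split; [apply: Pr|apply: Qs].
Qed.

Lemma near1_mono (P Q : C -> Prop) : (forall x, P x -> Q x) -> near1 P -> near1 Q.
Proof. by move=> PQ [r r0 Pr]; exists r => // x /Pr/PQ. Qed.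

Lemma near2_mono (P Q : C -> C -> Prop) :
  (forall x y, P x y -> Q x y) -> near2 P -> near2 Q.
Proof. by move=> PQ [r r0 Pr]; exists r => // x y xr /(Pr _ _ xr)/PQ. Qed.

Lemma near1_le (r : R) : 0 < r -> near1 (fun x => `‖x‖ <= r).
Proof. by exists r. Qed.

Lemma near1_near2 (P : C -> Prop) : near1 P -> near2 (fun x _ => P x).
Proof. by move=> [r r0 Pr]; exists r => // x y /Pr. Qed.

Lemma near1_big_and n (P : nat -> C -> Prop) :
  (forall i, (i < n)%N -> near1 (P i)) ->
  near1 (fun x => forall i, (i < n)%N -> P i x).
Proof.
elim: n => [|n IH] Pn; first by exists 1.
have := near1_and (IH (fun i ni => Pn i (ltnW ni))) (Pn n (ltnSn n)).
apply: near1_mono => x [H1 H2] i; rewrite ltnS leq_eqVlt => /orP[/eqP->|] //.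
exact: H1.
Qed.

Definition an F := exists2 r : R, 0 < r & uapprox r F.
(** A one-variable germ is a two-variable germ that ignores its first argument, so that closure
    properties are proved once. *)
Definition an1 (c : C -> C) := an (fun _ y => c y).

Lemma an_const a : an (fun _ _ => a).
Proof. by exists 1 => //; apply: uapprox_polyfun; constructor. Qed.

Lemma an_fst : an (fun x _ => x).
Proof. by exists 1 => //; apply: uapprox_polyfun; constructor. Qed.

Lemma an_snd : an (fun _ y => y).
Proof. by exists 1 => //; apply: uapprox_polyfun; constructor. Qed.

Lemma an_common F G : an F -> an G ->
  exists r : R, [/\ 0 < r, uapprox r F & uapprox r G].
Proof.
move=> [r r0 Fr] [s s0 Gs]; exists (Num.min r s); split.
- by rewrite lt_min r0.
- by apply: uapprox_le Fr; rewrite ge_min lexx.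
- by apply: uapprox_le Gs; rewrite ge_min lexx orbT.
Qed.

Lemma anD F G : an F -> an G -> an (fun x y => F x y + G x y).
Proof.
move=> Fa Ga; have [r [r0 Fr Gr]] := an_common Fa Ga.
by exists r => //; apply: uapproxD.
Qed.

Lemma anM F G : an F -> an G -> an (fun x y => F x y * G x y).
Proof.
move=> Fa Ga; have [r [r0 Fr Gr]] := an_common Fa Ga.
by exists r => //; apply: uapproxM.
Qed.

Lemma anN F : an F -> an (fun x y => - F x y).
Proof.
have -> : (fun x y => - F x y) = (fun x y => -1 * F x y).
  by apply/funext => x; apply/funext => y; rewrite mulN1r.
exact/anM/an_const.
Qed.

Lemma anB F G : an F -> an G -> an (fun x y => F x y - G x y).
Proof. by move=> Fa /anN; apply: anD. Qed.

Lemma anX F n : an F -> an (fun x y => F x y ^+ n).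
Proof.
move=> Fa; elim: n => [|n IH]; first exact: an_const.
have -> : (fun x y => F x y ^+ n.+1) = (fun x y => F x y * F x y ^+ n).
  by apply/funext => x; apply/funext => y; rewrite exprS.
exact: anM.
Qed.

Lemma an_sum n (F : nat -> C -> C -> C) : (forall i, (i < n)%N -> an (F i)) ->
  an (fun x y => \sum_(i < n) F i x y).
Proof.
elim: n => [|n IH] Fa.
  have -> : (fun x y => \sum_(i < 0) F i x y) = (fun _ _ => 0).
    by apply/funext => x; apply/funext => y; rewrite big_ord0.
  exact: an_const.
have -> : (fun x y => \sum_(i < n.+1) F i x y) =
    (fun x y => \sum_(i < n) F i x y + F n x y).
  by apply/funext => x; apply/funext => y; rewrite big_ord_recr.
by apply: anD; [apply: IH => i ni; apply/Fa/ltnW|apply: Fa].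
Qed.

Lemma an_bounded F : an F -> exists2 M : R, 0 < M & near2 (fun x y => `‖F x y‖ <= M).
Proof.
by move=> [r r0 /uapprox_bounded[M M0 MF]]; exists M => //; exists r.
Qed.

Lemma an_cont0 F (e : R) : an F -> 0 < e -> near2 (fun x y => `‖F x y - F 0 0‖ <= e).
Proof.
move=> [r r0 Fr] e0; have [P Pp PF] := Fr (e / 4) (divr_gt0 e0 (ltr0Sn _ _)).
have [_ [K [_ K0 _ lP]]] := polyfun_lipschitz r Pp.
exists (Num.min r (e / 4 / (K + 1))).
  by rewrite lt_min r0 !divr_gt0 // ltr_wpDl.
move=> x y; rewrite !le_min => /andP[xr xe] /andP[yr ye].
rewrite ler_pdivlMr ?ltr_wpDl // in xe; rewrite ler_pdivlMr ?ltr_wpDl // in ye.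
have c0 : `‖0‖ <= r by rewrite cnorm0 ltW.
have := lP x y 0 0 xr yr c0 c0; rewrite !subr0 => h1.
have h2 := PF _ _ xr yr; have := PF _ _ c0 c0; rewrite cdistC => h3.
have := cdistD (P x y) (F x y) (F 0 0); have := cdistD (P 0 0) (P x y) (F 0 0).
have := cnorm_ge0 x; have := cnorm_ge0 y; nra.
Qed.

Lemma an_comp_radius X Y (r : R) : an X -> an Y -> X 0 0 = 0 -> Y 0 0 = 0 -> 0 < r ->
  near2 (fun x y => `‖X x y‖ <= r /\ `‖Y x y‖ <= r).
Proof.
move=> Xa Ya X0 Y0 r0; apply: near2_and.
  by have := an_cont0 Xa r0; apply: near2_mono => x y; rewrite X0 subr0.
by have := an_cont0 Ya r0; apply: near2_mono => x y; rewrite Y0 subr0.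
Qed.

Lemma an_comp F X Y : an F -> an X -> an Y -> X 0 0 = 0 -> Y 0 0 = 0 ->
  an (fun x y => F (X x y) (Y x y)).
Proof.
move=> [r r0 Fr] Xa Ya X0 Y0; have [s s0 XYs] := an_comp_radius Xa Ya X0 Y0 r0.
have [q [q0 Xq Yq]] := an_common Xa Ya; exists (Num.min s q).
  by rewrite lt_min s0.
apply: (@uapprox_comp _ r) => //.
- by apply: uapprox_le Xq; rewrite ge_min lexx orbT.
- by apply: uapprox_le Yq; rewrite ge_min lexx orbT.
- by move=> x y; rewrite !le_min => /andP[xs _] /andP[ys _]; apply: XYs.
Qed.

Lemma near2_comp (P : C -> C -> Prop) X Y : near2 P -> an X -> an Y ->
  X 0 0 = 0 -> Y 0 0 = 0 -> near2 (fun x y => P (X x y) (Y x y)).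
Proof.
move=> [r r0 Pr] Xa Ya X0 Y0; have := an_comp_radius Xa Ya X0 Y0 r0.
by apply: near2_mono => x y [hx hy]; apply: Pr.
Qed.

Lemma near1_comp2 (P : C -> C -> Prop) (X Y : C -> C) : near2 P -> an1 X -> an1 Y ->
  X 0 = 0 -> Y 0 = 0 -> near1 (fun t => P (X t) (Y t)).
Proof.
move=> Pn Xa Ya X0 Y0; have [r r0 Pr] := near2_comp Pn Xa Ya X0 Y0.
by exists r => // t; apply: (Pr 0); rewrite cnorm0 ltW.
Qed.

Lemma near1_comp (P : C -> Prop) (X : C -> C) : near1 P -> an1 X ->
  X 0 = 0 -> near1 (fun t => P (X t)).
Proof. by move=> /near1_near2 Pn Xa X0; apply: (near1_comp2 Pn Xa Xa). Qed.

Lemma near2_compr (P : C -> Prop) Y : near1 P -> an Y -> Y 0 0 = 0 ->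
  near2 (fun x y => P (Y x y)).
Proof. by move=> /near1_near2 Pn Ya Y0; apply: (near2_comp Pn Ya Ya). Qed.

Lemma an1_comp (c : C -> C) Y : an1 c -> an Y -> Y 0 0 = 0 ->
  an (fun x y => c (Y x y)).
Proof. by move=> ca Ya Y0; apply: (an_comp ca Ya Ya). Qed.

Lemma an1_fst (c : C -> C) : an1 c -> an (fun x _ => c x).
Proof. by move=> ca; apply: (an1_comp ca an_fst). Qed.

Lemma an_along F (X Y : C -> C) : an F -> an1 X -> an1 Y -> X 0 = 0 -> Y 0 = 0 ->
  an1 (fun t => F (X t) (Y t)).
Proof. by move=> Fa Xa Ya X0 Y0; apply: (an_comp Fa Xa Ya). Qed.

Lemma an1_id : an1 id.
Proof. exact: an_snd. Qed.

Lemma an1_cst a : an1 (fun=> a).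
Proof. exact: an_const. Qed.

Lemma an1X n : an1 (fun t => t ^+ n).
Proof. exact/anX/an_snd. Qed.

Lemma an1_cont0 (c : C -> C) (e : R) : an1 c -> 0 < e -> near1 (fun t => `‖c t - c 0‖ <= e).
Proof.
move=> ca e0; have [r r0 H] := an_cont0 ca e0; exists r => // t.
by apply: (H 0); rewrite cnorm0 ltW.
Qed.

Lemma an1_bounded (c : C -> C) : an1 c -> exists2 M : R, 0 < M & near1 (fun t => `‖c t‖ <= M).
Proof.
move=> /an_bounded[M M0 [r r0 H]]; exists M => //; exists r => // t.
by apply: (H 0); rewrite cnorm0 ltW.
Qed.

Lemma an1_unit (c : C -> C) : an1 c -> c 0 != 0 ->
  near1 (fun t => `‖c 0‖ / 2 <= `‖c t‖ /\ c t != 0).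
Proof.
move=> ca c0; have c00 : 0 < `‖c 0‖ by rewrite cnorm_gt0.
have := an1_cont0 ca (divr_gt0 c00 (ltr0Sn _ 1)); apply: near1_mono => t ct.
have h : `‖c 0‖ / 2 <= `‖c t‖.
  by have := cnorm_le_dist (c 0) (c t); rewrite cdistC; lra.
by split => //; rewrite -cnorm_gt0; lra.
Qed.

Lemma an_unit F : an F -> F 0 0 != 0 ->
  near2 (fun x y => `‖F 0 0‖ / 2 <= `‖F x y‖ /\ F x y != 0).
Proof.
move=> Fa F0; have F00 : 0 < `‖F 0 0‖ by rewrite cnorm_gt0.
have := an_cont0 Fa (divr_gt0 F00 (ltr0Sn _ 1)); apply: near2_mono => x y Fxy.
have h : `‖F 0 0‖ / 2 <= `‖F x y‖.
  by have := cnorm_le_dist (F 0 0) (F x y); rewrite cdistC; lra.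
by split => //; rewrite -cnorm_gt0; lra.
Qed.

Lemma an_taylor F : an F -> exists (r : R) (a : nat -> C -> C -> C),
  [/\ 0 < r, forall i, uapprox r (a i) &
  forall x y (rho B : R), `‖x‖ <= r -> `‖y‖ <= r -> 0 < rho <= r ->
    locally_bounded F rho B x y ->
    (forall i, `‖a i x y‖ * rho ^+ i <= B) /\
    forall n h, `‖h‖ <= rho / 2 ->
      `‖F (x + h) y - \sum_(i < n) a i x y * h ^+ i‖ <= 2 * B * (`‖h‖ / rho) ^+ n].
Proof.
move=> [r r0 Fr]; have r20 : 0 < r / 2 by rewrite divr_gt0.
have Fr2 : uapprox (2 * (r / 2)) F by rewrite mulrC divfK.
by have [a aa aP] := uapprox_taylor r20 Fr2; exists (r / 2), a.
Qed.

Lemma an_locally_bounded F : an F -> exists2 M : R, 0 < M & exists2 r : R, 0 < r &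
  forall x y rho, `‖x‖ <= r -> `‖y‖ <= r -> rho <= r -> locally_bounded F rho M x y.
Proof.
move=> /an_bounded[M M0 [r r0 H]]; exists M => //; exists (r / 2).
  by rewrite divr_gt0.
move=> x y rho xr yr rr h hr; apply: H; last lra.
by apply: (le_trans (cnormD _ _)); lra.
Qed.

(** Cauchy's estimate on radius rho gives |a_i| <= K rho^(n-i), which tends to 0 with rho.
    Uniqueness of Taylor coefficients and of derivatives rests on this. *)
Lemma poly_small_eq0 (a : nat -> C) n (K : R) :
  near1 (fun x => `‖\sum_(i < n) a i * x ^+ i‖ <= K * `‖x‖ ^+ n) ->
  forall i, (i < n)%N -> a i = 0.
Proof.
move=> [r r0 H] i ni; apply/eqP; rewrite -[_ == 0]negbK -cnorm_gt0 -leNgt.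
pose p := \poly_(j < n) a j.
have K0 : 0 <= K.
  have nr : `‖creal r‖ = r by rewrite cnorm_real gtr0_norm.
  have := H (creal r); rewrite nr lexx => /(_ isT) /(le_trans (cnorm_ge0 _)).
  by rewrite pmulr_lge0 ?exprn_gt0.
apply: (@vanishing_le _ (fun k => K * k.+1%:R^-1)) => [d d0|k].
  have [k hk] := vanishing_harmonic (divr_gt0 d0 (ltr_wpDl K0 ltr01)).
  exists k; rewrite ler_pdivlMr ?ltr_wpDl // in hk.
  have : 0 <= k.+1%:R^-1 :> R by rewrite invr_ge0.
  by rewrite mulrC in hk => k0; apply: le_trans hk; rewrite mulrDl mul1r lerDl.
rewrite add0r; pose rho : R := Num.min r k.+1%:R^-1.
have rho0 : 0 < rho by rewrite lt_min r0 invr_gt0 ltr0Sn.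
have rhok : rho <= k.+1%:R^-1 by rewrite ge_min lexx orbT.
have : `‖p`_i‖ * rho ^+ i <= K * rho ^+ n.
  apply: poly_cauchy_estimate => // h hr; rewrite horner_poly.
  apply: (le_trans (H h _)); first by apply: (le_trans hr); rewrite ge_min lexx.
  by rewrite ler_wpM2l // lerXn2r ?nnegrE // ltW.
rewrite coef_poly ni.
have -> : rho ^+ n = rho ^+ (n - i.+1).+1 * rho ^+ i.
  by rewrite -exprD addSnnS subnK.
rewrite mulrA ler_pM2r ?exprn_gt0 //.
move/le_trans; apply; rewrite ler_wpM2l // exprS.
apply: (le_trans _ rhok); rewrite ler_piMr ?(ltW rho0) // exprn_ile1 ?(ltW rho0) //.
by apply: (le_trans rhok); rewrite invf_le1 ?ler1n // ltr0n.
Qed.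

End AnalyticGerms.

Arguments an_fst {R}.
Arguments an_snd {R}.
Arguments an1_id {R}.
Arguments an1X {R} n.

(** * Division by powers of x, and the order of a germ *)

Section Division.
Variable R : realType.
Local Notation C := R[i].
Local Notation "`‖ z ‖" := (@cnorm R z).
Implicit Types (x y z h : C) (F G H P Q : C -> C -> C).

(** The quotient is taken pointwise, so the equation holds everywhere and not only near 0. Its value
    at x = 0 is the first Taylor coefficient, which makes the shifted Taylor sums converge to it
    uniformly: dividing the remainder by x costs one power of |x|. *)
Lemma an_div F : an F ->
  exists2 A, an A & forall x y, F x y = F 0 y + x * A x y.
Proof.
move=> Fa; have [r [a [r0 ar aP]]] := an_taylor Fa.
have [M M0 [s s0 FM]] := an_locally_bounded Fa.
pose rho : R := Num.min r s.
have rho0 : 0 < rho by rewrite lt_min r0.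
have rhor : rho <= r by rewrite ge_min lexx.
have rhos : rho <= s by rewrite ge_min lexx orbT.
pose A x y := if x == 0 then a 1%N 0 y else (F x y - F 0 y) / x.
exists A; last first.
  move=> x y; rewrite /A; have [->|x0] := eqVneq x 0; first by rewrite mul0r addr0.
  by rewrite mulrC divfK // addrC subrK.
have n0 (q : R) : 0 < q -> `‖0‖ <= q by move=> ?; rewrite cnorm0 ltW.
have TP y : `‖y‖ <= rho -> forall n x, `‖x‖ <= rho / 2 ->
    `‖F x y - \sum_(i < n) a i 0 y * x ^+ i‖ <= 2 * M * (`‖x‖ / rho) ^+ n.
  move=> yr n x xr; have yr' := le_trans yr rhor; have ys := le_trans yr rhos.
  have := (aP 0 y rho M (n0 _ r0) yr' _ (FM _ _ _ (n0 _ s0) ys rhos)).2 n x xr.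
  by rewrite add0r rho0 => ->.
have a0E y : `‖y‖ <= rho -> a 0%N 0 y = F 0 y.
  move=> yr; apply/esym/eqP; rewrite -subr_eq0 -[_ == 0]negbK -cnorm_gt0 -leNgt.
  have := TP y yr 1%N 0 (n0 _ (divr_gt0 rho0 (ltr0Sn _ 1))).
  by rewrite big_ord1 expr0 mulr1 cnorm0 mul0r expr1 mulr0.
exists (rho / 2); first by rewrite divr_gt0.
apply: uapprox_lim => e e0.
have c0 : 0 <= 2 * M / rho by rewrite divr_ge0 ?mulr_ge0 ?(ltW M0) ?(ltW rho0).
have h12 : 0 <= (2^-1 : R) <= 2^-1 by rewrite invr_ge0 ler0n lexx.
have [n hn] := vanishing_geometric c0 h12 e0.
exists (fun x y => \sum_(i < n.+1) a i.+1 0 y * x ^+ i).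
  elim: n.+1 => [|m IH].
    have -> : (fun x y => \sum_(i < 0) a i.+1 0 y * x ^+ i) = (fun _ _ => 0).
      by apply/funext => x; apply/funext => y; rewrite big_ord0.
    by apply: uapprox_polyfun; constructor.
  have -> : (fun x y => \sum_(i < m.+1) a i.+1 0 y * x ^+ i) =
     (fun x y => \sum_(i < m) a i.+1 0 y * x ^+ i + a m.+1 0 y * x ^+ m).
    by apply/funext => x; apply/funext => y; rewrite big_ord_recr.
  apply: uapproxD => //; apply: uapproxM.
    apply: (@uapprox_comp _ r _ (a m.+1) (fun _ _ => 0) (fun _ y => y)) => //.
    - by apply: uapprox_polyfun; constructor.
    - by apply: uapprox_polyfun; constructor.
    - by move=> _ y _ yr; rewrite n0 //; split=> //; apply: le_trans yr _; lra.
  elim: m {IH} => [|m IH].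
    have -> : (fun x _ : C => x ^+ 0) = (fun _ _ => 1) by [].
    by apply: uapprox_polyfun; constructor.
  have -> : (fun x _ : C => x ^+ m.+1) = (fun x _ => x * x ^+ m).
    by apply/funext => x; apply/funext => y; rewrite exprS.
  by apply: uapproxM => //; apply: uapprox_polyfun; constructor.
move=> x y xr yr; have yr' : `‖y‖ <= rho by apply: le_trans yr _; lra.
rewrite /A; have [->|x0] := eqVneq x 0.
  rewrite big_ord_recl expr0 mulr1 big1 ?addr0 ?subrr ?n0 // => i _.
  by rewrite exprS mul0r mulr0.
apply: le_trans hn.
have xp : 0 < `‖x‖ by rewrite cnorm_gt0.
have -> : (F x y - F 0 y) / x - \sum_(i < n.+1) a i.+1 0 y * x ^+ i =
    (F x y - \sum_(i < n.+2) a i 0 y * x ^+ i) / x.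
  rewrite [in RHS]big_ord_recl expr0 mulr1 a0E // opprD addrA [RHS]mulrBl.
  congr (_ - _); rewrite mulr_suml; apply: eq_bigr => i _.
  by rewrite (_ : lift ord0 i = i.+1 :> nat) // exprS [x * _]mulrC mulrA mulfK.
rewrite cnormM cnormV ler_pdivrMr //; apply: (le_trans (TP y yr' n.+2 x xr)).
have q1 : `‖x‖ / rho <= 2^-1 by rewrite ler_pdivrMr // mulrC.
have q0 : 0 <= `‖x‖ / rho by rewrite divr_ge0 // ltW.
rewrite exprS; have -> : 2 * M / rho * 2^-1 ^+ n * `‖x‖ =
  2 * M * (`‖x‖ / rho * 2^-1 ^+ n) by ring.
rewrite ler_wpM2l ?mulr_ge0 ?(ltW M0) // ler_wpM2l // exprS.
have t1 : (`‖x‖ / rho) ^+ n <= 2^-1 ^+ n by rewrite lerXn2r // nnegrE invr_ge0.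
apply: (le_trans _ t1); rewrite ler_piMl ?exprn_ge0 //; lra.
Qed.

Lemma an_divn F n : an F -> exists (a : nat -> C -> C) (A : C -> C -> C),
  [/\ forall i, an1 (a i), an A &
      forall x y, F x y = \sum_(i < n) a i y * x ^+ i + x ^+ n * A x y].
Proof.
move=> Fa; elim: n => [|n [a [A [aa Aa FE]]]].
  exists (fun _ _ => 0), F; split=> // [_|x y]; first exact: an_const.
  by rewrite big_ord0 add0r mul1r.
have [A' Aa' AE] := an_div Aa.
exists (fun i => if i == n then A 0 else a i), A'; split => //.
  move=> i; case: eqP => // _.
  exact: (an_comp Aa (an_const 0) an_snd).
move=> x y; rewrite FE big_ord_recr /= eqxx AE mulrDr addrA exprSr mulrA.
congr (_ + _ + _); last by rewrite mulrC.
by apply: eq_bigr => i _; rewrite ltn_eqF.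
Qed.

Lemma an1_divn (c : C -> C) n : an1 c -> exists (b : nat -> C) (w : C -> C),
  an1 w /\ forall t, c t = \sum_(i < n) b i * t ^+ i + t ^+ n * w t.
Proof.
move=> /an1_fst/(an_divn n)[a [A [_ Aa cE]]].
exists (fun i => a i 0), (A^~ 0); split; last by move=> t; apply: cE.
exact: (an_comp Aa an_snd (an_const 0)).
Qed.

Lemma an1_eq0_at0 (w : C -> C) : an1 w -> near1 (fun t => t != 0 -> w t = 0) -> w 0 = 0.
Proof.
move=> wa w0; apply/eqP; apply: contraT => /(an1_unit wa) wn.
have [r r0 H] := near1_and w0 wn.
have rn : `‖creal r‖ = r by rewrite cnorm_real gtr0_norm.
have [] := H (creal r); first by rewrite rn.
have cr0 : creal r != 0 by rewrite -cnorm_gt0 rn.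
by move=> /(_ cr0) -> [_]; rewrite eqxx.
Qed.

(** If all Taylor coefficients at 0 vanish, the remainder bound 2 M q^n forces [c] to vanish on a
    disc. Otherwise the first nonzero coefficient gives the power, and division gives the
    cofactor. *)
Lemma an1_order (c : C -> C) : an1 c -> near1 (fun t => c t = 0) \/
  exists k w, [/\ an1 w, w 0 != 0 & forall t, c t = t ^+ k * w t].
Proof.
move=> ca; have cf := an1_fst ca; have [r [a [r0 ar aP]]] := an_taylor cf.
have [M M0 [s s0 FM]] := an_locally_bounded cf.
pose rho : R := Num.min r s.
have rho0 : 0 < rho by rewrite lt_min r0.
have rhor : rho <= r by rewrite ge_min lexx.
have rhos : rho <= s by rewrite ge_min lexx orbT.
have n0 (q : R) : 0 < q -> `‖0‖ <= q by move=> ?; rewrite cnorm0 ltW.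
have TP n x : `‖x‖ <= rho / 2 ->
    `‖c x - \sum_(i < n) a i 0 0 * x ^+ i‖ <= 2 * M * (`‖x‖ / rho) ^+ n.
  move=> xr; have := (aP 0 0 rho M (n0 _ r0) (n0 _ r0) _
    (FM _ _ _ (n0 _ s0) (n0 _ s0) rhos)).2 n x xr.
  by rewrite add0r rho0 => ->.
have [az|] := pselect (forall i, a i 0 0 = 0).
  left; exists (rho / 2) => [|x xr]; first by rewrite divr_gt0.
  apply/eqP; rewrite -[_ == 0]negbK -cnorm_gt0 -leNgt.
  have M2 : 0 <= 2 * M by rewrite mulr_ge0 ?(ltW M0).
  have q12 : 0 <= `‖x‖ / rho <= 2^-1.
    by rewrite divr_ge0 ?(ltW rho0) //= ler_pdivrMr // mulrC.
  apply: (vanishing_le (vanishing_geometric M2 q12)) => n; rewrite add0r.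
  by have := TP n x xr; rewrite big1 ?subr0 // => i _; rewrite az mul0r.
move=> /existsNP/cid[i0 ai0]; right.
have ex : exists i, a i 0 0 != 0 by exists i0; apply/eqP.
have [k ak kmin] := find_ex_minn ex.
have [b [w [wa cE]]] := an1_divn k.+1 ca.
have [N N0 wN] := an1_bounded wa.
(* The coefficients obtained by division are the Taylor coefficients, since the two polynomials
   differ by O(x^(k+1)). *)
have ab i : (i < k.+1)%N -> b i = a i 0 0.
  move=> ik; apply/eqP; rewrite -subr_eq0; apply/eqP.
  apply: (@poly_small_eq0 _ (fun i => b i - a i 0 0) k.+1 (N + 2 * M / rho ^+ k.+1)) => //.
  have := near1_and wN (near1_le (divr_gt0 rho0 (ltr0Sn _ 1))).
  apply: near1_mono => x [wx xr].
  have -> : \sum_(i < k.+1) (b i - a i 0 0) * x ^+ i =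
     (c x - \sum_(i < k.+1) a i 0 0 * x ^+ i) - x ^+ k.+1 * w x.
    rewrite cE [X in X - _]addrAC addrK -sumrB.
    by apply: eq_bigr => j _; rewrite mulrBl.
  apply: (le_trans (cnormB _ _)); rewrite addrC mulrDl lerD //.
    by rewrite cnormM cnormX mulrC ler_wpM2r // exprn_ge0.
  by apply: (le_trans (TP _ _ xr)); rewrite expr_div_n mulrA mulrAC.
exists k, (fun t => b k + t * w t); split.
- by apply: anD; [apply: an_const|apply: anM => //; apply: an_snd].
- by rewrite mul0r addr0 ab.
- move=> t; rewrite cE big_ord_recr /= big1 ?add0r.
    by rewrite mulrDr exprSr mulrA [b k * _]mulrC.
  move=> i _; rewrite ab ?(ltn_trans _ (ltnSn k)) //.
  by apply/eqP; rewrite mulf_eq0; apply/orP; left; apply: contraT => /kmin; rewrite leqNgt ltn_ord.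
Qed.

(** Regularity of order [n] in x in the sense of Weierstrass. *)
Definition ordx F n :=
  exists u, [/\ an1 u, u 0 != 0 & near1 (fun x => F x 0 = x ^+ n * u x)].

(** This form plays the part of a Weierstrass polynomial: the Newton polygon is read off the [a i],
    with the unit [A] as leading coefficient. *)
Lemma ordx_expand F n : an F -> ordx F n -> exists (a : nat -> C -> C) (A : C -> C -> C),
  [/\ forall i, an1 (a i), an A, forall i, (i < n)%N -> a i 0 = 0, A 0 0 != 0 &
      forall x y, F x y = \sum_(i < n) a i y * x ^+ i + x ^+ n * A x y].
Proof.
move=> Fa [u [ua u0 Fu]]; have [a [A [aa Aa FE]]] := an_divn n Fa.
have A0a : an1 (fun x => A x 0) by apply: (an_comp Aa an_snd (an_const 0)).
have uA : an1 (fun x => u x - A x 0) by apply: anB.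
have [N N0 uN] := an1_bounded uA.
have Ez x : F x 0 = x ^+ n * u x ->
    \sum_(i < n) a i 0 * x ^+ i = x ^+ n * (u x - A x 0).
  by rewrite FE mulrBr => <-; rewrite addrK.
have a0 i : (i < n)%N -> a i 0 = 0.
  apply: (@poly_small_eq0 _ (fun i => a i 0) n N).
  apply: near1_mono (near1_and Fu uN) => x [/Ez -> ux].
  by rewrite cnormM cnormX mulrC ler_wpM2r // exprn_ge0.
exists a, A; split => //.
suff /eqP : u 0 - A 0 0 = 0 by rewrite subr_eq0 => /eqP <-.
apply: (an1_eq0_at0 uA); apply: near1_mono Fu => x /Ez.
rewrite big1 => [|i _]; last by rewrite a0 // mul0r.
move=> /esym/eqP; rewrite mulf_eq0 expf_eq0 => /orP[/andP[_ /eqP ->]|/eqP //].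
by rewrite eqxx.
Qed.

End Division.

(** * Partial derivatives *)

Section Derivatives.
Variable R : realType.
Local Notation C := R[i].
Local Notation "`‖ z ‖" := (@cnorm R z).
Implicit Types (x y z h : C) (F G H P Q : C -> C -> C).

(** Differentiability with an explicit quadratic remainder. Sums, products and compositions become
    inequalities between constants, and uniqueness follows from [poly_small_eq0]. *)
Definition has_der (phi : C -> C) (t d : C) := exists K r : R,
  [/\ 0 <= K, 0 < r & forall h, `‖h‖ <= r ->
      `‖phi (t + h) - phi t - d * h‖ <= K * `‖h‖ ^+ 2].

Lemma has_der_uniq (phi : C -> C) (t d d' : C) : has_der phi t d -> has_der phi t d' -> d = d'.
Proof.
move=> [K [r [K0 r0 H]]] [K' [r' [K0' r0' H']]].
pose a i : C := if i == 1%N then d - d' else 0.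
suff : a 1%N = 0 by move/eqP; rewrite subr_eq0 => /eqP.
apply: (@poly_small_eq0 _ a 2 (K + K')) => //.
apply: near1_mono (near1_and (near1_le r0) (near1_le r0')) => h [hr hr'].
rewrite !big_ord_recl big_ord0 /a /= mul0r add0r addr0 expr1.
have -> : (d - d') * h = (phi (t + h) - phi t - d' * h) - (phi (t + h) - phi t - d * h).
  by ring.
by apply: (le_trans (cnormB _ _)); rewrite addrC mulrDl lerD ?H ?H'.
Qed.

Lemma has_der_lip (phi : C -> C) (t d : C) : has_der phi t d -> exists L r : R,
  [/\ 0 <= L, 0 < r & forall h, `‖h‖ <= r -> `‖phi (t + h) - phi t‖ <= L * `‖h‖].
Proof.
move=> [K [r [K0 r0 H]]]; exists (K + `‖d‖), (Num.min 1 r); split.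
- exact: addr_ge0.
- by rewrite lt_min ltr01.
move=> h; rewrite le_min => /andP[h1 hr].
apply: (le_trans (cnorm_le_dist _ (d * h))); rewrite mulrDl cnormM lerD2r.
apply: (le_trans (H h hr)); rewrite ler_wpM2l // expr2.
by rewrite ler_piMr.
Qed.

Lemma has_der_cst (a t : C) : has_der (fun=> a) t 0.
Proof. by exists 0, 1; split=> // h _; rewrite subrr mul0r subr0 cnorm0 mul0r. Qed.

Lemma has_der_id (t : C) : has_der id t 1.
Proof.
by exists 0, 1; split=> // h _; rewrite /= [t + h]addrC addrK mul1r subrr cnorm0 mul0r.
Qed.

Lemma has_derD (phi psi : C -> C) (t d e : C) : has_der phi t d -> has_der psi t e ->
  has_der (fun s => phi s + psi s) t (d + e).
Proof.
move=> [K [r [K0 r0 H]]] [K' [r' [K0' r0' H']]].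
exists (K + K'), (Num.min r r'); split; rewrite ?addr_ge0 ?lt_min ?r0 // => h.
rewrite le_min => /andP[hr hr'].
have -> : phi (t + h) + psi (t + h) - (phi t + psi t) - (d + e) * h =
  (phi (t + h) - phi t - d * h) + (psi (t + h) - psi t - e * h) by ring.
by apply: (le_trans (cnormD _ _)); rewrite mulrDl lerD ?H ?H'.
Qed.

Lemma has_derM (phi psi : C -> C) (t d e : C) : has_der phi t d -> has_der psi t e ->
  has_der (fun s => phi s * psi s) t (d * psi t + phi t * e).
Proof.
move=> D1 D2; have [L [q [L0 q0 HL]]] := has_der_lip D1.
have [L' [q' [L0' q0' HL']]] := has_der_lip D2.
move: D1 D2 => [K [r [K0 r0 H]]] [K' [r' [K0' r0' H']]].
exists (K * `‖psi t‖ + `‖phi t‖ * K' + L * L'), (Num.min (Num.min r r') (Num.min q q')).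
split; rewrite ?addr_ge0 ?mulr_ge0 ?lt_min ?r0 ?r0' ?q0 // => h.
rewrite !le_min => /andP[/andP[hr hr'] /andP[hq hq']].
have -> : phi (t + h) * psi (t + h) - phi t * psi t - (d * psi t + phi t * e) * h =
  (phi (t + h) - phi t - d * h) * psi t + phi t * (psi (t + h) - psi t - e * h)
  + (phi (t + h) - phi t) * (psi (t + h) - psi t) by ring.
apply: (le_trans (cnormD _ _)); rewrite [leRHS]mulrDl lerD //.
  apply: (le_trans (cnormD _ _)); rewrite [leRHS]mulrDl lerD //.
    by rewrite cnormM mulrAC ler_wpM2r ?H.
  by rewrite cnormM -mulrA ler_wpM2l ?H'.
rewrite cnormM expr2 mulrACA ler_pM ?HL ?HL' //.
Qed.

Lemma has_derX n (t : C) : has_der (fun s => s ^+ n) t (n%:R * t ^+ n.-1).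
Proof.
elim: n => [|n IH].
  by rewrite mul0r; apply: has_der_cst.
have := has_derM (has_der_id t) IH.
have -> : (fun s : C => id s * s ^+ n) = (fun s => s ^+ n.+1).
  by apply/funext => s; rewrite exprS.
congr has_der; rewrite mul1r mulrCA /=; case: n {IH} => [|n] /=.
  by rewrite mul0r addr0 mul1r.
by rewrite -exprS -[in RHS]addn1 natrD mulrDl mul1r addrC.
Qed.

(** The derivative in x, specified by Cauchy's estimate and the first two Taylor remainders on every
    small disc where [F] is bounded. The freedom in [rho] and [B] matters: they are later taken
    proportional to powers of |t| or |x|. *)
Definition partial F G := exists2 r : R, 0 < r &
  forall x y (rho B : R), `‖x‖ <= r -> `‖y‖ <= r -> 0 < rho <= r ->
    locally_bounded F rho B x y ->
    `‖G x y‖ * rho <= B /\ forall h, `‖h‖ <= rho / 2 ->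
      `‖F (x + h) y - F x y‖ <= 2 * B * (`‖h‖ / rho) /\
      `‖F (x + h) y - F x y - G x y * h‖ <= 2 * B * (`‖h‖ / rho) ^+ 2.

Lemma an_partial F : an F -> exists2 G, an G & partial F G.
Proof.
move=> Fa; have [r [a [r0 ar aP]]] := an_taylor Fa.
exists (a 1%N); first by exists r.
exists r => // x y rho B xr yr rhor FB.
have [a1 aT] := aP x y rho B xr yr rhor FB.
have /andP[rho0 _] := rhor.
have a0E : a 0%N x y = F x y.
  apply/esym/eqP; rewrite -subr_eq0 -[_ == 0]negbK -cnorm_gt0 -leNgt.
  have := aT 1%N 0; rewrite cnorm0 divr_ge0 ?(ltW rho0) // => /(_ isT).
  by rewrite big_ord1 expr0 mulr1 addr0 mul0r expr1 mulr0.
split; first by have := a1 1%N; rewrite expr1.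
move=> h hr; split.
  by have := aT 1%N h hr; rewrite big_ord1 expr0 mulr1 a0E expr1.
have := aT 2%N h hr; rewrite !big_ord_recl big_ord0 expr0 mulr1 a0E addr0.
by rewrite expr1 opprD addrA.
Qed.

Lemma partial_quadratic F G : an F -> partial F G -> exists K r : R,
  [/\ 0 <= K, 0 < r & forall x y h, `‖x‖ <= r -> `‖y‖ <= r -> `‖h‖ <= r ->
    `‖F (x + h) y - F x y - G x y * h‖ <= K * `‖h‖ ^+ 2].
Proof.
move=> Fa [r r0 GP]; have [M M0 [s s0 FM]] := an_locally_bounded Fa.
pose rho : R := Num.min r s.
have rho0 : 0 < rho by rewrite lt_min r0.
have rhor : rho <= r by rewrite ge_min lexx.
have rhos : rho <= s by rewrite ge_min lexx orbT.
exists (2 * M / rho ^+ 2), (rho / 2); split.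
- by rewrite divr_ge0 ?mulr_ge0 ?(ltW M0) ?exprn_ge0 ?(ltW rho0).
- by rewrite divr_gt0.
move=> x y h xr yr hr.
have rr : 0 < rho <= r by rewrite rho0.
have FB : locally_bounded F rho M x y by apply: FM => //; lra.
have xr' : `‖x‖ <= r by lra.
have yr' : `‖y‖ <= r by lra.
have := ((GP x y rho M xr' yr' rr FB).2 h hr).2.
by rewrite expr_div_n mulrA [leRHS]mulrAC.
Qed.

Lemma partial_lipschitz F G : an F -> partial F G -> exists K r : R,
  [/\ 0 <= K, 0 < r & forall x y h, `‖x‖ <= r -> `‖y‖ <= r -> `‖h‖ <= r ->
    `‖F (x + h) y - F x y‖ <= K * `‖h‖].
Proof.
move=> Fa [r r0 GP]; have [M M0 [s s0 FM]] := an_locally_bounded Fa.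
pose rho : R := Num.min r s.
have rho0 : 0 < rho by rewrite lt_min r0.
have rhor : rho <= r by rewrite ge_min lexx.
have rhos : rho <= s by rewrite ge_min lexx orbT.
exists (2 * M / rho), (rho / 2); split.
- by rewrite divr_ge0 ?mulr_ge0 ?(ltW M0) ?(ltW rho0).
- by rewrite divr_gt0.
move=> x y h xr yr hr.
have rr : 0 < rho <= r by rewrite rho0.
have FB : locally_bounded F rho M x y by apply: FM => //; lra.
have xr' : `‖x‖ <= r by lra.
have yr' : `‖y‖ <= r by lra.
have := ((GP x y rho M xr' yr' rr FB).2 h hr).1.
by rewrite mulrA [leRHS]mulrAC.
Qed.

Lemma partial_has_der F G : an F -> partial F G ->
  near2 (fun x y => has_der (F^~ y) x (G x y)).
Proof.
move=> Fa /(partial_quadratic Fa)[K [r [K0 r0 H]]]; exists r => // x y xr yr.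
by exists K, r; split=> // h hr; apply: H.
Qed.

Definition swap F : C -> C -> C := fun x y => F y x.

Lemma an_swap F : an F -> an (swap F).
Proof. by move=> Fa; apply: (an_comp Fa an_snd an_fst). Qed.

(** The neighbourhood is fixed before the arcs: the same radius serves all [X], [Y] through all
    points near 0. *)
Lemma chain_rule F Fx Fy : an F -> partial F Fx -> an Fx -> partial (swap F) (swap Fy) ->
  near2 (fun x y => forall (X Y : C -> C) (t dX dY : C), X t = x -> Y t = y ->
    has_der X t dX -> has_der Y t dY ->
    has_der (fun s => F (X s) (Y s)) t (Fx x y * dX + Fy x y * dY)).
Proof.
move=> Fa FFx Fxa FFy.
have [K1 [r1 [K10 r10 H1]]] := partial_quadratic Fa FFx.
have [K2 [r2 [K20 r20 H2]]] := partial_quadratic (an_swap Fa) FFy.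
have [Fxy Fxya FxyP] := an_partial (an_swap Fxa).
have [K3 [r3 [K30 r30 H3]]] := partial_lipschitz (an_swap Fxa) FxyP.
pose r := Num.min r1 (Num.min r2 r3).
have r0 : 0 < r by rewrite !lt_min r10 r20.
have rr1 : r <= r1 by rewrite ge_min lexx.
have rr2 : r <= r2 by rewrite !ge_min lexx orbT.
have rr3 : r <= r3 by rewrite !ge_min lexx !orbT.
exists (r / 2) => [|x y xr yr X Y t dX dY Xt Yt DX DY]; first by rewrite divr_gt0.
have [L [q [L0 q0 HX]]] := has_der_lip DX; have [L' [q' [L0' q0' HY]]] := has_der_lip DY.
move: DX DY => [K [s [K0 s0 HdX]]] [K' [s' [K0' s0' HdY]]].
pose KK := K1 * L ^+ 2 + K2 * L' ^+ 2 + K3 * L' * L + `‖Fx x y‖ * K + `‖Fy x y‖ * K'.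
pose d := Num.min (Num.min (Num.min s s') (Num.min q q'))
   (Num.min (r / 2 / (L + 1)) (r / 2 / (L' + 1))).
exists KK, d; split.
- by rewrite !addr_ge0 ?mulr_ge0 ?exprn_ge0.
- by rewrite !lt_min s0 s0' q0 q0' !divr_gt0 ?ltr_wpDl.
move=> h; rewrite !le_min => /andP[/andP[/andP[hs hs'] /andP[hq hq']] /andP[hL hL']].
rewrite ler_pdivlMr ?ltr_wpDl // in hL; rewrite ler_pdivlMr ?ltr_wpDl // in hL'.
rewrite Xt Yt.
have := HX h hq; have := HY h hq'; have := HdX h hs; have := HdY h hs'.
rewrite Xt Yt; set a := X (t + h) - x; set b := Y (t + h) - y => bd ad bL aL.
have hn := cnorm_ge0 h.
have ar : `‖a‖ <= r / 2 by nra.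
have br : `‖b‖ <= r / 2 by nra.
have -> : X (t + h) = x + a by rewrite /a [RHS]addrC subrK.
have -> : Y (t + h) = y + b by rewrite /b [RHS]addrC subrK.
(* The five summands correspond, in this order, to the five terms of [KK]; the third one, where [Fx]
   is moved back from y + b to y, needs the Lipschitz constant [K3] of [Fx] in y. *)
have -> : F (x + a) (y + b) - F x y - (Fx x y * dX + Fy x y * dY) * h =
  (F (x + a) (y + b) - F x (y + b) - Fx x (y + b) * a) +
  (F x (y + b) - F x y - Fy x y * b) + (Fx x (y + b) - Fx x y) * a
  + Fx x y * (a - dX * h) + Fy x y * (b - dY * h) by ring.
have ybr : `‖y + b‖ <= r1 by apply: (le_trans (cnormD _ _)); lra.
have L2 (k l : R) z : 0 <= k -> `‖z‖ <= l * `‖h‖ -> k * `‖z‖ ^+ 2 <= k * l ^+ 2 * `‖h‖ ^+ 2.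
  move=> k0 zl; rewrite -mulrA ler_wpM2l // -exprMn lerXn2r ?nnegrE //.
  exact: le_trans zl.
rewrite /KK !(mulrDl _ _ (`‖h‖ ^+ 2)).
apply: (le_trans (cnormD _ _)); apply: lerD; last first.
  by rewrite cnormM -mulrA ler_wpM2l.
apply: (le_trans (cnormD _ _)); apply: lerD; last first.
  by rewrite cnormM -mulrA ler_wpM2l.
apply: (le_trans (cnormD _ _)); apply: lerD; last first.
  rewrite cnormM; have h3 : `‖Fx x (y + b) - Fx x y‖ <= K3 * `‖b‖ by apply: H3; lra.
  have -> : K3 * L' * L * `‖h‖ ^+ 2 = (K3 * (L' * `‖h‖)) * (L * `‖h‖) by ring.
  by rewrite ler_pM // (le_trans h3) // ler_wpM2l.
apply: (le_trans (cnormD _ _)); apply: lerD.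
  by apply: le_trans (L2 _ _ _ K10 aL); apply: H1 => //; lra.
by apply: le_trans (L2 _ _ _ K20 bL); apply: H2; lra.
Qed.

(* Subdividing the segment into [n] pieces, the quadratic errors add up to
   O(1/n), so no integration is needed. *)
Lemma mean_value F G : an F -> partial F G -> near2 (fun h y => forall B : R,
    (forall k, `‖k‖ <= `‖h‖ -> `‖G k y‖ <= B) -> `‖F h y - F 0 y‖ <= `‖h‖ * B).
Proof.
move=> Fa /(partial_quadratic Fa)[K [r [K0 r0 H]]]; exists r => // h y hr yr B GB.
apply: (@vanishing_le _ (fun n => K * `‖h‖ ^+ 2 * n.+1%:R^-1)).
  move=> d d0; have c0 : 0 <= K * `‖h‖ ^+ 2 by rewrite mulr_ge0 ?exprn_ge0.
  have [n hn] := vanishing_harmonic (divr_gt0 d0 (ltr_wpDl c0 ltr01)).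
  exists n; rewrite ler_pdivlMr ?ltr_wpDl // mulrC in hn.
  by apply: (le_trans _ hn); rewrite mulrDl mul1r lerDl invr_ge0.
move=> n; pose u : C := creal n.+1%:R^-1 * h.
have un : `‖u‖ = n.+1%:R^-1 * `‖h‖ by rewrite cnormM cnorm_real ger0_norm.
have uk k : (k <= n.+1)%N -> `‖u *+ k‖ <= `‖h‖.
  move=> kn; rewrite -mulr_natr cnormM cnorm_nat un mulrAC.
  rewrite ler_piMl // mulrC ler_pdivrMr ?ltr0Sn // mul1r ler_nat //.
have step k : (k <= n.+1)%N ->
    `‖F (u *+ k) y - F 0 y‖ <= k%:R * (`‖u‖ * B + K * `‖u‖ ^+ 2).
  elim: k => [|k IH] kn; first by rewrite mulr0n subrr cnorm0 mul0r.
  rewrite mulrSr -natr1 mulrDl mul1r [leRHS]addrC.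
  apply: (le_trans (cdistD (F (u *+ k) y) _ _)); apply: lerD; last exact/IH/ltnW.
  have uk' := uk k (ltnW kn).
  have ur : `‖u‖ <= r by apply: le_trans hr; have := uk 1%N isT; rewrite mulr1n.
  apply: (le_trans (cnorm_le_dist _ (G (u *+ k) y * u))); rewrite [leRHS]addrC lerD //.
    by apply: H => //; apply: le_trans uk' _.
  by rewrite cnormM mulrC ler_wpM2l // GB.
have := step n.+1 (leqnn _).
have -> : u *+ n.+1 = h.
  rewrite -mulr_natr /u mulrAC -[X in X * _]mulrC.
  by rewrite -creal_nat -crealM divff ?pnatr_eq0 // mul1r.
move/le_trans; apply; rewrite un.
have n0 : n.+1%:R != 0 :> R by rewrite pnatr_eq0.
by rewrite le_eqVlt; apply/orP; left; apply/eqP; field.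
Qed.

End Derivatives.

(** * The Newton-Puiseux theorem *)

Section NewtonPuiseux.
Variable R : realType.
Local Notation C := R[i].
Local Notation "`‖ z ‖" := (@cnorm R z).
Implicit Types (x y z h : C) (F G H P Q : C -> C -> C).

Lemma expc0 n : (0 < n)%N -> (0 : C) ^+ n = 0.
Proof. by move=> n0; rewrite expr0n gtn_eqF. Qed.

Lemma has_der_local (phi psi : C -> C) : near1 (fun t => phi t = psi t) ->
  near1 (fun t => forall d, has_der phi t d -> has_der psi t d).
Proof.
move=> [r r0 E]; exists (r / 2) => [|t tr d [K [s [K0 s0 H]]]]; first by rewrite divr_gt0.
exists K, (Num.min s (r / 2)); split; rewrite ?lt_min ?s0 ?divr_gt0 // => h.
rewrite le_min => /andP[hs hr]; rewrite -(E t); last lra.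
by rewrite -E ?H //; apply: (le_trans (cnormD _ _)); lra.
Qed.

Lemma an1_derivable (c : C -> C) : an1 c ->
  exists2 c', an1 c' & near1 (fun t => has_der c t (c' t)).
Proof.
move=> /an1_fst ca; have [G Ga cG] := an_partial ca.
exists (G^~ 0); first exact: (an_comp Ga an_snd (an_const 0)).
have [r r0 H] := partial_has_der ca cG; exists r => // t tr.
by apply: (H t 0) => //; rewrite cnorm0 ltW.
Qed.

Lemma ordx_partial F G n : an F -> an G -> partial F G -> ordx F n.+1 -> ordx G n.
Proof.
move=> Fa Ga FG [u [ua u0 Fu]]; have [u' ua' uu'] := an1_derivable ua.
exists (fun x => n.+1%:R * u x + x * u' x); split.
- apply: anD; first exact: (anM (an_const _) ua).
  exact: (anM an_snd ua').
- by rewrite mul0r addr0 mulf_neq0 // -creal_nat -cnorm_gt0 cnorm_real ger0_norm.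
have Fd : near1 (fun x => has_der (F^~ 0) x (G x 0)).
  have [r r0 H] := partial_has_der Fa FG; exists r => // x xr.
  by apply: H => //; rewrite cnorm0 ltW.
have := near1_and (near1_and Fd uu') (has_der_local Fu).
apply: near1_mono => x [[Fx ux] /(_ _ Fx) Fx'].
rewrite (has_der_uniq Fx' (has_derM (has_derX n.+1 x) ux)) /=.
by rewrite exprS; ring.
Qed.

Theorem implicit_function F G : an F -> an G -> partial F G ->
  F 0 0 = 0 -> G 0 0 != 0 ->
  exists c, [/\ an1 c, c 0 = 0 & near1 (fun t => F (c t) t = 0)].
Proof.
move=> Fa Ga FG F0 G0; set l := G 0 0 in G0.
have l0 : 0 < `‖l‖ by rewrite cnorm_gt0.
(* Newton's iteration with the slope frozen at [l]: for small y it contracts by 1/2, and its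
   iterates from 0 are analytic in y and converge uniformly. *)
pose K x y := x + (- l^-1) * F x y.
have Ka : an K by apply/anD/anM/Fa/an_const/an_fst.
have [Q [q [Q0 q0 FQ]]] := partial_quadratic Fa FG.
have [g g0 Gg] := an_cont0 Ga (divr_gt0 l0 (ltr0Sn _ 3)).
have [k k0 Kk] := Ka.
(* Two points of the disc differ by up to [2 * rho], hence [q / 2]. The last two entries bound the
   variation of the slope and the quadratic error by |l|/4 each, relative to |h|; together they give
   the ratio 1/2. *)
pose rho : R := Num.min (Num.min k (q / 2)) (Num.min g (`‖l‖ / 8 / (Q + 1))).
have rho0 : 0 < rho by rewrite !lt_min k0 g0 !divr_gt0 // ltr_wpDl.
have [rk rq rg rl] : [/\ rho <= k, rho <= q / 2, rho <= g & rho <= `‖l‖ / 8 / (Q + 1)].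
  by rewrite /rho; split; rewrite !ge_min lexx ?orbT.
have contr x x' t : `‖x‖ <= rho -> `‖x'‖ <= rho -> `‖t‖ <= rho ->
    `‖K x t - K x' t‖ <= 2^-1 * `‖x - x'‖.
  move=> xr xr' tr; set h := x - x'.
  have hr : `‖h‖ <= 2 * rho by apply: (le_trans (cnormB _ _)); lra.
  have hq : `‖h‖ <= q by lra.
  have -> : K x t - K x' t = (- l^-1) *
      ((F x t - F x' t - G x' t * h) + (G x' t - l) * h).
    have : l^-1 * l = 1 by rewrite mulVf.
    by rewrite /K /h; move: l^-1 => i il; ring: il.
  rewrite cnormM cnormN cnormV mulrC ler_pdivrMr //.
  have xE : x = x' + h by rewrite /h [RHS]addrC subrK.
  have := FQ x' t h; rewrite -xE => /(_ _ _ hq) b1.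
  have {}b1 : `‖F x t - F x' t - G x' t * h‖ <= Q * `‖h‖ ^+ 2 by apply: b1; lra.
  have b2 : `‖G x' t - l‖ <= `‖l‖ / 4 by apply: Gg; lra.
  have b3 : `‖(G x' t - l) * h‖ <= `‖l‖ / 4 * `‖h‖ by rewrite cnormM ler_wpM2r.
  apply: (le_trans (cnormD _ _)).
  rewrite ler_pdivlMr ?ltr_wpDl // in rl.
  have : Q * `‖h‖ ^+ 2 <= `‖l‖ / 4 * `‖h‖.
    rewrite expr2 mulrA ler_wpM2r //; nra.
  lra.
have K0a : an1 (K 0) by apply: (an_comp Ka (an_const 0) an_snd).
have K00 : K 0 0 = 0 by rewrite /K F0 mulr0 addr0.
have [s1 s10 K0s] := an1_cont0 K0a (divr_gt0 rho0 (ltr0Sn _ 1)).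
pose s : R := Num.min s1 rho.
have s0 : 0 < s by rewrite lt_min s10.
have srho : s <= rho by rewrite ge_min lexx orbT.
have K0s' t : `‖t‖ <= s -> `‖K 0 t‖ <= rho / 2.
  move=> ts; have := K0s t; rewrite K00 subr0; apply.
  by apply: (le_trans ts); rewrite ge_min lexx.
have n0 : `‖0‖ <= rho by rewrite cnorm0 ltW.
pose c n t := iter n (K^~ t) 0.
have Kr x t : `‖x‖ <= rho -> `‖t‖ <= s -> `‖K x t‖ <= rho.
  move=> xr ts; apply: (le_trans (cnorm_le_dist _ (K 0 t))).
  have := contr x 0 t xr n0 (le_trans ts srho); have := K0s' t ts.
  by rewrite subr0; lra.
have cr n t : `‖t‖ <= s -> `‖c n t‖ <= rho.
  by move=> ts; elim: n => [|n IH] //=; apply: Kr.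
have ca n : uapprox s (fun _ t => c n t).
  elim: n => [|n IH]; first exact/uapprox_polyfun/polyfun_const.
  apply: (@uapprox_comp _ k _ K _ (fun _ t => t)) => //.
    by apply: uapprox_polyfun; constructor.
  move=> _ t _ ts; split; last by lra.
  by apply: (le_trans (cr n t ts)).
pose e n : R := rho * 2^-1 ^+ n.
have cS n t : `‖t‖ <= s -> `‖c n.+1 t - c n t‖ <= e n / 2.
  move=> ts; elim: n => [|n IH].
    by rewrite /e expr0 mulr1 /= subr0; apply: K0s'.
  have : `‖c n.+2 t - c n.+1 t‖ <= 2^-1 * `‖c n.+1 t - c n t‖.
    by apply: (contr (c n.+1 t) (c n t)); rewrite ?cr //; apply: le_trans ts srho.
  have -> : e n.+1 = 2^-1 * e n by rewrite /e exprS mulrCA.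
  lra.
have e0 n : 0 <= e n by rewrite mulr_ge0 ?(ltW rho0) // exprn_ge0 // invr_ge0.
have cnm n m t : `‖t‖ <= s -> `‖c (m + n)%N t - c n t‖ <= e n - e (m + n)%N.
  move=> ts; elim: m => [|m IH]; first by rewrite !subrr cnorm0.
  have := cdistD (c (m + n)%N t) (c (m.+1 + n)%N t) (c n t).
  have := cS (m + n)%N t ts.
  have -> : e (m.+1 + n)%N = 2^-1 * e (m + n)%N by rewrite /e addSn exprS mulrCA.
  rewrite -addSn; lra.
have cauchy t n m : `‖t‖ <= s -> `‖c n t - c m t‖ <= e n + e m.
  move=> ts; have en := e0 n; have em := e0 m.
  have [mn|/ltnW nm] := leqP m n.
    have := cnm m (n - m)%N t ts; rewrite subnK //; lra.
  by have := cnm n (m - n)%N t ts; rewrite subnK // cdistC; lra.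
have ve : vanishing e.
  apply: vanishing_geometric; first exact: ltW.
  by rewrite invr_ge0 ler0n lexx.
pose d t := xget 0 [set z : C | forall n, `‖c n t - z‖ <= e n].
have dP t n : `‖t‖ <= s -> `‖c n t - d t‖ <= e n.
  move=> ts; suff : [set z : C | forall n, `‖c n t - z‖ <= e n] !=set0.
    by move=> /xgetPex; apply.
  by apply: vanishing_limit => // i j; apply: cauchy.
have dr t : `‖t‖ <= s -> `‖d t‖ <= rho.
  move=> ts; apply: (vanishing_le ve) => n.
  have := cnorm_le_dist (d t) (c n t); have := dP t n ts; rewrite cdistC.
  by have := cr n t ts; lra.
exists d; split.
- exists s => //; apply: uapprox_lim => w w0; have [n en] := ve w w0.
  exists (fun _ t => c n t) => // _ t _ ts.
  by rewrite cdistC; apply: (le_trans (dP t n ts)).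
- apply/eqP; rewrite -[_ == 0]negbK -cnorm_gt0 -leNgt.
  apply: (vanishing_le ve) => n; rewrite add0r.
  have c0 : c n 0 = 0 by elim: n => [|n IH] //=; rewrite -/(c n 0) IH.
  by have := dP 0 n; rewrite c0 add0r cnormN cnorm0 (ltW s0); apply.
exists s => // t ts.
have ts' : `‖t‖ <= rho by lra.
suff /eqP : `‖K (d t) t - d t‖ <= 0.
  rewrite /K addrAC subrr add0r cnormM -[_ <= 0]negbK -ltNge => h.
  apply/eqP; apply: contraT => Fn; case/negP: h.
  by rewrite mulr_gt0 // cnorm_gt0 ?oppr_eq0 ?invr_eq0.
apply: (vanishing_le (e := fun n => 2 * e n)) => [w w0|n].
  by have [n en] := ve (w / 2) (divr_gt0 w0 (ltr0Sn _ 1)); exists n; lra.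
rewrite add0r; have := cdistD (c n.+1 t) (K (d t) t) (d t).
have := dP t n.+1 ts.
have -> : e n.+1 = 2^-1 * e n by rewrite /e exprS mulrCA.
have := contr (d t) (c n t) t (dr t ts) (cr n t ts) ts'.
rewrite [`‖d t - _‖]cdistC; have := dP t n ts; rewrite /c /=; have := e0 n; lra.
Qed.

(** A root al of full multiplicity k would make g a multiple of (X - al)^k. Its linear coefficient
    is then a nonzero multiple of al^(k-1), so al = 0 and g is a monomial, against the nonzero
    coefficient below degree k. *)
Lemma poly_multiplicity_lt (g : {poly C}) k i : (1 < k)%N -> size g = k.+1 ->
  g`_1 = 0 -> (i < k)%N -> g`_i != 0 ->
  exists al mu v, [/\ (0 < mu < k)%N, v.[al] != 0 & g = v * ('X - al%:P) ^+ mu].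
Proof.
move=> k1 sg g1 ik gi.
have g0 : g != 0 by rewrite -size_poly_eq0 sg.
have /closed_rootP[al gal] : size g != 1%N by rewrite sg eqSS -lt0n ltnW.
have [mu [v]] := multiplicity_XsubC g al; rewrite g0 /= => val gE.
exists al, mu, v; split => //; apply/andP; split.
  rewrite lt0n; apply: contra val => /eqP mu0.
  by move: gal; rewrite gE mu0 expr0 mulr1.
rewrite ltnNge; apply/negP => kmu.
have v0 : v != 0 by apply: contraNneq val => ->; rewrite root0.
have sE : (size v + mu)%N = k.+1.
  rewrite -sg gE size_Mmonic ?monic_exp ?monicXsubC // size_exp_XsubC.
  by rewrite addnS.
have sv : (0 < size v)%N by rewrite lt0n size_poly_eq0.
have [sv1 muk] : size v = 1%N /\ mu = k by lia.
have vC : v = (v`_0)%:P by apply: size1_polyC; rewrite sv1.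
have v00 : v`_0 != 0 by move: v0; rewrite vC polyC_eq0 coefC.
have al0 : al = 0.
  apply/eqP; have : g^`().[0] = 0 by rewrite horner_coef0 coef_deriv g1.
  rewrite gE vC muk derivM derivC mul0r add0r deriv_exp derivXsubC mul1r.
  rewrite hornerM hornerC hornerMn horner_exp !hornerE => /eqP.
  rewrite mulf_eq0 (negPf v00) /= -mulr_natr mulf_eq0 expf_eq0 oppr_eq0.
  rewrite -creal_nat -[creal _ == 0]negbK -cnorm_gt0 cnorm_real ger0_norm // ltr0n.
  by case/orP => [/andP[]//|]; rewrite (ltnW k1).
move: gi; rewrite gE vC muk al0 subr0 coefCM coefXn ltn_eqF // mulr0 eqxx //.
Qed.

(** The edge of the Newton polygon at the vertex x^k. With q = k!, every quotient q d_i / (k - i),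
    d_i the order of a_i, is an integer; p is the least of them, and an index attaining it has
    [e i 0 != 0]. *)
Lemma newton_slope k (a : nat -> C -> C) : (0 < k)%N -> (forall i, an1 (a i)) ->
  (forall i, (i < k)%N -> a i 0 = 0) -> ~ near1 (fun t => a 0 t = 0) ->
  exists (q p : nat) (e : nat -> C -> C), [/\ (0 < q)%N, (0 < p)%N,
    forall i, (i < k)%N ->
      an1 (e i) /\ near1 (fun s => a i (s ^+ q) = s ^+ (p * (k - i)) * e i s) &
    exists2 i, (i < k)%N & e i 0 != 0].
Proof.
move=> k0 aa a0 na0.
(* The boolean records whether [a i] is the zero germ; if not, the other components are its order
   and its unit. *)
have /choice[f fP] : forall i, exists f : bool * nat * (C -> C),
    if f.1.1 then near1 (fun t => a i t = 0)
    else [/\ an1 f.2, f.2 0 != 0 & forall t, a i t = t ^+ f.1.2 * f.2 t].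
  move=> i; have [az|[d [w P]]] := an1_order (aa i).
    by exists (true, 0%N, id).
  by exists (false, d, w).
pose z i := (f i).1.1; pose d i := (f i).1.2; pose w i := (f i).2.
pose q := k`!; have q0 : (0 < q)%N by apply: fact_gt0.
have dvd (i : 'I_k) : (k - i %| q * d i)%N.
  apply/dvdn_mulr/dvdn_fact; rewrite subn_gt0 ltn_ord leq_subr //.
pose D (i : 'I_k) := (q * d i %/ (k - i))%N.
have DE (i : 'I_k) : (D i * (k - i))%N = (q * d i)%N by rewrite divnK // dvd.
have z0 : ~~ z (Ordinal k0).
  by apply/negP => z0; apply: na0; have := fP 0%N; rewrite -/(z 0%N) z0.
have [i0 iz imin] := @arg_minnP _ (Ordinal k0) (fun i : 'I_k => ~~ z i) D z0.
exists q, (D i0), (fun i s => if z i then 0 else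
  s ^+ (q * d i - D i0 * (k - i)) * w i (s ^+ q)); split => //.
- have := fP i0; rewrite -/(z i0) (negPf iz) => -[_ w0 aE].
  rewrite lt0n; apply: contra w0 => /eqP D0.
  have := DE i0; rewrite D0 mul0n => /esym/eqP; rewrite muln_eq0 (gtn_eqF q0) /= => /eqP d0.
  have := aE 0; rewrite a0 // -/(d i0) d0 expr0 mul1r => <-.
  by rewrite eqxx.
- move=> i ik; have := fP i; rewrite -/(z i); case zi : (z i); [move=> az|move=> [wa w0 aE]].
    split; first exact: an1_cst.
    have := near1_comp az (an1X q) _; rewrite expr0n gtn_eqF // => /(_ erefl).
    by apply: near1_mono => s ->; rewrite mulr0.
  split.
    apply: anM; first exact: an1X.
    by apply: (an1_comp wa (an1X q)); rewrite expr0n gtn_eqF.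
  exists 1 => // s _; rewrite aE mulrA -exprD subnKC -?exprM //.
  rewrite -(DE (Ordinal ik)) leq_pmul2r ?subn_gt0 //.
  by apply: imin; rewrite /= zi.
exists i0 => //; rewrite (negPf iz) DE subnn expr0 mul1r expr0n gtn_eqF //.
by have := fP i0; rewrite -/(z i0) (negPf iz) => -[].
Qed.

Lemma an1_horner (p : {poly C}) (a : C) : an1 (fun t => p.[a + t]).
Proof.
have -> : (fun t => p.[a + t]) = (fun t => \sum_(i < size p) p`_i * (a + t) ^+ i).
  by apply/funext => t; rewrite horner_coef.
apply: (@an_sum _ _ (fun i _ t => p`_i * (a + t) ^+ i)) => i _.
by apply: anM; [apply: an_const|apply/anX/anD/an_snd/an_const].
Qed.

(** Each round shifts along a root of F_x, blows up along an edge of the Newton polygon and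
    recentres at a root of the initial polynomial. The order in x becomes the multiplicity of that
    root, which is smaller, so the induction terminates. *)
Theorem puiseux_root n F : an F -> ordx F n.+1 -> exists (N : nat) (c : C -> C),
  [/\ (0 < N)%N, an1 c, c 0 = 0 & near1 (fun t => F (c t) (t ^+ N) = 0)].
Proof.
elim/ltn_ind: n F => n IH F Fa Fn.
have [G Ga FG] := an_partial Fa; have Gn := ordx_partial Fa Ga FG Fn.
case: n => [|n] in IH Fn Gn.
  have [u [_ u0 [r r0 Fu]]] := Fn; have [v [_ v0 [s s0 Gv]]] := Gn.
  have n0 (q : R) : 0 < q -> `‖0‖ <= q by move=> ?; rewrite cnorm0 ltW.
  have [||c [ca c0 Fc]] := implicit_function Fa Ga FG.
  - by rewrite Fu ?n0 // expr1 mul0r.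
  - by rewrite Gv ?n0 // mul1r.
  by exists 1%N, c.
set k := n.+2 in IH Fn Gn.
have [N1 [c1 [N10 ca1 c10 Gc1]]] := IH n (ltnSn n) G Ga Gn.
pose H x y := F (x + c1 y) (y ^+ N1).
have Ha : an H.
  by apply: (an_comp Fa); [apply/anD/ca1/an_fst|apply: an1X|rewrite c10 addr0|
    rewrite expr0n gtn_eqF].
have Hk : ordx H k.
  have [u [ua u0 Fu]] := Fn; exists u; split=> //; apply: near1_mono Fu => x Fx.
  by rewrite /H c10 addr0 expr0n gtn_eqF.
have [a [A [aa Aa a0 A0 HE]]] := ordx_expand Ha Hk.
(* [a 1%N t] is H_x(0, t) = F_x(c1(t), t^N1) = 0. In terms of the expansion: the increment of F at
   c1(t) is O(h^2) and so are the higher terms, hence a_1(t) h = O(h^2). *)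
have a1 : near1 (fun t => a 1%N t = 0).
  have [H' Ha' HH'] := an_partial Ha.
  have Gd := near1_comp2 (partial_has_der Fa FG) ca1 (an1X N1) c10 (expc0 N10).
  have [[B B0 AB] r0] := (an_bounded Aa, near1_le (@ltr01 R)).
  have [r r0' AB'] := AB.
  apply: near1_mono (near1_and (near1_and Gc1 Gd) (near1_le r0')) => t [[Gt Ft] tr].
  have [K [s [K0 s0 Hs]]] := Ft; rewrite Gt in Hs.
  have := @poly_small_eq0 _ (fun i => if i == 1%N then a 1%N t else 0) 2
    (K + \sum_(i < n) `‖a i.+2 t‖ + B).
  move=> /(_ _ 1%N isT) /=; apply.
  apply: near1_mono (near1_and (near1_and (near1_le s0) (near1_le r0'))
    (near1_le (@ltr01 R))) => h [[hs hr] h1].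
  rewrite !big_ord_recl big_ord0 /= mul0r add0r addr0 expr1.
  have HH : H h t = a 0 t + a 1%N t * h + \sum_(i < n) a i.+2 t * h ^+ i.+2 + h ^+ k * A h t.
    by rewrite HE !big_ord_recl expr0 mulr1 expr1 addrA.
  have H0 : H 0 t = a 0 t.
    rewrite HE big_ord_recl expr0 mulr1 big1 => [|i _]; last by rewrite exprS mul0r mulr0.
    by rewrite exprS !mul0r !addr0.
  have -> : a 1%N t * h = (F (c1 t + h) (t ^+ N1) - F (c1 t) (t ^+ N1) - 0 * h)
     - \sum_(i < n) a i.+2 t * h ^+ i.+2 - h ^+ k * A h t.
    have -> : F (c1 t + h) (t ^+ N1) = H h t by rewrite /H addrC.
    have -> : F (c1 t) (t ^+ N1) = H 0 t by rewrite /H add0r.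
    by rewrite HH H0; ring.
  have hn m : `‖h‖ ^+ m.+2 <= `‖h‖ ^+ 2.
    by rewrite -addn2 exprD ler_piMl ?exprn_ge0 // exprn_ile1.
  rewrite !mulrDl; apply: (le_trans (cnormB _ _)); apply: lerD; last first.
    rewrite cnormM cnormX mulrC; apply: ler_pM; rewrite ?exprn_ge0 //.
      exact: AB'.
    exact: hn.
  apply: (le_trans (cnormB _ _)); apply: lerD; first exact: Hs.
  apply: (le_trans (cnorm_sum _ _ _)); rewrite mulr_suml; apply: ler_sum => i _.
  by rewrite cnormM cnormX ler_wpM2l.
(* If the constant coefficient vanishes, the root [c1] of F_x is already a root of F. *)
have [a00|na0] := pselect (near1 (fun t => a 0 t = 0)).
  exists N1, c1; split=> //; apply: near1_mono a00 => t at0.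
  have := HE 0 t; rewrite /H add0r => ->; rewrite big_ord_recl expr0 mulr1 at0 big1 => [|i _].
    by rewrite exprS !mul0r !addr0.
  by rewrite exprS mul0r mulr0.
have [q [p [e [q0 p0 eP [i0 i0k ei0]]]]] := newton_slope (ltn0Sn _) aa a0 na0.
have ea i : (i < k)%N -> an1 (e i) by case/eP.
(* The strict transform: H(s^p x, s^q) divided by s^(p k). At s = 0 it becomes the initial
   polynomial [g] below. *)
pose E x s := \sum_(i < k) e i s * x ^+ i + x ^+ k * A (s ^+ p * x) (s ^+ q).
have eH : near1 (fun s => forall x, H (s ^+ p * x) (s ^+ q) = s ^+ (p * k) * E x s).
  have : near1 (fun s => forall i, (i < k)%N ->
     a i (s ^+ q) = s ^+ (p * (k - i)) * e i s).
    by apply: near1_big_and => i /eP[].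
  apply: near1_mono => s es x; rewrite HE /E mulrDr mulr_sumr exprMn -exprM mulrA.
  congr (_ + _); apply: eq_bigr => i _; rewrite es // exprMn -exprM.
  have -> : (p * k = p * (k - i) + p * i)%N by rewrite -mulnDr subnK // ltnW.
  by rewrite exprD; ring.
pose g := \poly_(i < k.+1) (if i == k then A 0 0 else e i 0).
have gE i : (i < k)%N -> g`_i = e i 0.
  by move=> ik; rewrite coef_poly (ltn_trans ik) // ltn_eqF.
have sg : size g = k.+1 by rewrite size_poly_eq // eqxx.
have e10 : e 1%N 0 = 0.
  apply: an1_eq0_at0; first exact: ea.
  have [_ e1] := eP 1%N isT.
  have := near1_and e1 (near1_comp a1 (an1X q) (expc0 q0)).
  apply: near1_mono => s [-> /eqP]; rewrite mulf_eq0 expf_eq0 => /orP[/andP[_ ->]//|/eqP //].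
have [al [mu [v [/andP[mu0 muk] val gE']]]] : exists al mu v, 
    [/\ (0 < mu < k)%N, v.[al] != 0 & g = v * ('X - al%:P) ^+ mu].
  by apply: (@poly_multiplicity_lt g k i0) => //; rewrite gE.
pose F2 x s := E (al + x) s.
have alx : an (fun x _ => al + x) by apply/anD/an_fst/an_const.
have F2a : an F2.
  apply: anD.
    apply: (@an_sum _ _ (fun i x s => e i s * (al + x) ^+ i)) => i ik.
    by apply: anM; [apply: ea|apply: anX].
  apply: anM; first exact: anX.
  apply: (an_comp Aa); rewrite ?expr0n ?gtn_eqF ?mul0r //; last exact: an1X.
  by apply: anM => //; apply: an1X.
have F2E x : F2 x 0 = x ^+ mu * v.[al + x].
  have -> : F2 x 0 = g.[al + x].
    rewrite horner_poly big_ord_recr /= eqxx /F2 /E !expr0n !gtn_eqF //= mul0r mulrC.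
    by congr (_ + _); apply: eq_bigr => i _; rewrite ltn_eqF.
  by rewrite gE' hornerM horner_exp !hornerE [al + x]addrC addrK mulrC addrC.
have F2mu : ordx F2 mu.-1.+1.
  exists (fun x => v.[al + x]); rewrite prednK //; split; first exact: an1_horner.
    by rewrite addr0.
  by exists 1.
have muk' : (mu.-1 < n.+1)%N by rewrite prednK // -ltnS.
have [N2 [c2 [N20 ca2 c20 F2c2]]] := IH _ muk' F2 F2a F2mu.
have N2z : (0 : C) ^+ N2 = 0 by rewrite expr0n gtn_eqF.
have sa : an (fun _ u : C => (u ^+ N2) ^+ q) := anX q (an1X N2).
have sp : an (fun _ u : C => (u ^+ N2) ^+ p) := anX p (an1X N2).
(* Undoing the substitutions: y = t^N1, t = s^q, s = u^N2, and x = c1(t) + s^p (al + c2(u)). *)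
exists (N1 * q * N2)%N, (fun u => (u ^+ N2) ^+ p * (al + c2 u) + c1 ((u ^+ N2) ^+ q)).
split.
- by rewrite !muln_gt0 N10 q0.
- apply: anD; last by apply: (an1_comp ca1 sa); rewrite N2z expr0n gtn_eqF.
  by apply: (anM sp); apply: (anD _ ca2); apply: an_const.
- by rewrite N2z !expr0n !gtn_eqF // mul0r add0r.
apply: near1_mono (near1_and F2c2 (near1_comp eH (an1X N2) N2z)) => u [F2u Hu].
have := Hu (al + c2 u); rewrite -/(F2 (c2 u) (u ^+ N2)) F2u mulr0 /H.
have -> : (N1 * q * N2 = N2 * q * N1)%N by lia.
by rewrite !exprM.
Qed.

End NewtonPuiseux.

Arguments expc0 {R n}.

(** * Estimates near the polar branches *)

Section Factorization.
Variable R : realType.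
Local Notation C := R[i].
Local Notation "`‖ z ‖" := (@cnorm R z).
Implicit Types (x y z h : C) (F G H P Q : C -> C -> C).

(** Roots are split off one at a time: after a shift along a root, dividing by x lowers the order by
    one. The cofactor lives over the parameter t of the root just found. *)
Theorem puiseux_factorization n F : an F -> ordx F n ->
  exists (N : nat) (c : nat -> C -> C) (U : C -> C -> C),
  [/\ (0 < N)%N, forall i, (i < n)%N -> an1 (c i) /\ c i 0 = 0, an U, U 0 0 != 0 &
      near2 (fun x t => F x (t ^+ N) = U x t * \prod_(i < n) (x - c i t))].
Proof.
elim: n F => [|n IH] F Fa Fn.
  have [u [_ u0 [r r0 Fu]]] := Fn.
  exists 1%N, (fun _ => id), F; split => //.
    by rewrite Fu ?cnorm0 ?ltW // mul1r.
  by exists 1 => // x t _ _; rewrite big_ord0 mulr1.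
have [N1 [d [N10 da d0 Fd]]] := puiseux_root Fa Fn.
pose H x y := F (x + d y) (y ^+ N1).
have Ha : an H.
  by apply: (an_comp Fa); [apply/anD/da/an_fst|apply: an1X|rewrite d0 addr0|
    apply: expc0].
have [A Aa HA] := an_div Ha.
have xda : an (fun x t => x - d t) by apply: (anB an_fst da).
pose F1 x t := A (x - d t) t.
have F1a : an F1 by apply: (an_comp Aa xda an_snd) => //; rewrite d0 subrr.
have FF1 x t : F (d t) (t ^+ N1) = 0 -> F x (t ^+ N1) = (x - d t) * F1 x t.
  move=> Fdt; have := HA (x - d t) t.
  by rewrite /H subrK add0r Fdt add0r.
have F1n : ordx F1 n.
  have [u [ua u0 Fu]] := Fn; exists u; split => //.
  have [r r0 Fd'] := Fd; have Fd0 := Fd' 0.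
  have F0 : F (d 0) (0 ^+ N1) = 0 by apply: Fd0; rewrite cnorm0 ltW.
  have E x : F x 0 = x ^+ n.+1 * u x -> x != 0 -> F1 x 0 - x ^+ n * u x = 0.
    move=> Fx x0; have := FF1 x 0 F0; rewrite expc0 // Fx d0 subr0 exprS -mulrA.
    by move/(mulfI x0) => ->; rewrite subrr.
  have wa : an1 (fun x => F1 x 0 - x ^+ n * u x).
    apply: anB; first exact: (an_comp F1a an_snd (an_const 0)).
    exact: (anM (an1X n) ua).
  have w0 : F1 0 0 - 0 ^+ n * u 0 = 0.
    by apply: (an1_eq0_at0 wa); apply: near1_mono Fu => x /E.
  apply: near1_mono Fu => x /E Ex; apply/eqP; rewrite -subr_eq0.
  by have [->|/Ex ->] := eqVneq x 0; rewrite ?w0.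
have [N2 [c [U [N20 cP Ua U0 FU]]]] := IH F1 F1a F1n.
have N2z : (0 : C) ^+ N2 = 0 by apply: expc0.
(* The roots of the cofactor refine the parameter once more, so the root found first is
   reparametrized by t^N2. *)
exists (N2 * N1)%N, (fun i => if i == n then fun t => d (t ^+ N2) else c i), U.
split => //; first by rewrite muln_gt0 N10 N20.
  move=> i; rewrite ltnS leq_eqVlt => /orP[/eqP ->|ni].
    by rewrite eqxx N2z; split => //; apply: (an1_comp da (an1X N2) N2z).
  by rewrite ltn_eqF //; apply: cP.
have := near2_and FU (near2_compr Fd (an1X N2) N2z).
apply: near2_mono => x t [Fxt Fdt]; rewrite exprM FF1 // Fxt big_ord_recr /= eqxx.
rewrite mulrC -mulrA; congr (_ * (_ * _)).
by apply: eq_bigr => i _; rewrite ltn_eqF.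
Qed.

(* Holds for a power of t times a unit, hence for every germ. *)
Lemma an1_doubling (d : C -> C) : an1 d -> exists2 K : R, 0 < K &
  near1 (fun t => forall s, `‖s‖ <= 2 * `‖t‖ -> `‖d s‖ <= K * `‖d t‖).
Proof.
move=> da; have [[r r0 dz]|[k [w [wa w0 dE]]]] := an1_order da.
  exists 1 => //; exists (r / 2) => [|t tr s st]; first by rewrite divr_gt0.
  by rewrite dz ?cnorm0 ?mulr_ge0 //; lra.
have [M M0 wM] := an1_bounded wa; have wu := an1_unit wa w0.
have l0 : 0 < `‖w 0‖ by rewrite cnorm_gt0.
exists (2 ^+ k * (M * (2 / `‖w 0‖))).
  by rewrite mulr_gt0 ?exprn_gt0 ?ltr0Sn // mulr_gt0 // divr_gt0.
have [r r0 H] := near1_and wM wu.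
exists (r / 2) => [|t tr s st]; first by rewrite divr_gt0.
rewrite !dE !cnormM !cnormX.
have [ws _] : `‖w s‖ <= M /\ `‖w 0‖ / 2 <= `‖w s‖ /\ w s != 0 by apply: H; lra.
have [_ [wt _]] : `‖w t‖ <= M /\ `‖w 0‖ / 2 <= `‖w t‖ /\ w t != 0 by apply: H; lra.
have -> : 2 ^+ k * (M * (2 / `‖w 0‖)) * (`‖t‖ ^+ k * `‖w t‖) =
   (2 * `‖t‖) ^+ k * (M * (2 / `‖w 0‖ * `‖w t‖)) by rewrite exprMn; ring.
apply: ler_pM; rewrite ?exprn_ge0 //; first by rewrite lerXn2r ?nnegrE ?mulr_ge0.
rewrite -[leLHS]mulr1; apply: ler_pM => //.
by rewrite mulrAC ler_pdivlMr // mul1r mulrC; lra.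
Qed.

Section Factored.
Variables (n N : nat) (c : nat -> C -> C) (U Phi : C -> C -> C).
Hypothesis cP : forall i, (i < n)%N -> an1 (c i) /\ c i 0 = 0.
Hypothesis Ua : an U.
Hypothesis U0 : U 0 0 != 0.
Hypothesis PhiE : near2 (fun x t => Phi x t = U x t * \prod_(i < n) (x - c i t)).

Definition closest i x t := forall j, (j < n)%N -> `‖x - c i t‖ <= `‖x - c j t‖.

Lemma factored_lower : exists2 K : R, 0 < K & near2 (fun x t => forall d : R, 0 <= d ->
  (forall j, (j < n)%N -> d <= `‖x - c j t‖) -> d ^+ n <= K * `‖Phi x t‖).
Proof.
have l0 : 0 < `‖U 0 0‖ by rewrite cnorm_gt0.
exists (2 / `‖U 0 0‖); first by rewrite divr_gt0.
apply: near2_mono (near2_and PhiE (an_unit Ua U0)) => x t [-> [Ux _]] d d0 dc.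
rewrite cnormM cnorm_prod.
have dp : d ^+ n <= \prod_(i < n) `‖x - c i t‖.
  rewrite -[n in leLHS]card_ord -prodr_const; apply: ler_prod => i _.
  by rewrite d0 dc.
apply: (le_trans dp); rewrite mulrA ler_peMl ?prodr_ge0 //.
by rewrite mulrAC ler_pdivlMr // mul1r mulrC; lra.
Qed.

(** Since c_i is closest, |c_i(t) - c_j(t)| <= 2 |x - c_j(t)|. With the doubling constant K_j of c_i
    - c_j, the factor k + c_i(s) - c_j(s) is at most (1 + 2 K_j) |x - c_j(t)|; the product of these
    constants is [K']. *)
Lemma factored_near_closest i : (i < n)%N -> exists2 K : R, 0 < K &
  near2 (fun x t => closest i x t -> forall k s, `‖k‖ <= `‖x - c i t‖ ->
    `‖s‖ <= 2 * `‖t‖ -> `‖Phi (k + c i s) s‖ <= K * `‖Phi x t‖).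
Proof.
move=> ni; have [cia ci0] := cP ni.
have /choice[K KP] : forall j, exists K : R, 0 < K /\ ((j < n)%N ->
    near1 (fun t => forall s, `‖s‖ <= 2 * `‖t‖ ->
      `‖c i s - c j s‖ <= K * `‖c i t - c j t‖)).
  move=> j; have [nj|nj] := boolP (j < n)%N; last by exists 1.
  have [cja _] := cP nj.
  by have [K K0 KP] := an1_doubling (anB cia cja : an1 _); exists K.
have dbl : near1 (fun t => forall j, (j < n)%N -> forall s, `‖s‖ <= 2 * `‖t‖ ->
    `‖c i s - c j s‖ <= K j * `‖c i t - c j t‖).
  by apply: near1_big_and => j nj; have [_] := KP j; apply.
have l0 : 0 < `‖U 0 0‖ by rewrite cnorm_gt0.
have [M M0 UM] := an_bounded Ua.
have [r r0 H] := near2_and (near2_and PhiE UM) (an_unit Ua U0).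
have [s s0 cs] := an1_cont0 cia (divr_gt0 r0 (ltr0Sn _ 3)).
pose K' := \prod_(j < n) (1 + 2 * K j).
have K'0 : 0 < K'.
  by apply: prodr_gt0 => j _; have [Kj _] := KP j; lra.
exists (M * (2 / `‖U 0 0‖) * K').
  by rewrite !mulr_gt0 // invr_gt0.
have [q q0 dq] := dbl.
pose rad := Num.min (Num.min (r / 4) (s / 2)) q.
exists rad; first by rewrite !lt_min !divr_gt0.
move=> x t; rewrite !le_min => /andP[/andP[xr _] xq] /andP[/andP[tr ts] tq].
move=> cl k u kx ut.
have cu : `‖c i u‖ <= r / 4 by have := cs u; rewrite ci0 subr0; apply; lra.
have ct : `‖c i t‖ <= r / 4.
  by have := cs t; rewrite ci0 subr0; apply; have := cnorm_ge0 t; lra.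
have kr : `‖k‖ <= r / 2 by have := cnormB x (c i t); lra.
have kcr : `‖k + c i u‖ <= r by have := cnormD k (c i u); lra.
have ur : `‖u‖ <= r by have := cnorm_ge0 t; lra.
have [[PE1 UM1] _] := H _ _ kcr ur.
have xr' : `‖x‖ <= r by lra.
have tr' : `‖t‖ <= r by lra.
have [[PE2 _] [Ul _]] := H _ _ xr' tr'.
rewrite PE1 PE2 !cnormM !cnorm_prod.
have pp : \prod_(j < n) `‖k + c i u - c j u‖ <= K' * \prod_(j < n) `‖x - c j t‖.
  rewrite -big_split /=; apply: ler_prod => j _; rewrite cnorm_ge0 /=.
  have Kj := (KP j).1; rewrite -addrA.
  have := cnormD k (c i u - c j u); have := dq t tq j (ltn_ord j) u ut.
  have := cdistD x (c i t) (c j t); rewrite [`‖c i t - x‖]cdistC.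
  have := cl j (ltn_ord j).
  set a1 := `‖c i u - c j u‖; set a2 := `‖c i t - c j t‖; set a3 := `‖x - c j t‖.
  set a4 := `‖x - c i t‖ => h1 h2 h3 h4; apply: (le_trans h4).
  have : K j * a2 <= K j * (2 * a3) by rewrite ler_wpM2l ?(ltW Kj) //; lra.
  have -> : (1 + 2 * K j) * a3 = a3 + K j * (2 * a3) by ring.
  by move: kx; rewrite -/a4; lra.
apply: (@le_trans _ _ (M * (K' * \prod_(j < n) `‖x - c j t‖))).
  by apply: ler_pM => //; apply: prodr_ge0 => j _.
have -> : M * (2 / `‖U 0 0‖) * K' * (`‖U x t‖ * \prod_(j < n) `‖x - c j t‖) =
   M * (2 / `‖U 0 0‖ * `‖U x t‖ * (K' * \prod_(j < n) `‖x - c j t‖)) by ring.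
rewrite ler_wpM2l ?(ltW M0) // ler_peMl //.
  by rewrite mulr_ge0 ?(ltW K'0) // prodr_ge0.
by rewrite mulrAC ler_pdivlMr // mul1r mulrC; lra.
Qed.

Lemma closest_exists x t : (0 < n)%N -> exists2 i, (i < n)%N & closest i x t.
Proof.
move=> n0; pose i := [arg min_(i < Ordinal n0) `‖x - c i t‖]%O.
exists i; first exact: ltn_ord.
move=> j nj; rewrite /i; case: arg_minP => // k _ kmin.
exact: (kmin (Ordinal nj)).
Qed.

End Factored.

End Factorization.

(** * The dichotomy near the closest polar root *)

Section PolarEstimate.
Variable R : realType.
Local Notation C := R[i].
Local Notation "`‖ z ‖" := (@cnorm R z).
Implicit Types (x y z h : C) (F G H P Q : C -> C -> C).

Lemma partial_shift F G (c Y : C -> C) : partial F G -> an1 c -> an1 Y ->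
  c 0 = 0 -> Y 0 = 0 ->
  partial (fun k t => F (k + c t) (Y t)) (fun k t => G (k + c t) (Y t)).
Proof.
move=> [r r0 FG] ca Ya c0 Y0.
have kc : an (fun k t => k + c t) by apply: (anD an_fst ca).
have kc0 : 0 + c 0 = 0 :> C by rewrite c0 addr0.
have [s s0 H] := an_comp_radius kc Ya kc0 Y0 r0.
exists (Num.min r s) => [|k t rho B]; first by rewrite lt_min r0.
rewrite !le_min => /andP[_ ks] /andP[_ ts] /andP[rho0 /andP[rhor _]] FB.
have [kr tr] := H k t ks ts.
have FB' : locally_bounded F rho B (k + c t) (Y t).
  by move=> h hr; have := FB h hr; rewrite addrAC.
have rr : 0 < rho <= r by rewrite rho0.
have [h1 h2] := FG _ _ _ _ kr tr rr FB'; split => // h hr.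
by rewrite [k + h + _]addrAC; apply: h2.
Qed.

(** Cauchy's estimate on the disc of radius |t| about t, where |c| is at most kap (2 |t|)^N; hence
    the factor 2^N. *)
Lemma der_le_pow (c c' : C -> C) (kap : R) N : an1 c -> near1 (fun t => has_der c t (c' t)) ->
  near1 (fun t => `‖c t‖ <= kap * `‖t‖ ^+ N) ->
  near1 (fun t => `‖t‖ * `‖c' t‖ <= kap * 2 ^+ N * `‖t‖ ^+ N).
Proof.
move=> ca cc' [s s0 ck]; have cf := an1_fst ca.
have [G Ga [r r0 cG]] := an_partial cf.
have [q q0 dG] := partial_has_der cf (ex_intro2 _ _ r r0 cG).
have kap0 : 0 <= kap.
  have := ck (creal s); rewrite cnorm_real gtr0_norm // lexx.
  by move=> /(_ isT) /(le_trans (cnorm_ge0 _)); rewrite pmulr_lge0 // exprn_gt0.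
have rad0 : 0 < Num.min (Num.min (s / 2) r) q by rewrite !lt_min divr_gt0 // r0.
apply: near1_mono (near1_and cc' (near1_le rad0)) => t [ct].
rewrite !le_min => /andP[/andP[ts tr] tq].
have [->|t0] := eqVneq t 0.
  by rewrite cnorm0 mul0r !mulr_ge0 ?exprn_ge0.
have n0 (p : R) : 0 < p -> `‖0‖ <= p by move=> ?; rewrite cnorm0 ltW.
have := dG t 0 tq (n0 _ q0) => /has_der_uniq /(_ ct) <-.
have tpos : 0 < `‖t‖ <= r by rewrite cnorm_gt0 t0.
have LB : locally_bounded (fun x _ => c x) `‖t‖ (kap * (2 * `‖t‖) ^+ N) t 0.
  move=> h ht; have th : `‖t + h‖ <= 2 * `‖t‖ by have := cnormD t h; lra.
  apply: (le_trans (ck _ _)); first lra.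
  by rewrite ler_wpM2l // lerXn2r ?nnegrE // mulr_ge0.
have := (cG t 0 _ _ tr (n0 _ r0) tpos LB).1.
by rewrite exprMn mulrA mulrC.
Qed.

(** For v = t^k w, t v' = t^k (k w + t w'), and k >= 1 because v(0) = 0. Once |t w'| <= |w|/2, |t
    v'| lies between |v|/2 and (k + 1) |v|. *)
Lemma log_derivative (v v' : C -> C) : an1 v -> v 0 = 0 ->
  near1 (fun t => has_der v t (v' t)) ->
  near1 (fun t => `‖v t‖ <= 2 * (`‖t‖ * `‖v' t‖)) /\
  exists2 K : R, 0 < K & near1 (fun t => `‖t‖ * `‖v' t‖ <= K * `‖v t‖).
Proof.
move=> va v0 vv'; have [vz|[k [w [wa w0 vE]]]] := an1_order va.
  split; first by apply: near1_mono vz => t ->; rewrite cnorm0 !mulr_ge0.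
  exists 1 => //; apply: near1_mono (near1_and vv' (has_der_local vz)) => t [vt].
  move=> /(_ _ vt)/has_der_uniq/(_ (has_der_cst 0 t)) ->.
  by rewrite cnorm0 mulr0 mulr_ge0.
have k0 : (0 < k)%N.
  rewrite lt0n; apply: contra w0 => /eqP k0.
  by have := vE 0; rewrite v0 k0 expr0 mul1r => <-.
have [w' wa' ww'] := an1_derivable wa.
have [M M0 wM] := an1_bounded wa'.
have l0 : 0 < `‖w 0‖ by rewrite cnorm_gt0.
have r0 : 0 < `‖w 0‖ / (4 * M) by rewrite divr_gt0 ?mulr_gt0.
have main : near1 (fun t => exists z, [/\ t * v' t = t ^+ k * (k%:R * w t + z),
    v t = t ^+ k * w t & `‖z‖ <= `‖w t‖ / 2]).
  have := near1_and (near1_and vv' ww') (near1_and wM (near1_and (an1_unit wa w0) (near1_le r0))).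
  apply: near1_mono => t [[vt wt] [w'M [[wl _] tr]]]; exists (t * w' t); split => //.
    have vE' : v = (fun s => s ^+ k * w s) by apply/funext => s; apply: vE.
    rewrite vE' in vt; rewrite (has_der_uniq vt (has_derM (has_derX k t) wt)).
    have -> : t ^+ k = t * t ^+ k.-1 by rewrite -exprS prednK.
    by ring.
  rewrite cnormM; rewrite ler_pdivlMr ?mulr_gt0 // in tr.
  have : `‖t‖ * `‖w' t‖ <= `‖t‖ * M by rewrite ler_wpM2l.
  lra.
split.
  apply: near1_mono main => t [z [tv vt zw]]; rewrite -cnormM tv vt !cnormM.
  rewrite mulrCA ler_wpM2l //.
  have : `‖w t‖ <= `‖k%:R * w t‖.
    by rewrite cnormM cnorm_nat ler_peMl // ler1n.
  have := cnormB (k%:R * w t + z) z; rewrite addrK; lra.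
exists (k%:R + 1) => [|]; first by rewrite ltr_wpDl.
apply: near1_mono main => t [z [tv vt zw]]; rewrite -cnormM tv vt !cnormM.
rewrite mulrCA ler_wpM2l // mulrDl mul1r.
have := cnormD (k%:R * w t) z; rewrite cnormM cnorm_nat.
have := cnorm_ge0 (w t); lra.
Qed.

Section Gradient.
Variables f fx fy : C -> C -> C.
Hypothesis fa : an f.
Hypothesis fxa : an fx.
Hypothesis fxP : partial f fx.
Hypothesis fyP : partial (swap f) (swap fy).
Hypothesis f0 : f 0 0 = 0.
Variables (n N : nat) (c : nat -> C -> C) (U : C -> C -> C).
Hypothesis N0 : (0 < N)%N.
Hypothesis cP : forall i, (i < n)%N -> an1 (c i) /\ c i 0 = 0.
Hypothesis Ua : an U.
Hypothesis U0 : U 0 0 != 0.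
Hypothesis fxE : near2 (fun x t => fx x (t ^+ N) = U x t * \prod_(i < n) (x - c i t)).
Variable kap : R.
Hypothesis cN : forall i, (i < n)%N -> near1 (fun t => `‖c i t‖ <= kap * `‖t‖ ^+ N).

Let N0c : (0 : C) ^+ N = 0 := expc0 N0.

Lemma polar_value_an i : (i < n)%N -> an1 (fun t => f (c i t) (t ^+ N)).
Proof. by move=> /cP[ca c0]; apply: (an_along fa ca (an1X N) c0 N0c). Qed.

Lemma polar_derivative i : (i < n)%N -> exists v' c' : C -> C,
  near1 (fun t => [/\ has_der (fun s => f (c i s) (s ^+ N)) t (v' t), has_der (c i) t (c' t) &
    v' t = fx (c i t) (t ^+ N) * c' t + fy (c i t) (t ^+ N) * (N%:R * t ^+ N.-1)]).
Proof.
move=> ni; have [ca c0] := cP ni.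
have [v' _ vv'] := an1_derivable (polar_value_an ni).
have [c' _ cc'] := an1_derivable ca; exists v', c'.
have ch := near1_comp2 (chain_rule fa fxP fxa fyP) ca (an1X N) c0 N0c.
apply: near1_mono (near1_and (near1_and vv' cc') ch) => t [[vt ct] cht]; split => //.
exact: has_der_uniq vt (cht (c i) (fun s => s ^+ N) t _ _ erefl erefl ct (has_derX N t)).
Qed.

(** In the coordinates k = x - c_i(t) and t, f is [W] plus v. The dichotomy compares |f| with |k|
    |f_x|, which bounds both W and t W_t: when |f| is much larger, it is comparable to v, and the
    logarithmic derivative of v bounds it. *)
Lemma near_polar_estimate i : (i < n)%N -> exists2 K : R, 0 < K &
  near2 (fun x t => closest n c i x t ->
    `‖f x (t ^+ N)‖ <= K * (`‖x - c i t‖ * `‖fx x (t ^+ N)‖) \/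
    [/\ `‖f (c i t) (t ^+ N)‖ <= 2 * `‖f x (t ^+ N)‖,
        `‖f x (t ^+ N)‖ <= 2 * `‖f (c i t) (t ^+ N)‖ &
        `‖f x (t ^+ N)‖ <=
          K * (`‖t‖ ^+ N * (`‖fx x (t ^+ N)‖ + `‖fy x (t ^+ N)‖))]).
Proof.
move=> ni; have [ca c0] := cP ni.
pose Phi x t := fx x (t ^+ N).
have [K0 K00 near_closest] :=
  factored_near_closest cP Ua U0 (fxE : near2 (fun x t => Phi x t = _)) ni.
pose g k t := f (k + c i t) (t ^+ N).
have kca : an (fun k t => k + c i t) by apply: (anD an_fst ca).
have ga : an g by apply: (an_comp fa kca (an1X N)); rewrite ?c0 ?addr0.
have gP : partial g (fun k t => Phi (k + c i t) t) := partial_shift fxP ca (an1X N) c0 N0c.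
pose W k t := g k t - g 0 t.
have g0a : an (fun _ t => g 0 t) by apply: (an_comp ga (an_const 0) an_snd).
have Wa : an W by apply: (anB ga g0a).
have [G Ga GP] := an_partial (an_swap Wa).
have [v' [c' vc']] := polar_derivative ni.
have va := polar_value_an ni.
have v00 : f (c i 0) (0 ^+ N) = 0 by rewrite c0 N0c f0.
have [vlog _] := log_derivative va v00
  (near1_mono (fun t v => let: And3 a _ _ := v in a) vc').
have ct' := der_le_pow ca
  (near1_mono (fun t v => let: And3 _ a _ := v in a) vc') (cN ni).
have ch := near2_comp (chain_rule fa fxP fxa fyP) an_fst (an1X N) erefl N0c.
have [r1 r10 mv] := mean_value ga gP.
have [r2 r20 Gb] := GP.
have [r3 r30 dG] := partial_has_der (an_swap Wa) (ex_intro2 _ _ r2 r20 Gb).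
pose r := Num.min (Num.min r1 r2) r3.
have r0 : 0 < r by rewrite !lt_min r10 r20.
have xca : an (fun x t => x - c i t) by apply: (anB an_fst ca).
have xc0 : 0 - c i 0 = 0 by rewrite c0 subr0.
have r20' : 0 < r / 2 by rewrite divr_gt0.
have small := an_comp_radius xca an_snd xc0 erefl r20'.
pose K1 : R := `|kap| * 2 ^+ N + N%:R.
have K10 : 0 <= K1 by rewrite addr_ge0 ?mulr_ge0 ?exprn_ge0.
(* Outside the first alternative, |f - v| and the error in t v' are at most |f|/16. Then |v| >=
   (15/16) |f|, and |v| <= 2 |t v'| leaves (13/16) |f| <= 2 K1 |t|^N (|f_x| + |f_y|), within the
   factor 4 K1. *)
exists (16 * K0 + 4 * K1); first lra.
have near_t : near2 (fun _ t => (`‖f (c i t) (t ^+ N)‖ <= 2 * (`‖t‖ * `‖v' t‖)) /\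
    (`‖t‖ * `‖c' t‖ <= kap * 2 ^+ N * `‖t‖ ^+ N) /\
    [/\ has_der (fun s => f (c i s) (s ^+ N)) t (v' t), has_der (c i) t (c' t) &
    v' t = fx (c i t) (t ^+ N) * c' t + fy (c i t) (t ^+ N) * (N%:R * t ^+ N.-1)]).
  by have [q q0 H] := near1_and vlog (near1_and ct' vc'); exists q => // x t _; apply: H.
have := near2_and (near2_and near_closest small) (near2_and near_t ch).
apply: near2_mono => x t [[ncl [kr tr]] [[vt [c't [dv dc _]]] chx]] cl.
have {}ncl := ncl cl; set k := x - c i t in ncl kr *.
have {}kr : `‖k‖ <= r by lra.
have rr1 : r <= r1 by rewrite !ge_min lexx.
have rr2 : r <= r2 by rewrite !ge_min lexx orbT.
have rr3 : r <= r3 by rewrite !ge_min lexx orbT.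
have kx : k + c i t = x by rewrite /k subrK.
set y := t ^+ N in vt chx *; set D := `‖fx x y‖; set E := `‖fy x y‖.
have D0 : 0 <= D := cnorm_ge0 _.
have E0 : 0 <= E := cnorm_ge0 _.
(* Mean value inequality along the x-direction, from the root c_i(s) to c_i(s) + k; it is uniform in
   s. *)
have Wb s : `‖s‖ <= 2 * `‖t‖ -> `‖W k s‖ <= `‖k‖ * (K0 * D).
  move=> st; apply: mv; first lra; first lra.
  by move=> l lk; apply: ncl.
have vE : g 0 t = f (c i t) y by rewrite /g add0r.
have Wt := Wb t; rewrite /W vE /g kx -/y in Wt.
have {}Wt : `‖f x y - f (c i t) y‖ <= `‖k‖ * (K0 * D).
  by apply: Wt; have := cnorm_ge0 t; lra.
(* Cauchy's estimate in t on the disc of radius |t|, contained in |s| <= 2 |t|. *)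
have tG : `‖t‖ * `‖G t k‖ <= `‖k‖ * (K0 * D).
  have [->|t0] := eqVneq t 0.
    by rewrite cnorm0 mul0r !mulr_ge0 // ltW.
  have tpos : 0 < `‖t‖ <= r2 by rewrite cnorm_gt0 t0 /=; lra.
  have tr2 : `‖t‖ <= r2 by lra.
  have kr2 : `‖k‖ <= r2 by lra.
  have := (Gb t k `‖t‖ (`‖k‖ * (K0 * D)) tr2 kr2 tpos _).1.
  rewrite [`‖t‖ * _]mulrC; apply => s st; apply: Wb.
  by have := cnormD t s; lra.
have dX : has_der (fun s => k + c i s) t (0 + c' t).
  exact: (has_derD (has_der_cst k t) dc).
have dg := chx (fun s => k + c i s) (fun s => s ^+ N) t _ _ kx erefl dX (has_derX N t).
have dW : has_der (fun s => W k s) t (G t k) by apply: (dG t k); lra.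
have dWv := has_derD dW dv.
have EWv : (fun s => W k s + f (c i s) (s ^+ N)) = (fun s => f (k + c i s) (s ^+ N)).
  by apply/funext => s; rewrite /W /g add0r subrK.
rewrite EWv in dWv.
(* Two expressions for the t-derivative of f(k + c_i(t), t^N) at fixed k: the chain rule, and W_t +
   v'. *)
have key := has_der_uniq dg dWv; rewrite add0r in key.
have tv : `‖t‖ * `‖v' t‖ <= K1 * (`‖t‖ ^+ N * (D + E)) + `‖k‖ * (K0 * D).
  have tvE : t * v' t = (fx x y * (t * c' t) + fy x y * (N%:R * t ^+ N)) - t * G t k.
    have -> : v' t = fx x y * c' t + fy x y * (N%:R * t ^+ N.-1) - G t k.
      by rewrite key addrC addKr.
    have -> : t ^+ N = t * t ^+ N.-1 by rewrite -exprS prednK.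
    by ring.
  rewrite -cnormM tvE; apply: (le_trans (cnormB _ _)); rewrite cnormM lerD //.
  apply: (le_trans (cnormD _ _)); rewrite !cnormM cnorm_nat cnormX -/D -/E.
  have tN0 : 0 <= `‖t‖ ^+ N by apply: exprn_ge0.
  have h1 : D * (`‖t‖ * `‖c' t‖) <= D * (`|kap| * 2 ^+ N * `‖t‖ ^+ N).
    rewrite ler_wpM2l // (le_trans c't) // ler_wpM2r // ler_wpM2r ?exprn_ge0 //.
    exact: ler_norm.
  have -> : K1 * (`‖t‖ ^+ N * (D + E)) =
     D * (`|kap| * 2 ^+ N * `‖t‖ ^+ N) + E * (N%:R * `‖t‖ ^+ N) +
     (D * (N%:R * `‖t‖ ^+ N) + E * (`|kap| * 2 ^+ N * `‖t‖ ^+ N)) by rewrite /K1; ring.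
  have : 0 <= D * (N%:R * `‖t‖ ^+ N) + E * (`|kap| * 2 ^+ N * `‖t‖ ^+ N).
    by rewrite addr_ge0 // !mulr_ge0 // exprn_ge0.
  lra.
have tN0 : 0 <= `‖t‖ ^+ N * (D + E) by rewrite mulr_ge0 ?exprn_ge0 ?addr_ge0.
have kD0 : 0 <= `‖k‖ * D by rewrite mulr_ge0.
have [fk|kf] := leP `‖f x y‖ ((16 * K0 + 4 * K1) * (`‖k‖ * D)); [by left|right].
have kf' : 16 * (`‖k‖ * (K0 * D)) <= `‖f x y‖.
  apply: (le_trans _ (ltW kf)); rewrite [leRHS]mulrDl.
  have : 0 <= 4 * K1 * (`‖k‖ * D) by rewrite mulr_ge0 // mulr_ge0.
  have -> : 16 * (`‖k‖ * (K0 * D)) = 16 * K0 * (`‖k‖ * D) by ring.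
  lra.
have b1 := cnorm_le_dist (f x y) (f (c i t) y).
have b2 := cnorm_le_dist (f (c i t) y) (f x y); rewrite cdistC in b2.
split; try lra.
have : 0 <= 16 * K0 * (`‖t‖ ^+ N * (D + E)) by rewrite mulr_ge0 // mulr_ge0 // ltW.
lra.
Qed.

End Gradient.

End PolarEstimate.

(** * Tangency of the polar roots and the gradient inequality *)

Section GradientBound.
Variable R : realType.
Local Notation C := R[i].
Local Notation "`‖ z ‖" := (@cnorm R z).
Implicit Types (x y z h : C) (F G H P Q : C -> C -> C).

Lemma near2_big_and n (P : nat -> C -> C -> Prop) :
  (forall i, (i < n)%N -> near2 (P i)) ->
  near2 (fun x y => forall i, (i < n)%N -> P i x y).
Proof.
elim: n => [|n IH] Pn; first by exists 1.
have := near2_and (IH (fun i ni => Pn i (ltnW ni))) (Pn n (ltnSn n)).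
apply: near2_mono => x y [H1 H2] i; rewrite ltnS leq_eqVlt => /orP[/eqP->|] //.
exact: H1.
Qed.

Lemma near2_root N (P : C -> C -> Prop) : (0 < N)%N ->
  near2 (fun x t => P x (t ^+ N)) -> near2 P.
Proof.
move=> N0 [r r0 H]; exists (Num.min r (r ^+ N)); first by rewrite lt_min r0 exprn_gt0.
move=> x y; rewrite !le_min => /andP[xr _] /andP[_ yr].
have [t ty] := cnth_root_exists y N0; rewrite -ty; apply: H => //.
have := yr; rewrite -ty cnormX ler_pXn2r ?nnegrE //; exact: ltW.
Qed.

(** Order at least [m] at the origin, as a growth condition, which Cauchy's estimate transfers to
    the derivatives. *)
Definition vanishing_order F m := exists M r : R, [/\ 0 < M, 0 < r &
  forall (rho : R) x y, 0 < rho <= r -> `‖x‖ <= rho -> `‖y‖ <= rho -> `‖F x y‖ <= M * rho ^+ m].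

Lemma vanishing_order_swap F m : vanishing_order F m -> vanishing_order (swap F) m.
Proof. by move=> [M [r [M0 r0 H]]]; exists M, r; split=> // rho x y ? ? ?; apply: H. Qed.

Lemma vanishing_order_partial F G m :
  partial F G -> vanishing_order F m.+1 -> vanishing_order G m.
Proof.
move=> [r r0 FG] [M [s [M0 s0 H]]].
exists (M * 2 ^+ m.+1), (Num.min r (s / 2)); split.
- by rewrite mulr_gt0 // exprn_gt0.
- by rewrite lt_min r0 divr_gt0.
move=> rho x y; rewrite le_min => /andP[rho0 /andP[rhor rhos]] xr yr.
have LB : locally_bounded F rho (M * (2 * rho) ^+ m.+1) x y.
  move=> h hr; apply: H; [lra|have := cnormD x h; lra|lra].
have rr : 0 < rho <= r by rewrite rho0.
have := (FG x y rho _ (le_trans xr rhor) (le_trans yr rhor) rr LB).1.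
have -> : M * (2 * rho) ^+ m.+1 = M * 2 ^+ m.+1 * rho ^+ m * rho.
  by rewrite exprMn [rho ^+ m.+1]exprSr; ring.
by rewrite ler_pM2r.
Qed.

(** On the axis y = 0, G has size |x|^n up to constants. Since G = O(|x|^n) on the polydisc of
    radius |x|, moving y by kap |x| changes it by O(kap |x|^n), so G keeps that size in a thin cone
    around the axis. The order at the origin and the order in x must agree here: this is
    mini-regularity. *)
Lemma regular_cone G n : an G -> vanishing_order G n -> ordx G n ->
  exists kap k : R, [/\ 0 < kap, 0 < k &
    near2 (fun x y => `‖y‖ <= kap * `‖x‖ -> k * `‖x‖ ^+ n <= `‖G x y‖)].
Proof.
move=> Ga [M [s [M0 s0 GM]]] [u [ua u0 Gu]].
have l0 : 0 < `‖u 0‖ by rewrite cnorm_gt0.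
have [G' _ [r r0 GG']] := an_partial (an_swap Ga).
pose kap := Num.min 2^-1 (`‖u 0‖ / 4 / (2 * M)).
have kap0 : 0 < kap by rewrite lt_min invr_gt0 ltr0Sn !divr_gt0 // mulr_gt0.
have kap1 : kap <= 2^-1 by rewrite ge_min lexx.
have kap2 : kap * (2 * M) <= `‖u 0‖ / 4.
  by rewrite -ler_pdivlMr ?mulr_gt0 // ge_min lexx orbT.
exists kap, (`‖u 0‖ / 4); split; rewrite ?divr_gt0 //.
have nx : near1 (fun x => G x 0 = x ^+ n * u x /\ `‖u 0‖ / 2 <= `‖u x‖ /\ u x != 0).
  exact: near1_and Gu (an1_unit ua u0).
have rs0 : 0 < Num.min r s by rewrite lt_min r0.
apply: near2_mono (near1_near2 (near1_and nx (near1_le rs0))) => x y.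
rewrite le_min => -[[Gx [ux _]] /andP[xr xs]] yx.
have xn0 : 0 <= `‖x‖ ^+ n by apply: exprn_ge0.
have b0 : `‖u 0‖ / 2 * `‖x‖ ^+ n <= `‖G x 0‖.
  by rewrite Gx cnormM cnormX mulrC ler_wpM2l.
have [x0|x0] := eqVneq x 0.
  have -> : y = 0.
    apply/eqP; rewrite -[_ == 0]negbK -cnorm_gt0 -leNgt.
    by rewrite x0 cnorm0 mulr0 in yx.
  by apply: (le_trans _ b0); rewrite ler_wpM2r //; lra.
have x1 : 0 < `‖x‖ <= r by rewrite cnorm_gt0 x0.
have x2 : 0 < `‖x‖ <= s by rewrite cnorm_gt0 x0.
have n0 (q : R) : 0 < q -> `‖0‖ <= q by move=> ?; rewrite cnorm0 ltW.
have LB : locally_bounded (swap G) `‖x‖ (M * `‖x‖ ^+ n) 0 x.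
  by move=> h hx; rewrite add0r; apply: GM.
have yx2 : `‖y‖ <= `‖x‖ / 2.
  apply: (le_trans yx); rewrite mulrC ler_wpM2l //.
have := ((GG' 0 x _ _ (n0 _ r0) xr x1 LB).2 y yx2).1; rewrite add0r /swap => b1.
have b2 : 2 * (M * `‖x‖ ^+ n) * (`‖y‖ / `‖x‖) <= `‖u 0‖ / 4 * `‖x‖ ^+ n.
  have : `‖y‖ / `‖x‖ <= kap by rewrite ler_pdivrMr // cnorm_gt0.
  move=> yk; apply: (@le_trans _ _ (2 * (M * `‖x‖ ^+ n) * kap)).
    by rewrite ler_wpM2l // !mulr_ge0 // ltW.
  have -> : 2 * (M * `‖x‖ ^+ n) * kap = kap * (2 * M) * `‖x‖ ^+ n by ring.
  by rewrite ler_wpM2r.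
have := cnorm_le_dist (G x 0) (G x y); rewrite cdistC.
lra.
Qed.

Lemma polar_root_tangency G (n N : nat) (c : C -> C) : (0 < N)%N -> an G ->
  vanishing_order G n -> ordx G n ->
  an1 c -> c 0 = 0 -> near1 (fun t => G (c t) (t ^+ N) = 0) ->
  exists2 kap : R, 0 < kap & near1 (fun t => `‖c t‖ <= kap * `‖t‖ ^+ N).
Proof.
move=> N0 Ga Gv Gn ca c0 Gc; have [kap [k [kap0 k0 cone]]] := regular_cone Ga Gv Gn.
exists kap^-1; first by rewrite invr_gt0.
have := near1_and Gc (near1_comp2 cone ca (an1X N) c0 (expc0 N0)).
apply: near1_mono => t [Gct]; rewrite Gct cnorm0 cnormX => cn.
rewrite leNgt; apply/negP => ct.
have {}ct : `‖t‖ ^+ N < kap * `‖c t‖ by rewrite -ltr_pdivrMl.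
have cpos : 0 < `‖c t‖.
  by rewrite -(pmulr_rgt0 _ kap0); apply: le_lt_trans ct; rewrite exprn_ge0.
by have := cn (ltW ct); rewrite leNgt mulr_gt0 // exprn_gt0.
Qed.

Lemma powR_root_le (A B K : R) n : 0 <= A -> 0 <= B -> 0 <= K ->
  A ^+ n <= K * B ^+ n.+1 -> A `^ (n%:R / n.+1%:R) <= K `^ n.+1%:R^-1 * B.
Proof.
move=> A0 B0 K0 AB; rewrite powRrM powR_mulrn //.
have BE : B = (B ^+ n.+1) `^ n.+1%:R^-1.
  by rewrite -powR_mulrn // -powRrM divff ?pnatr_eq0 // powRr1.
rewrite [X in _ * X]BE -powRM ?exprn_ge0 //.
by apply: ge0_ler_powR; rewrite ?nnegrE ?invr_ge0 ?mulr_ge0 ?exprn_ge0.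
Qed.

(** Meant for A = |f|, T = |t| and B the gradient: T^P = O(A) turns the factor T^N into A^(N/P),
    which is then divided out. *)
Lemma powR_arc_le (A T B K K' : R) (N P : nat) : (0 < P)%N -> 0 < A -> 0 <= T -> 0 <= B ->
  0 <= K -> 0 <= K' -> T ^+ P <= K' * A -> A <= K * (T ^+ N * B) ->
  A `^ (1 - N%:R / P%:R) <= K * K' `^ (N%:R / P%:R) * B.
Proof.
move=> P0 A0 T0 B0 K0 K'0 TA AB.
have P0' : P%:R != 0 :> R by rewrite pnatr_eq0 -lt0n.
set e := N%:R / P%:R; have e0 : 0 <= e by rewrite divr_ge0.
have Ae : 0 < A `^ e by apply: powR_gt0.
rewrite powRB; last by rewrite (gt_eqF A0) implybT.
rewrite powRr1 ?(ltW A0) // ler_pdivrMr //; apply: (le_trans AB).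
have TN : T ^+ N <= K' `^ e * A `^ e.
  have -> : T ^+ N = (T ^+ P) `^ e.
    by rewrite -!powR_mulrn // -powRrM mulrCA divff // mulr1.
  rewrite -powRM ?(ltW A0) //; apply: ge0_ler_powR => //.
    by rewrite nnegrE exprn_ge0.
  by rewrite nnegrE mulr_ge0 // ltW.
have -> : K * K' `^ e * B * A `^ e = K * ((K' `^ e * A `^ e) * B) by ring.
by rewrite ler_wpM2l // ler_wpM2r.
Qed.

(** A larger exponent only decreases a power of A in (0, 1]. The value A = 0 is treated apart, since
    [powR] is 1 at (0, 0); there [0 < L] is used. *)
Lemma powR_le_small (A l L B : R) : 0 <= A <= 1 -> 0 < L -> l <= L -> 0 <= B ->
  (0 < A -> A `^ l <= B) -> A `^ L <= B.
Proof.
move=> /andP[A0 A1] L0 lL B0 AB; move: A0; rewrite le_eqVlt => /orP[/eqP <-|A0].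
  by rewrite powR0 // gt_eqF.
by apply: le_trans (AB A0); apply: ger_powR => //; rewrite A0.
Qed.

Section UpperBound.
Variables f fx fy : C -> C -> C.
Hypothesis fa : an f.
Hypothesis fxa : an fx.
Hypothesis fxP : partial f fx.
Hypothesis fyP : partial (swap f) (swap fy).
Hypothesis f0 : f 0 0 = 0.
Variables (n N : nat) (c : nat -> C -> C) (U : C -> C -> C).
Hypothesis N0 : (0 < N)%N.
Hypothesis cP : forall i, (i < n)%N -> an1 (c i) /\ c i 0 = 0.
Hypothesis Ua : an U.
Hypothesis U0 : U 0 0 != 0.
Hypothesis fxE : near2 (fun x t => fx x (t ^+ N) = U x t * \prod_(i < n) (x - c i t)).
Variable kap : R.
Hypothesis cN : forall i, (i < n)%N -> near1 (fun t => `‖c i t‖ <= kap * `‖t‖ ^+ N).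
Variable L : R.
Hypothesis Ln : n%:R / n.+1%:R <= L.
Hypothesis Lc : forall i (P : nat) (w : C -> C), (i < n)%N -> an1 w -> w 0 != 0 ->
  (forall t, f (c i t) (t ^+ N) = t ^+ P * w t) -> 1 - N%:R / P%:R <= L.

Let gn x y := `‖fx x y‖ + `‖fy x y‖.

Lemma upper_bound_near_polar i : (i < n)%N -> exists2 K : R, 0 < K &
  near2 (fun x t => closest n c i x t ->
    `‖f x (t ^+ N)‖ `^ L <= K * gn x (t ^+ N)).
Proof.
move=> ni.
have n0 : (0 < n)%N by apply: leq_ltn_trans ni.
have L0 : 0 < L by apply: lt_le_trans Ln; rewrite divr_gt0 ?ltr0n.
have [K K0 est] := near_polar_estimate fa fxa fxP fyP f0 N0 cP Ua U0 fxE cN ni.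
have [K1 K10 low] :=
  factored_lower Ua U0 (fxE : near2 (fun x t => (fun x t => fx x (t ^+ N)) x t = _)).
have fs0 : an (fun x t => f x (t ^+ N)).
  by apply: (an_comp fa an_fst (an1X N)) => //; apply: expc0.
have fs : near2 (fun x t => `‖f x (t ^+ N)‖ <= 1).
  by have := an_cont0 fs0 ltr01; rewrite expc0 // f0; apply: near2_mono => x t; rewrite subr0.
have K2 : 0 <= K ^+ n * K1 by rewrite mulr_ge0 ?exprn_ge0 // ltW.
have A0 x t : 0 <= `‖f x (t ^+ N)‖ by apply: cnorm_ge0.
have g0 x y : 0 <= gn x y by apply: addr_ge0.
(* First alternative: |f|^n <= K^n |k|^n |f_x|^n, and |k|^n <= K1 |f_x|, so |f|^n =
   O(|f_x|^(n+1)). *)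
have caseA x t : closest n c i x t ->
    (forall d : R, 0 <= d -> (forall j, (j < n)%N -> d <= `‖x - c j t‖) ->
      d ^+ n <= K1 * `‖fx x (t ^+ N)‖) -> `‖f x (t ^+ N)‖ <= 1 ->
    `‖f x (t ^+ N)‖ <= K * (`‖x - c i t‖ * `‖fx x (t ^+ N)‖) ->
    `‖f x (t ^+ N)‖ `^ L <= (K ^+ n * K1) `^ n.+1%:R^-1 * gn x (t ^+ N).
  move=> cl lw f1 fK; apply: (powR_le_small _ L0 Ln); rewrite ?A0 //.
    by rewrite mulr_ge0 ?powR_ge0.
  move=> _; apply: (@le_trans _ _ ((K ^+ n * K1) `^ n.+1%:R^-1 * `‖fx x (t ^+ N)‖)); last first.
    by rewrite ler_wpM2l ?powR_ge0 // lerDl.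
  apply: powR_root_le => //; apply: (@le_trans _ _ ((K * (`‖x - c i t‖ * `‖fx x (t ^+ N)‖)) ^+ n)).
    by rewrite lerXn2r ?nnegrE // !mulr_ge0 // ltW.
  rewrite !exprMn -mulrA ler_wpM2l ?exprn_ge0 ?(ltW K0) // exprS mulrA.
  rewrite ler_wpM2r ?exprn_ge0 //; exact: lw.
have [vz|[P [w [wa w0 vE]]]] := an1_order (polar_value_an fa N0 cP ni).
  exists ((K ^+ n * K1) `^ n.+1%:R^-1 + 1); first by rewrite ltr_wpDl ?powR_ge0.
  have vz2 : near2 (fun _ t => f (c i t) (t ^+ N) = 0).
    by have [r r0 H] := vz; exists r => // x t _; apply: H.
  apply: near2_mono (near2_and (near2_and est low) (near2_and fs vz2)).
  move=> x t [[es lw] [f1 v0]] cl.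
  have [fK|[_]] := es cl.
    apply: (le_trans (caseA _ _ cl lw f1 fK)).
    by rewrite ler_wpM2r // lerDl.
  rewrite v0 cnorm0 mulr0 => fl0 _.
  have -> : `‖f x (t ^+ N)‖ = 0 by apply/eqP; rewrite eq_le fl0 A0.
  by rewrite powR0 ?gt_eqF // mulr_ge0 // addr_ge0 // powR_ge0.
have P0 : (0 < P)%N.
  rewrite lt0n; apply: contra w0 => /eqP P0.
  have := vE 0; have [_ c0] := cP ni; rewrite c0 expc0 // f0 P0 expr0 mul1r => <-.
  by rewrite eqxx.
have l0 : 0 < `‖w 0‖ by rewrite cnorm_gt0.
(* One factor 2 comes from |v| <= 2 |f|, the other from |w(t)| >= |w(0)|/2 in |t|^P = |v| /
   |w(t)|. *)
pose K' : R := 2 * (2 / `‖w 0‖).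
have K'0 : 0 < K' by rewrite mulr_gt0 // divr_gt0.
exists ((K ^+ n * K1) `^ n.+1%:R^-1 + K * K' `^ (N%:R / P%:R)).
  by rewrite ltr_wpDl ?powR_ge0 // mulr_gt0 // powR_gt0.
have wu2 : near2 (fun _ t => `‖w 0‖ / 2 <= `‖w t‖ /\ w t != 0).
  by have [r r0 H] := an1_unit wa w0; exists r => // x t _; apply: H.
apply: near2_mono (near2_and (near2_and est low) (near2_and fs wu2)).
move=> x t [[es lw] [f1 [wt _]]] cl.
have [fK|[v1 v2 v3]] := es cl.
  apply: (le_trans (caseA _ _ cl lw f1 fK)).
  by rewrite ler_wpM2r // lerDl mulr_ge0 ?powR_ge0 // ltW.
apply: (@le_trans _ _ (K * K' `^ (N%:R / P%:R) * gn x (t ^+ N))); last first.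
  by rewrite ler_wpM2r // lerDr powR_ge0.
apply: (powR_le_small _ L0 (Lc ni wa w0 vE)); rewrite ?A0 //.
  by rewrite mulr_ge0 // mulr_ge0 ?powR_ge0 // ltW.
move=> fpos; apply: (powR_arc_le P0 fpos (cnorm_ge0 t)) => //; try exact: ltW.
have : `‖t‖ ^+ P <= 2 / `‖w 0‖ * `‖f (c i t) (t ^+ N)‖.
  rewrite vE cnormM cnormX mulrCA ler_peMr ?exprn_ge0 //.
  by rewrite mulrAC ler_pdivlMr // mul1r mulrC; lra.
move/le_trans; apply.
have -> : K' * `‖f x (t ^+ N)‖ = 2 / `‖w 0‖ * (2 * `‖f x (t ^+ N)‖) by rewrite /K'; ring.
by rewrite ler_wpM2l // divr_ge0.
Qed.

Theorem gradient_lower_bound : exists2 k : R, 0 < k &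
  near2 (fun x y => k * `‖f x y‖ `^ L <= gn x y).
Proof.
suff [K K0 H] : exists2 K : R, 0 < K & near2 (fun x y => `‖f x y‖ `^ L <= K * gn x y).
  exists K^-1; first by rewrite invr_gt0.
  by apply: near2_mono H => x y; rewrite ler_pdivrMl.
(* With no polar root f_x is a unit, and the gradient is bounded below while |f|^L <= 1. *)
have [n0|n0] := posnP n.
  have fx0 : fx 0 0 != 0.
    have [r r0 H] := fxE; have := H 0 0; rewrite cnorm0 (ltW r0) expc0 // => -> //.
    rewrite big1 ?mulr1 // => i _; exfalso.
    by have := ltn_ord i; rewrite [X in (_ < X)%N]n0.
  have l0 : 0 < `‖fx 0 0‖ by rewrite cnorm_gt0.
  exists (2 / `‖fx 0 0‖); first by rewrite divr_gt0.
  have L0 : 0 <= L by apply: le_trans Ln; rewrite divr_ge0.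
  apply: near2_mono (near2_and (an_cont0 fa ltr01) (an_unit fxa fx0)) => x y.
  rewrite f0 subr0 => -[f1 [fxy _]].
  apply: (@le_trans _ _ 1).
    have -> : (1 : R) = 1 `^ L by rewrite powR1.
    by apply: ge0_ler_powR; rewrite ?nnegrE ?powR1.
  rewrite mulrAC ler_pdivlMr // mul1r /gn; have := cnorm_ge0 (fy x y); lra.
have /choice[K KP] : forall i, exists K : R, 0 < K /\ ((i < n)%N ->
    near2 (fun x t => closest n c i x t -> `‖f x (t ^+ N)‖ `^ L <= K * gn x (t ^+ N))).
  move=> i; have [ni|ni] := boolP (i < n)%N; last by exists 1.
  by have [K K0 KP] := upper_bound_near_polar ni; exists K.
(* The closest root varies with the point; the sum dominates the constant of each. *)
exists (\sum_(i < n) K i).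
  rewrite (bigD1 (Ordinal n0)) //= ltr_wpDr ?(KP _).1 //.
  by apply: sumr_ge0 => i _; apply/ltW/(KP _).1.
apply: (near2_root N0).
have := @near2_big_and n _ (fun i ni => (KP i).2 ni).
apply: near2_mono => x t H; have [i ni cl] := closest_exists c x t n0.
apply: (le_trans (H i ni cl)); rewrite ler_wpM2r ?addr_ge0 //.
rewrite (bigD1 (Ordinal ni)) //= lerDl.
by apply: sumr_ge0 => j _; apply/ltW/(KP _).1.
Qed.

End UpperBound.

End GradientBound.

(** * Taylor series, complex derivatives and Puiseux arcs *)

Section Bridge.
Variable R : realType.
Local Notation C := R[i].
Local Notation "`‖ z ‖" := (@cnorm R z).
Implicit Types (x y z h : C) (F G H P Q : C -> C -> C).

Lemma cnorm_lt z (e : R) : (`|z| < (e%:C)%C) = (`‖z‖ < e).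
Proof. by rewrite normc_modulus ltcR. Qed.

(** The order of R[i] only compares numbers with equal imaginary parts, so a positive radius is
    real. *)
Lemma pos_complex_real (e : C) : 0 < e -> e = ((complex.Re e)%:C)%C /\ 0 < complex.Re e.
Proof. by case: e => a b; rewrite ltcE /= => /andP[/eqP -> ->]. Qed.

Lemma near1P (P : R[i]^o -> Prop) : (\forall z \near (0 : R[i]^o), P z) <-> near1 P.
Proof.
split.
  move=> /nbhs_ballP[e /= /pos_complex_real[eE e0] eP].
  exists (complex.Re e / 2); first by rewrite divr_gt0.
  move=> x xe; apply: eP; rewrite -ball_normE /= sub0r normrN eE cnorm_lt; lra.
move=> [r r0 rP]; apply/nbhs_ballP; exists (r%:C)%C; first by rewrite /= ltcR.
by move=> x; rewrite -ball_normE /= sub0r normrN cnorm_lt => /ltW/rP.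
Qed.

Lemma near1_dnbhsP (P : R[i]^o -> Prop) :
  (\forall z \near (0 : R[i]^o)^', P z) <-> near1 (fun z => z != 0 -> P z).
Proof. by rewrite -near1P; split. Qed.

Lemma near2P (P : (R[i]^o * R[i]^o)%type -> Prop) :
  (\forall z \near (0 : (R[i]^o * R[i]^o)%type), P z) <-> near2 (fun x y => P (x, y)).
Proof.
split.
  move=> /nbhs_ballP[e /= /pos_complex_real[eE e0] eP].
  exists (complex.Re e / 2); first by rewrite divr_gt0.
  move=> x y xe ye; apply: eP; split; rewrite -ball_normE /= sub0r normrN eE cnorm_lt; lra.
move=> [r r0 rP]; apply/nbhs_ballP; exists (r%:C)%C; first by rewrite /= ltcR.
move=> [x y] [/=]; rewrite -!ball_normE /= !sub0r !normrN !cnorm_lt => xr yr.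
by apply: rP; apply: ltW.
Qed.

Lemma cvg_seqP (u : nat -> C) (l : C) :
  (u : nat -> R[i]^o) @ \oo --> (l : R[i]^o) <->
  forall e : R, 0 < e -> exists N : nat, forall n, (N <= n)%N -> `‖u n - l‖ <= e.
Proof.
split.
  move=> /cvgrPdist_lt ul e e0.
  have e0' : (0 : C) < (e%:C)%C by rewrite ltcR.
  have [N _ HN] := ul _ e0'; exists N => n Nn.
  by have := HN n Nn; rewrite /= cnorm_lt cdistC => /ltW.
move=> ul; apply/cvgrPdist_lt => e /pos_complex_real[eE e0].
have e20 : 0 < complex.Re e / 2 by rewrite divr_gt0.
have [N HN] := ul _ e20; exists N => // n Nn.
by have := HN n Nn; rewrite cdistC eE /= cnorm_lt; lra.
Qed.

Lemma cvg_seq_lim (u : nat -> C) (l : C) :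
  (u : nat -> R[i]^o) @ \oo --> (l : R[i]^o) -> limn (u : nat -> R[i]^o) = l.
Proof. exact: cvg_lim. Qed.

Lemma derive_has_der (f : (R[i]^o * R[i]^o)%type -> R[i]^o) (z v : (R[i]^o * R[i]^o)%type) (d : C) :
  (exists K r : R, [/\ 0 <= K, 0 < r & forall h, `‖h‖ <= r ->
     `‖f (h *: v + z) - f z - d * h‖ <= K * `‖h‖ ^+ 2]) ->
  'D_v f z = d.
Proof.
move=> [K [r [K0 r0 H]]]; apply: cvg_lim => //.
apply/cvgrPdist_lt => e /pos_complex_real[eE e0]; apply/near1_dnbhsP.
have q0 : 0 < Num.min r (complex.Re e / 2 / (K + 1)).
  by rewrite lt_min r0 !divr_gt0 // ltr_wpDl.
exists (Num.min r (complex.Re e / 2 / (K + 1))) => // h.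
rewrite le_min => /andP[hr hK] h0; rewrite eE cnorm_lt.
rewrite ler_pdivlMr ?ltr_wpDl // in hK.
have hp : 0 < `‖h‖ by rewrite cnorm_gt0.
have -> : d - h^-1 *: (f (h *: v + z) - f z) =
   - (h^-1 * (f (h *: v + z) - f z - d * h)).
  have -> : forall w : R[i]^o, h^-1 *: w = h^-1 * w by [].
  rewrite !mulrBr [h^-1 * (d * h)]mulrCA mulVf // mulr1; ring.
rewrite cnormN cnormM cnormV mulrC ltr_pdivrMr //.
apply: (le_lt_trans (H h hr)); rewrite expr2 mulrA ltr_pM2r //; nra.
Qed.

Lemma derive_fst (f : (R[i]^o * R[i]^o)%type -> R[i]^o) x y d :
  has_der (fun s => f (s, y)) x d -> 'D_(1, 0) f (x, y) = d.
Proof.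
move=> [K [r [K0 r0 H]]]; apply: derive_has_der; exists K, r; split => // h hr.
have -> : h *: ((1, 0) : (R[i]^o * R[i]^o)%type) + (x, y) = (x + h, y).
  by congr (_, _); rewrite /= ?scaler0 ?add0r // addrC -[h *: 1]/(h * 1) mulr1.
exact: H.
Qed.

Lemma derive_snd (f : (R[i]^o * R[i]^o)%type -> R[i]^o) x y d :
  has_der (fun s => f (x, s)) y d -> 'D_(0, 1) f (x, y) = d.
Proof.
move=> [K [r [K0 r0 H]]]; apply: derive_has_der; exists K, r; split => // h hr.
have -> : h *: ((0, 1) : (R[i]^o * R[i]^o)%type) + (x, y) = (x, y + h).
  by congr (_, _); rewrite /= ?scaler0 ?add0r // addrC -[h *: 1]/(h * 1) mulr1.
exact: H.
Qed.

Lemma sqrt_sum_squares_bounds (a b : R) : 0 <= a -> 0 <= b ->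
  a <= Num.sqrt (a ^+ 2 + b ^+ 2) /\ b <= Num.sqrt (a ^+ 2 + b ^+ 2) /\
  Num.sqrt (a ^+ 2 + b ^+ 2) <= a + b.
Proof.
move=> a0 b0; split; last split.
- by rewrite -[leLHS](ger0_norm a0) -sqrtr_sqr ler_wsqrtr // lerDl sqr_ge0.
- by rewrite -[leLHS](ger0_norm b0) -sqrtr_sqr ler_wsqrtr // lerDr sqr_ge0.
- rewrite -[leRHS](ger0_norm (addr_ge0 a0 b0)) -sqrtr_sqr ler_wsqrtr // sqrrD.
  by rewrite addrAC lerDl mulrn_wge0 // mulr_ge0.
Qed.

Lemma grad_norm_bounds (f : (R[i]^o * R[i]^o)%type -> R[i]^o)
    (z : (R[i]^o * R[i]^o)%type) (d e : C) :
  'D_(1, 0) f z = d -> 'D_(0, 1) f z = e ->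
  `‖d‖ <= grad_norm f z /\ `‖e‖ <= grad_norm f z /\ grad_norm f z <= `‖d‖ + `‖e‖.
Proof.
by move=> dE eE; rewrite /grad_norm dE eE; apply: sqrt_sum_squares_bounds; apply: cnorm_ge0.
Qed.

Lemma seriesE (u : nat -> R[i]^o) n : series u n = \sum_(k < n) u k.
Proof. by rewrite /series /= big_mkord. Qed.

Lemma geometric_series_bound (u : nat -> C) (B q : R) n l : 0 <= B -> 0 <= q <= 2^-1 ->
  (forall k, (n <= k)%N -> `‖u k‖ <= B * q ^+ k) ->
  (series u : nat -> R[i]^o) @ \oo --> (l : R[i]^o) ->
  `‖l - \sum_(k < n) u k‖ <= 2 * B * q ^+ n.
Proof.
move=> B0 q12 uB /cvg_seqP ul; apply/ler_addgt0Pr => e e0.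
have [N HN] := ul e e0; have := HN _ (leq_maxl N n).
set m := maxn N n; have nm : (n <= m)%N by apply: leq_maxr.
rewrite seriesE => lm.
apply: (le_trans (cdistD (\sum_(k < m) u k) _ _)).
rewrite [leRHS]addrC lerD //; first by rewrite cdistC.
rewrite -!(big_mkord xpredT u) (big_cat_nat _ nm) //= addrAC subrr add0r.
apply: (le_trans (cnorm_sum _ _ _)).
apply: (@le_trans _ _ (\sum_(n <= i < m) B * q ^+ i)).
  by rewrite big_nat [leRHS]big_nat; apply: ler_sum => i /andP[ni _]; apply: uB.
by rewrite -mulr_sumr [2 * B]mulrC -mulrA ler_wpM2l // sum_geometric_le.
Qed.

Lemma hom_part_polyfun (a : nat -> nat -> R[i]^o) k :
  polyfun (fun x y => hom_part a k (x, y)).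
Proof.
have polyX F n : polyfun F -> polyfun (fun x y => F x y ^+ n).
  move=> Fp; elim: n => [|n IH]; first by apply: polyfun_const.
  have -> : (fun x y => F x y ^+ n.+1) = (fun x y => F x y * F x y ^+ n).
    by apply/funext => x; apply/funext => y; rewrite exprS.
  exact: polyfunM.
apply: polyfun_sum => i; apply: polyfunM; first apply: polyfunM.
- exact: polyfun_const.
- exact/polyX/polyfun_fst.
- exact/polyX/polyfun_snd.
Qed.

Section Taylor.
Variables (f : (R[i]^o * R[i]^o)%type -> R[i]^o) (a : nat -> nat -> R[i]^o).
Hypothesis fT : is_taylor f a.

(** The k-th homogeneous part has k + 1 terms of size M (rho/r)^k, and k + 1 <= 2^k is absorbed by
    doubling the ratio: hence s = 2/r, and the radius r/4 keeps the ratio at most 1/2. *)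
Lemma taylor_remainder : exists M s r : R, [/\ 0 < M, 0 < s, 0 < r, r * s <= 2^-1 &
  forall n (rho : R) x y, 0 <= rho <= r -> `‖x‖ <= rho -> `‖y‖ <= rho ->
    `‖f (x, y) - \sum_(k < n) hom_part a k (x, y)‖ <= M * (rho * s) ^+ n].
Proof.
have [[r [M [r0 aM]]] /near2P[q q0 fS]] := fT.
have M0 : 0 <= M.
  by apply: le_trans (aM 0%N 0%N); rewrite mulr1; apply: cnorm_ge0.
exists (2 * (M + 1)), (2 / r), (Num.min q (r / 4)); split.
- by rewrite mulr_gt0 // ltr_wpDl.
- by rewrite divr_gt0.
- by rewrite lt_min q0 divr_gt0.
- have h : Num.min q (r / 4) <= r / 4 by rewrite ge_min lexx orbT.
  by rewrite mulrA ler_pdivrMr //; lra.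
move=> n rho x y /andP[rho0]; rewrite le_min => /andP[rq r4] xr yr.
have q12 : 0 <= rho * (2 / r) <= 2^-1.
  rewrite mulr_ge0 ?divr_ge0 ?rho0 ?(ltW r0) //= mulrA ler_pdivrMr //; lra.
have M1 : 0 <= M + 1 by rewrite addr_ge0.
have fxy := fS x y (le_trans xr rq) (le_trans yr rq).
apply: (geometric_series_bound (u := fun k => hom_part a k (x, y)) M1 q12 _ fxy).
move=> k _; rewrite /hom_part /=; apply: (le_trans (cnorm_sum _ _ _)).
apply: (@le_trans _ _ (\sum_(i < k.+1) M * (rho / r) ^+ k)).
  apply: ler_sum => i _; rewrite !cnormM !cnormX.
  have ik : (i + (k - i) = k)%N by rewrite subnKC // -ltnS.
  rewrite expr_div_n mulrA ler_pdivlMr ?exprn_gt0 //.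
  apply: (@le_trans _ _ ((`‖a i (k - i)%N‖ * r ^+ k) * rho ^+ k)).
    rewrite -mulrA mulrAC -mulrA [X in _ * X]mulrC mulrA [leRHS]mulrAC -!mulrA.
    rewrite ler_wpM2l // !mulrA ler_wpM2r ?exprn_ge0 ?(ltW r0) //.
    by rewrite -[in leRHS]ik exprD; apply: ler_pM; rewrite ?exprn_ge0 // lerXn2r ?nnegrE ?rho0.
  rewrite ler_wpM2r ?exprn_ge0 ?rho0 //.
  by have := aM i (k - i)%N; rewrite ik.
rewrite sumr_const card_ord -[leLHS]mulr_natr.
have -> : M * (rho / r) ^+ k * k.+1%:R = M * (k.+1%:R * (rho / r) ^+ k) by ring.
have rr0 : 0 <= (rho / r) ^+ k by rewrite exprn_ge0 // divr_ge0 // ltW.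
apply: ler_pM => //; [by rewrite mulr_ge0|lra|].
have -> : (rho * (2 / r)) ^+ k = 2 ^+ k * (rho / r) ^+ k.
  by rewrite mulrCA exprMn.
rewrite ler_wpM2r // -natrX ler_nat; exact: ltn_expl.
Qed.

Lemma taylor_an : an (fun x y => f (x, y)).
Proof.
have [M [s [r [M0 s0 r0 rs H]]]] := taylor_remainder.
exists r => // e e0.
have q12 : 0 <= r * s <= 2^-1 by rewrite rs andbT mulr_ge0 // ltW.
have [n hn] := vanishing_geometric (ltW M0) q12 e0.
exists (fun x y => \sum_(k < n) hom_part a k (x, y)).
  by apply: polyfun_sum => k; apply: hom_part_polyfun.
move=> x y xr yr; apply: le_trans hn; apply: H => //.
by rewrite ltW //= lexx.
Qed.

Variable m : nat.
Hypothesis am : mini_regular_x a m.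

Lemma taylor_vanishing_order : vanishing_order (fun x y => f (x, y)) m.
Proof.
have [M [s [r [M0 s0 r0 rs H]]]] := taylor_remainder.
exists (M * s ^+ m), r; split=> //; first by rewrite mulr_gt0 // exprn_gt0.
move=> rho x y /andP[/ltW rho0 rr] xr yr.
have {}rr : 0 <= rho <= r by rewrite rho0.
have := H m rho x y rr xr yr.
rewrite big1 ?subr0; last by move=> k _; apply: (am.1.1 k (ltn_ord k)).
by rewrite exprMn [rho ^+ m * _]mulrC mulrA.
Qed.

(** On y = 0 only the pure power of x survives in the homogeneous part of degree m, with coefficient
    f_m(1, 0); the coefficients obtained by division must agree with it. *)
Lemma taylor_ordx : ordx (fun x y => f (x, y)) m.
Proof.
have [M [s [r [M0 s0 r0 rs H]]]] := taylor_remainder.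
have fa := taylor_an.
have ca : an1 (fun x => f (x, 0)) by apply: (an_comp fa an_snd (an_const 0)).
have [b [w [wa cE]]] := an1_divn m.+1 ca.
have [W W0 wW] := an1_bounded wa.
set al := hom_part a m (1, 0); have al0 : al != 0 := am.2.
have alE x : \sum_(k < m.+1) hom_part a k (x, 0) = al * x ^+ m.
  rewrite big_ord_recr /= big1 ?add0r; last by move=> k _; apply: (am.1.1 k (ltn_ord k)).
  rewrite /al /hom_part /= !big_ord_recr /= !big1.
  - by rewrite !add0r subnn !expr0 expr1n !mulr1.
  - by move=> i _; rewrite expc0 ?mulr0 // subn_gt0.
  - by move=> i _; rewrite expc0 ?mulr0 // subn_gt0.
have bE i : (i < m.+1)%N -> b i = if i == m then al else 0.
  move=> im; apply/eqP; rewrite -subr_eq0; apply/eqP.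
  apply: (@poly_small_eq0 _ (fun i => b i - if i == m then al else 0) m.+1
    (W + M * s ^+ m.+1)) => //.
  apply: near1_mono (near1_and wW (near1_le r0)) => x [wx xr].
  have -> : \sum_(i < m.+1) (b i - (if i == m :> nat then al else 0)) * x ^+ i =
      (f (x, 0) - \sum_(k < m.+1) hom_part a k (x, 0)) - x ^+ m.+1 * w x.
    rewrite cE alE [X in X - _]addrAC addrK.
    under eq_bigr => j _ do rewrite mulrBl.
    rewrite sumrB; congr (_ - _); rewrite big_ord_recr /= eqxx big1 ?add0r //.
    by move=> j _; rewrite ltn_eqF ?mul0r.
  rewrite [leRHS]mulrDl [leRHS]addrC; apply: (le_trans (cnormB _ _)).
  apply: lerD; last by rewrite cnormM cnormX mulrC ler_wpM2r // exprn_ge0.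
  have xx : 0 <= `‖x‖ <= r by rewrite cnorm_ge0.
  have := H m.+1 `‖x‖ x 0 xx (lexx _); rewrite cnorm0 => /(_ (cnorm_ge0 _)).
  by rewrite exprMn [`‖x‖ ^+ m.+1 * _]mulrC mulrA.
exists (fun x => al + x * w x); split.
- by apply: anD; [apply: an_const|apply: (anM an_snd wa)].
- by rewrite mul0r addr0.
exists 1 => // x _; rewrite cE big_ord_recr /= bE // eqxx big1 ?add0r.
  by rewrite mulrDr mulrC mulrA exprSr.
by move=> i _; rewrite bE ?ltn_eqF ?mul0r // (ltn_trans (ltn_ord i)).
Qed.

End Taylor.

End Bridge.

(** * Puiseux arcs as tests for the gradient exponent *)

Section Arcs.
Variable R : realType.
Local Notation C := R[i].
Local Notation "`‖ z ‖" := (@cnorm R z).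
Implicit Types (x y z h : C) (F G H P Q : C -> C -> C).

Lemma an1_series (c : C -> C) : an1 c -> exists u : nat -> C, u 0%N = c 0 /\
  near1 (fun t =>
    (series (fun k => u k * t ^+ k : R[i]^o) : nat -> R[i]^o) @ \oo --> (c t : R[i]^o)).
Proof.
move=> /an1_fst cf; have [r [a [r0 ar aP]]] := an_taylor cf.
have [M M0 [s s0 FM]] := an_locally_bounded cf.
pose rho : R := Num.min r s.
have rho0 : 0 < rho by rewrite lt_min r0.
have rhor : rho <= r by rewrite ge_min lexx.
have rhos : rho <= s by rewrite ge_min lexx orbT.
have n0 (q : R) : 0 < q -> `‖0‖ <= q by move=> ?; rewrite cnorm0 ltW.
have TP n x : `‖x‖ <= rho / 2 ->
    `‖c x - \sum_(i < n) a i 0 0 * x ^+ i‖ <= 2 * M * (`‖x‖ / rho) ^+ n.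
  move=> xr; have := (aP 0 0 rho M (n0 _ r0) (n0 _ r0) _
    (FM _ _ _ (n0 _ s0) (n0 _ s0) rhos)).2 n x xr.
  by rewrite add0r rho0 => ->.
exists (fun k => a k 0 0); split.
  have := TP 1%N 0 (n0 _ (divr_gt0 rho0 (ltr0Sn _ 1))).
  rewrite big_ord1 expr0 mulr1 cnorm0 mul0r expr1 mulr0 => h.
  apply/esym/eqP; rewrite -subr_eq0 -[_ == 0]negbK -cnorm_gt0 -leNgt //.
exists (rho / 2) => [|t tr]; first by rewrite divr_gt0.
apply/cvg_seqP => e e0.
have M2 : 0 <= 2 * M by rewrite mulr_ge0 // ltW.
have q0 : 0 <= `‖t‖ / rho by rewrite divr_ge0 // ltW.
have q1 : `‖t‖ / rho <= 2^-1 by rewrite ler_pdivrMr // mulrC.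
have q12 : 0 <= `‖t‖ / rho <= 2^-1 by rewrite q0.
have [n hn] := vanishing_geometric M2 q12 e0; exists n => k nk.
rewrite seriesE cdistC; apply: (le_trans (TP k t tr)); apply: le_trans hn.
rewrite ler_wpM2l // ler_wiXn2l //; lra.
Qed.

Lemma puiseux_of_germ N (c : C -> C) : (0 < N)%N -> an1 c -> c 0 = 0 ->
  exists gamma : puiseux R, near1 (fun t => puiseux_arc gamma t = (c t, t ^+ N)).
Proof.
move=> N0 /an1_series[u [u0 uc]] c0.
have u00 : u 0%N = 0 by rewrite u0.
have ucv : \forall t \near (0 : R[i]^o), cvgn (series (fun k => u k * t ^+ k : R[i]^o)).
  by apply/near1P; apply: near1_mono uc => t ut; apply/cvg_ex; exists (c t).
exists (@Puiseux R N u N0 u00 ucv); apply: near1_mono uc => t ut.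
by rewrite /puiseux_arc /=; congr (_, _); apply: cvg_seq_lim.
Qed.

(** Convergence at a single point r bounds the terms there, so near 0 the series is dominated by a
    geometric one; without constant term it is at most 2 B |t| / r. *)
Lemma puiseux_arc_small (gamma : puiseux R) (e : R) : 0 < e ->
  near1 (fun t => `‖(puiseux_arc gamma t).1‖ <= e /\ `‖(puiseux_arc gamma t).2‖ <= e).
Proof.
case: gamma => N u N0 u0 uc e0; rewrite /puiseux_arc /=.
have [r r0 rcv] := (near1P _).1 uc.
have rn : `‖creal r‖ = r by rewrite cnorm_real gtr0_norm.
have /cvg_ex[l /= lr] := rcv (creal r) (eq_ind_r (fun v => v <= r) (lexx r) rn).
have [K HK] := (cvg_seqP _ _).1 lr 1 ltr01.
(* Past [K], a term is the difference of two partial sums within 1 of the limit, hence at most 2;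
   the finite sum covers the earlier terms. *)
have Bex : exists2 B : R, 0 < B & forall k, `‖u k‖ * r ^+ k <= B.
  exists (2 + \sum_(k < K) `‖u k‖ * r ^+ k).
    by rewrite ltr_wpDr // sumr_ge0 // => i _; rewrite mulr_ge0 // exprn_ge0 // ltW.
  have S0 : 0 <= \sum_(k < K) `‖u k‖ * r ^+ k.
    by rewrite sumr_ge0 // => i _; rewrite mulr_ge0 // exprn_ge0 // ltW.
  move=> k; have [Kk|kK] := leqP K k; last first.
    rewrite (bigD1 (Ordinal kK)) //= addrCA lerDl addr_ge0 // sumr_ge0 // => i _.
    by rewrite mulr_ge0 // exprn_ge0 // ltW.
  have := HK k.+1 (leqW Kk); have := HK k Kk; rewrite !seriesE big_ord_recr /=.
  set S := \sum_(i < k) _ => h1 h2.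
  have -> : `‖u k‖ * r ^+ k = `‖u k * creal r ^+ k‖ by rewrite cnormM cnormX rn.
  have := cnormB (S + u k * creal r ^+ k - l) (S - l).
  have -> : S + u k * creal r ^+ k - l - (S - l) = u k * creal r ^+ k by ring.
  lra.
have [B B0 uB] := Bex.
pose d := Num.min (r / 2) (r * (e / (2 * B))).
have d0 : 0 < d by rewrite lt_min divr_gt0 //= mulr_gt0 // divr_gt0 // mulr_gt0.
have tN := an1_cont0 (an1X N) e0.
apply: near1_mono (near1_and (near1_and ((near1P _).1 uc) tN) (near1_le d0)).
  move=> t [[tcv tNe]]; rewrite le_min => /andP[tr te].
  split; last by move: tNe; rewrite expc0 // subr0.
  have q12 : 0 <= `‖t‖ / r <= 2^-1.
    by rewrite divr_ge0 ?(ltW r0) //= ler_pdivrMr // mulrC.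
  have /cvg_ex[l' /= tl] := tcv.
  rewrite (cvg_seq_lim tl).
  have := geometric_series_bound (n := 1) (ltW B0) q12 _ tl.
  rewrite big_ord1 u0 mul0r subr0 expr1 => H; apply: (le_trans (H _)).
    move=> k _; rewrite cnormM cnormX expr_div_n mulrA [leRHS]mulrAC ler_wpM2r ?exprn_ge0 //.
    by rewrite ler_pdivlMr ?exprn_gt0.
  rewrite mulrA ler_pdivrMr // mulrC -ler_pdivlMr ?mulr_gt0 //.
  by rewrite [e * r]mulrC -mulrA.
Qed.

Lemma powR_dominated (c1 c2 l L : R) : 0 < c1 -> 0 < c2 -> l < L ->
  exists2 e : R, 0 < e & forall A, 0 < A <= e -> c2 * A `^ L < c1 * A `^ l.
Proof.
move=> c10 c20 lL; have d0 : 0 < L - l by rewrite subr_gt0.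
exists ((c1 / (2 * c2)) `^ (L - l)^-1).
  by rewrite powR_gt0 // divr_gt0 // mulr_gt0.
move=> A /andP[A0 Ae]; have -> : A `^ L = A `^ (L - l) * A `^ l.
  by rewrite -powRD ?subrK // (gt_eqF A0) implybT.
have Al : 0 < A `^ l by apply: powR_gt0.
rewrite mulrA ltr_pM2r //.
have : A `^ (L - l) <= c1 / (2 * c2).
  have -> : c1 / (2 * c2) = ((c1 / (2 * c2)) `^ (L - l)^-1) `^ (L - l).
    by rewrite -powRrM mulVf ?gt_eqF // powRr1 // divr_ge0 ?mulr_ge0 ?ltW.
  by apply: (ge0_ler_powR (ltW d0)); rewrite ?nnegrE ?powR_ge0 ?(ltW A0).
rewrite ler_pdivlMr ?mulr_gt0 //; nra.
Qed.

(** If l < L, then |f|^L is negligible against |f|^l for small |f|, so the two gradient bounds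
    contradict each other wherever f is nonzero on the arc. It serves twice: for the minimality of
    the exponent, and for l(gamma) <= L on every gamma in Gamma. *)
Lemma gradient_exponent_ge (f : (R[i]^o * R[i]^o)%type -> R[i]^o)
    (phi : R[i]^o -> (R[i]^o * R[i]^o)%type) (l L c2 : R) :
  an (fun x y => f (x, y)) -> f (0, 0) = 0 ->
  (forall e : R, 0 < e -> near1 (fun t => `‖(phi t).1‖ <= e /\ `‖(phi t).2‖ <= e)) ->
  gradient_exponents f l -> 0 < c2 ->
  near1 (fun t => t != 0 -> grad_norm f (phi t) <= c2 * `‖f (phi t)‖ `^ L) ->
  ~ near1 (fun t => t != 0 -> f (phi t) = 0) -> L <= l.
Proof.
move=> fa f0 phi0 [l0 [c1 c10 /near2P[r r0 lr]]] c20 gL nz.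
rewrite leNgt; apply/negP => lL; apply: nz.
have [e e0 He] := powR_dominated c10 c20 lL.
have [s s0 fs] := an_cont0 fa e0.
have q0 : 0 < Num.min r s by rewrite lt_min r0.
apply: near1_mono (near1_and gL (phi0 _ q0)) => t [gt].
rewrite !le_min => -[/andP[p1r p1s] /andP[p2r p2s]] t0.
have {}gt := gt t0; case: (phi t) gt p1r p1s p2r p2s => x y /= gt xr xs yr ys.
apply/eqP; rewrite -[_ == 0]negbK -cnorm_gt0; apply/negP => fpos.
have fe : `‖f (x, y)‖ <= e by have := fs x y xs ys; rewrite f0 subr0.
have := He _ (introT andP (conj fpos fe)).
by rewrite ltNge; apply/negP; rewrite negbK; apply: (le_trans (lr x y xr yr)).
Qed.

Lemma order_uniq (P P' : nat) (w w' : C -> C) : an1 w -> an1 w' -> w 0 != 0 -> w' 0 != 0 ->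
  (forall t, t ^+ P * w t = t ^+ P' * w' t) -> P = P'.
Proof.
have H (Q Q' : nat) (v v' : C -> C) : an1 v -> an1 v' -> v 0 != 0 ->
    (forall t, t ^+ Q * v t = t ^+ Q' * v' t) -> (Q' <= Q)%N.
  move=> va va' v0 E; rewrite leqNgt; apply/negP => QQ.
  suff : v 0 - 0 ^+ (Q' - Q) * v' 0 = 0.
    by rewrite expc0 ?subn_gt0 // mul0r subr0; apply/eqP.
  apply: (an1_eq0_at0 (anB va (anM (an1X (Q' - Q)) va') :
    an1 (fun t => v t - t ^+ (Q' - Q) * v' t))).
  exists 1 => // t _ t0; have := E t.
  rewrite -{1}(subnKC (ltnW QQ)) exprD -mulrA => /(mulfI (expf_neq0 Q t0)) ->.
  by rewrite subrr.
move=> wa wa' w0 w0' E; apply/eqP; rewrite eqn_leq.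
by rewrite (H P' P w' w) // (H P P' w w').
Qed.

Lemma puiseux_arc0 (gamma : puiseux R) : puiseux_arc gamma 0 = (0, 0).
Proof.
have H (e : R) : 0 < e -> `‖(puiseux_arc gamma 0).1‖ <= e /\ `‖(puiseux_arc gamma 0).2‖ <= e.
  by move=> /(puiseux_arc_small gamma)[r r0]; apply; rewrite cnorm0 ltW.
have Z z : (forall e : R, 0 < e -> `‖z‖ <= e) -> z = 0.
  move=> ze; apply/eqP; rewrite -[_ == 0]negbK -cnorm_gt0 -leNgt.
  by apply/ler_addgt0Pr => e /ze; rewrite add0r.
rewrite [LHS]surjective_pairing; congr (_, _); apply: Z => e /H[].
  by [].
by [].
Qed.

End Arcs.

(** * Exponent and order of f along a polar branch *)

Section PolarArcs.
Variable R : realType.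
Local Notation C := R[i].
Local Notation "`‖ z ‖" := (@cnorm R z).
Implicit Types (F G H P Q : C -> C -> C).

Section PolarArc.
Variables f fx fy : C -> C -> C.
Hypothesis fa : an f.
Hypothesis fxa : an fx.
Hypothesis fxP : partial f fx.
Hypothesis fyP : partial (swap f) (swap fy).
Hypothesis f0 : f 0 0 = 0.
Variables (n N : nat) (c : nat -> C -> C).
Hypothesis N0 : (0 < N)%N.
Hypothesis cP : forall i, (i < n)%N -> an1 (c i) /\ c i 0 = 0.
Hypothesis cR : forall i, (i < n)%N -> near1 (fun t => fx (c i t) (t ^+ N) = 0).

(** On the branch f_x = 0, so t v' = N t^N f_y. As |t v'| is comparable to |v| and |t|^N to
    |v|^(N/P), |f_y| is comparable to |v|^(1 - N/P). *)
Lemma polar_arc_exponent i (P : nat) (w : C -> C) : (i < n)%N -> (0 < P)%N -> an1 w -> w 0 != 0 ->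
  (forall t, f (c i t) (t ^+ N) = t ^+ P * w t) ->
  exists k1 k2 : R, [/\ 0 < k1, 0 < k2 & near1 (fun t => t != 0 ->
    k1 * `‖f (c i t) (t ^+ N)‖ `^ (1 - N%:R / P%:R) <= `‖fy (c i t) (t ^+ N)‖ <=
    k2 * `‖f (c i t) (t ^+ N)‖ `^ (1 - N%:R / P%:R))].
Proof.
move=> ni P0 wa w0 vE; have [v' [c' vc']] := polar_derivative fa fxa fxP fyP N0 cP ni.
have va := polar_value_an fa N0 cP ni.
have v00 : f (c i 0) (0 ^+ N) = 0 by rewrite (cP ni).2 expc0.
have [vlow [K K0 vup]] := log_derivative va v00
  (near1_mono (fun t v => let: And3 a _ _ := v in a) vc').
have [W W0 wW] := an1_bounded wa; have wl := an1_unit wa w0.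
have l0 : 0 < `‖w 0‖ / 2 by rewrite divr_gt0 // cnorm_gt0.
have NR : 0 < N%:R :> R by rewrite ltr0n.
have P0' : P%:R != 0 :> R by rewrite pnatr_eq0 -lt0n.
set e := N%:R / P%:R; have e0 : 0 <= e by rewrite divr_ge0.
exists ((`‖w 0‖ / 2) `^ e / (2 * N%:R)), (K * W `^ e / N%:R); split.
- by rewrite divr_gt0 ?powR_gt0 // mulr_gt0.
- by rewrite divr_gt0 // mulr_gt0 // powR_gt0.
have := near1_and (near1_and (near1_and vlow vup) (near1_and wW wl)) (near1_and vc' (cR ni)).
apply: near1_mono => t [[[vl vu] [wW' [wl' wt0]]] [[_ _ v'E] fx0]] t0.
rewrite fx0 mul0r add0r in v'E.
have tpos : 0 < `‖t‖ by rewrite cnorm_gt0.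
have tN : 0 < `‖t‖ ^+ N by rewrite exprn_gt0.
have tv : `‖t‖ * `‖v' t‖ = N%:R * (`‖t‖ ^+ N * `‖fy (c i t) (t ^+ N)‖).
  rewrite v'E !cnormM cnorm_nat cnormX.
  have -> : `‖t‖ ^+ N = `‖t‖ * `‖t‖ ^+ N.-1 by rewrite -exprS prednK.
  by ring.
set v := f (c i t) (t ^+ N) in vl vu *; set D := `‖fy _ _‖ in tv *.
have vpos : 0 < `‖v‖ by rewrite cnorm_gt0 /v vE mulf_neq0 // expf_neq0.
(* Splitting v this way exhibits the factor |t|^N, which then cancels against the one in [tv]. *)
have ve : `‖v‖ = `‖v‖ `^ (1 - e) * (`‖t‖ ^+ N * `‖w t‖ `^ e).
  have -> : `‖t‖ ^+ N * `‖w t‖ `^ e = `‖v‖ `^ e.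
    rewrite /v vE cnormM cnormX powRM ?exprn_ge0 //; congr (_ * _).
    by rewrite -!powR_mulrn // -powRrM mulrCA divff // mulr1.
  rewrite -powRD; first by rewrite subrK powRr1 // ltW.
  by rewrite (gt_eqF vpos) implybT.
have V0 : 0 <= `‖v‖ `^ (1 - e) by apply: powR_ge0.
move: vl vu; rewrite tv; set A := `‖v‖ `^ (1 - e) in ve V0 *; rewrite ve => vl vu.
have w1 : (`‖w 0‖ / 2) `^ e <= `‖w t‖ `^ e.
  by apply: (ge0_ler_powR e0); rewrite ?nnegrE ?(ltW l0).
have w2 : `‖w t‖ `^ e <= W `^ e.
  by apply: (ge0_ler_powR e0); rewrite ?nnegrE ?(ltW W0).
apply/andP; split.
  rewrite mulrAC ler_pdivrMr ?mulr_gt0 //.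
  rewrite -(ler_pM2l tN); apply: (@le_trans _ _ (A * (`‖t‖ ^+ N * `‖w t‖ `^ e))).
    have -> : A * (`‖t‖ ^+ N * `‖w t‖ `^ e) = `‖t‖ ^+ N * (`‖w t‖ `^ e * A) by ring.
    by rewrite ler_wpM2l ?(ltW tN) // ler_wpM2r.
  by apply: (le_trans vl); rewrite le_eqVlt; apply/orP; left; apply/eqP; ring.
rewrite mulrAC ler_pdivlMr // -(ler_pM2l tN).
have -> : `‖t‖ ^+ N * (D * N%:R) = N%:R * (`‖t‖ ^+ N * D) by ring.
apply: (le_trans vu).
have -> : `‖t‖ ^+ N * (K * W `^ e * A) = K * (A * (`‖t‖ ^+ N * W `^ e)) by ring.
by do 3![rewrite ler_wpM2l ?(ltW K0) ?(ltW tN) //].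
Qed.

(** By tangency the branch lies in the polydisc of radius (kap + 1) |t|^N, where f = O(|t|^(N m)).
    If P < N m, the leading term w(0) t^P would be O(t^(P+1)). *)
Lemma polar_value_order i m (P : nat) (w : C -> C) (kap : R) : (i < n)%N -> vanishing_order f m ->
  0 < kap -> near1 (fun t => `‖c i t‖ <= kap * `‖t‖ ^+ N) -> an1 w -> w 0 != 0 ->
  (forall t, f (c i t) (t ^+ N) = t ^+ P * w t) -> (N * m <= P)%N.
Proof.
move=> ni [M [r [M0 r0 fM]]] kap0 ck wa w0 vE; rewrite leqNgt; apply/negP => PN.
have K1 : 0 < kap + 1 by lra.
have tN := an1_cont0 (an1X N) (divr_gt0 r0 K1).
have := @poly_small_eq0 _ (fun i => if i == P then w 0 else 0) P.+1.
have [w1 wa' w1E] := an_div (an1_fst wa).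
have [W W0 wW] := an1_bounded (an_comp wa' an_snd (an_const 0) erefl erefl : an1 (fun t => w1 t 0)).
move=> /(_ (M * (kap + 1) ^+ m + W)) H.
have {}H : w 0 = 0.
  have := H _ P (ltnSn P); rewrite eqxx; apply.
  apply: near1_mono (near1_and (near1_and ck tN) (near1_and wW (near1_le (@ltr01 R)))).
  move=> t [[ct tr] [w1W t1]].
  rewrite big_ord_recr /= eqxx big1 ?add0r; last by move=> j _; rewrite ltn_eqF ?mul0r.
  have -> : w 0 * t ^+ P = t ^+ P * w t - t ^+ P.+1 * w1 t 0.
    by rewrite (w1E t 0) exprSr; ring.
  rewrite -vE mulrDl; apply: (le_trans (cnormB _ _)); apply: lerD; last first.
    by rewrite cnormM cnormX mulrC ler_wpM2r // exprn_ge0.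
  have [->|t0] := eqVneq t 0.
    by rewrite (cP ni).2 expc0 // f0 cnorm0 mulr_ge0 ?exprn_ge0 // mulr_ge0 ?exprn_ge0 // ltW.
  have tpos : 0 < `‖t‖ by rewrite cnorm_gt0.
  have tNpos : 0 < `‖t‖ ^+ N by rewrite exprn_gt0.
  move: tr; rewrite expc0 // subr0 cnormX ler_pdivlMr // mulrC => tr.
  have rr : 0 < (kap + 1) * `‖t‖ ^+ N <= r by rewrite mulr_gt0.
  apply: (le_trans (fM _ (c i t) (t ^+ N) rr _ _)).
  - by apply: (le_trans ct); rewrite mulrDl lerDl mul1r ltW.
  - by rewrite cnormX mulrDl mul1r lerDr mulr_ge0 // ltW.
  - rewrite exprMn mulrA ler_wpM2l ?mulr_ge0 ?exprn_ge0 ?(ltW M0) ?(ltW K1) //.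
    rewrite -exprM ler_wiXn2l //.
by rewrite H eqxx in w0.
Qed.

End PolarArc.

End PolarArcs.

(** * The Łojasiewicz exponent *)

Theorem theorem4p1 (R : realType) (f : Cplx2 R -> Cplx R)
    (a : nat -> nat -> Cplx R) (m : nat)
    (f0 : f (0, 0) = 0) (fa : is_taylor f a) (fm : mini_regular_x a m) :
  exists2 L : R, is_lojasiewicz_exponent f L &
    (Gamma f = set0 -> L = (m%:R - 1) / m%:R) /\
    (Gamma f <> set0 ->
      is_maximum
        [set l : R | exists2 gamma, Gamma f gamma &
                       is_arc_exponent f (puiseux_arc gamma) l] L).
Proof.
pose F (x y : R[i]) : R[i] := f (x, y).
have Fa : an F := taylor_an fa.
have Fv : vanishing_order F m := taylor_vanishing_order fa fm.
have Fm : ordx F m := taylor_ordx fa fm.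
(* Order 0 in x would make f(0, 0) nonzero. *)
have [n mn] : exists n, m = n.+1.
  case: (m) Fm => [|n _]; last by exists n.
  move=> [u [_ u0 [r r0 Fu]]]; case/eqP: u0.
  have := Fu 0; rewrite cnorm0 ltW // mul1r => <- //.
have nm : n%:R / n.+1%:R = (m%:R - 1) / m%:R :> R by rewrite mn -[n.+1%:R]natr1 addrK.
rewrite mn in Fv Fm.
have [Fx Fxa FxP] := an_partial Fa.
have [G Ga FyP] := an_partial (an_swap Fa).
pose Fy := swap G.
have Fxn : ordx Fx n := ordx_partial Fa Fxa FxP Fm.
have Fxv : vanishing_order Fx n := vanishing_order_partial FxP Fv.
have Fyv : vanishing_order Fy n.
  exact: vanishing_order_swap (vanishing_order_partial FyP (vanishing_order_swap Fv)).
have D12 : near2 (fun x y => 'D_(1, 0) f (x, y) = Fx x y /\ 'D_(0, 1) f (x, y) = Fy x y).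
  have h1 := partial_has_der Fa FxP.
  have h2 := near2_comp (partial_has_der (an_swap Fa) FyP) an_snd an_fst erefl erefl.
  apply: near2_mono (near2_and h1 h2) => x y [d1 d2].
  by split; [apply: derive_fst d1|apply: derive_snd d2].
have gradE : near2 (fun x y => [/\ cnorm (Fx x y) <= grad_norm f (x, y),
    cnorm (Fy x y) <= grad_norm f (x, y) &
    grad_norm f (x, y) <= cnorm (Fx x y) + cnorm (Fy x y)]).
  by apply: near2_mono D12 => x y [d1 d2]; have [? [? ?]] := grad_norm_bounds d1 d2.
have [N [c [U [N0 cP Ua U0 FxE]]]] := puiseux_factorization Fxa Fxn.
have Nc := expc0 (R := R) N0.
have cR i : (i < n)%N -> near1 (fun t => Fx (c i t) (t ^+ N) = 0).
  move=> ni; have [ca c0] := cP i ni.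
  apply: near1_mono (near1_comp2 FxE ca an1_id c0 erefl) => t ->.
  by rewrite (bigD1 (Ordinal ni)) //= subrr mul0r mulr0.
have [kap kap0 cN] : exists2 kap : R, 0 < kap & forall i, (i < n)%N ->
    near1 (fun t => cnorm (c i t) <= kap * cnorm t ^+ N).
  have /choice[k kP] : forall i, exists k : R, 0 < k /\ ((i < n)%N ->
      near1 (fun t => cnorm (c i t) <= k * cnorm t ^+ N)).
    move=> i; have [ni|ni] := boolP (i < n)%N; last by exists 1.
    have [ca c0] := cP i ni.
    by have [k k0 ck] := polar_root_tangency N0 Fxa Fxv Fxn ca c0 (cR i ni); exists k.
  have sk0 (P : pred 'I_n) : 0 <= \sum_(i < n | P i) k i.
    by apply: sumr_ge0 => i _; apply/ltW/(kP i).1.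
  exists (1 + \sum_(i < n) k i) => [|i ni]; first by rewrite ltr_wpDr.
  apply: near1_mono ((kP i).2 ni) => t /le_trans; apply.
  rewrite ler_wpM2r ?exprn_ge0 ?cnorm_ge0 // (bigD1 (Ordinal ni)) //= addrCA lerDl.
  by rewrite addr_ge0.
(* The boolean tells whether f is a nonzero germ along c_i, that is, whether c_i gives an element of
   Gamma; then come its order and its unit. *)
have /choice[d dP] : forall i, exists d : bool * nat * (R[i] -> R[i]), (i < n)%N ->
    if d.1.1 then [/\ an1 d.2, d.2 0 != 0 &
        forall t, F (c i t) (t ^+ N) = t ^+ d.1.2 * d.2 t]
    else near1 (fun t => F (c i t) (t ^+ N) = 0).
  move=> i; have [ni|ni] := boolP (i < n)%N; last by exists (true, 0%N, id).
  have [vz|[P [w wP]]] := an1_order (polar_value_an Fa N0 cP ni).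
    by exists (false, 0%N, id).
  by exists (true, P, w).
pose nz i := (d i).1.1; pose P i := (d i).1.2; pose w i := (d i).2.
have oT i : (i < n)%N -> nz i -> [/\ an1 (w i), w i 0 != 0 &
    forall t, F (c i t) (t ^+ N) = t ^+ P i * w i t].
  by move=> ni nzi; have := dP i ni; rewrite -/(nz i) nzi.
have oF i : (i < n)%N -> ~~ nz i -> near1 (fun t => F (c i t) (t ^+ N) = 0).
  by move=> ni nzi; have := dP i ni; rewrite -/(nz i) (negPf nzi).
have P_ge i : (i < n)%N -> nz i -> (N * n.+1 <= P i)%N.
  move=> ni nzi; have [wa w0 wE] := oT i ni nzi.
  exact: (polar_value_order f0 N0 cP ni Fv kap0 (cN i ni) wa w0 wE).
have P_uniq i (Q : nat) (v : R[i] -> R[i]) : (i < n)%N -> an1 v -> v 0 != 0 ->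
    (forall t, F (c i t) (t ^+ N) = t ^+ Q * v t) -> nz i /\ Q = P i.
  move=> ni va v0 vE; have [nzi|zi] := boolP (nz i).
    have [wa w0 wE] := oT i ni nzi; split=> //.
    by apply: (order_uniq va wa v0 w0) => t; rewrite -vE wE.
  exfalso; case/eqP: v0; apply: (an1_eq0_at0 va).
  apply: near1_mono (oF i ni zi) => t; rewrite vE => /eqP.
  by rewrite mulf_eq0 expf_eq0 => /orP[/andP[_ ->] //|/eqP].
have in_exponents L : n%:R / n.+1%:R <= L -> (forall i, (i < n)%N -> nz i ->
    1 - N%:R / (P i)%:R <= L) -> gradient_exponents f L.
  move=> Ln LP; split; first by apply: le_trans Ln; rewrite divr_ge0.
  have Lc i (Q : nat) (v : R[i] -> R[i]) : (i < n)%N -> an1 v -> v 0 != 0 ->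
      (forall t, F (c i t) (t ^+ N) = t ^+ Q * v t) -> 1 - N%:R / Q%:R <= L.
    by move=> ni va v0 vE; have [nzi ->] := P_uniq i Q v ni va v0 vE; apply: LP.
  have [k k0 kP] := gradient_lower_bound Fa Fxa FxP FyP f0 N0 cP Ua U0 FxE cN Ln Lc.
  (* [grad_norm] dominates each partial derivative, hence half their sum. *)
  exists (k / 2); first by rewrite divr_gt0.
  apply/near2P; apply: near2_mono (near2_and kP gradE) => x y [kxy [g1 g2 _]].
  by rewrite -/(cnorm (f (x, y))) -/(F x y); lra.
have arc_small i : (i < n)%N -> forall e : R, 0 < e ->
    near1 (fun t => cnorm (c i t) <= e /\ cnorm (t ^+ N) <= e).
  move=> ni e e0; have [ca c0] := cP i ni.
  have h1 := an1_cont0 ca e0; have h2 := an1_cont0 (an1X N) e0.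
  by apply: near1_mono (near1_and h1 h2) => t; rewrite c0 Nc !subr0.
have arc_nz i : (i < n)%N -> nz i -> ~ near1 (fun t => t != 0 -> F (c i t) (t ^+ N) = 0).
  move=> ni nzi vz; have [wa w0 wE] := oT i ni nzi.
  case/eqP: w0; apply: (an1_eq0_at0 wa); apply: near1_mono vz => t vt t0.
  by move/eqP: (vt t0); rewrite wE mulf_eq0 expf_eq0 (negPf t0) andbF => /eqP.
have arc_exp i : (i < n)%N -> nz i -> exists k1 k2 : R, [/\ 0 < k1, 0 < k2 &
    near1 (fun t => t != 0 ->
      k1 * cnorm (F (c i t) (t ^+ N)) `^ (1 - N%:R / (P i)%:R) <=
        grad_norm f (c i t, t ^+ N) <=
      k2 * cnorm (F (c i t) (t ^+ N)) `^ (1 - N%:R / (P i)%:R))].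
  move=> ni nzi; have [wa w0 wE] := oT i ni nzi; have [ca c0] := cP i ni.
  have Pi0 : (0 < P i)%N by apply: leq_trans (P_ge i ni nzi); rewrite muln_gt0 N0.
  have [k1 [k2 [k10 k20 kP]]] :=
    polar_arc_exponent Fa Fxa FxP FyP f0 N0 cP cR ni Pi0 wa w0 wE.
  exists k1, k2; split => //.
  have gE := near1_comp2 gradE ca (an1X N) c0 Nc.
  apply: near1_mono (near1_and (near1_and kP (cR i ni)) gE) => t [[kt fxt] [_ g2 g3]] t0.
  move: g3; rewrite fxt cnorm0 add0r => g3.
  have /andP[h1 h2] := kt t0; apply/andP; split; first exact: le_trans h1 g2.
  exact: le_trans g3 h2.
have Gamma_of i : (i < n)%N -> nz i -> exists2 gamma, Gamma f gamma &
    near1 (fun t => puiseux_arc gamma t = (c i t, t ^+ N)).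
  move=> ni nzi; have [ca c0] := cP i ni.
  have [gamma gE] := puiseux_of_germ N0 ca c0; exists gamma => //; split.
    apply/near1P; have dE := near1_comp2 D12 ca (an1X N) c0 Nc.
    by apply: near1_mono (near1_and (near1_and gE dE) (cR i ni)) => t [[-> [-> _]]].
  move=> /near1P vz; apply: (arc_nz i ni nzi).
  by apply: near1_mono (near1_and gE vz) => t [-> vt] _; apply: vt.
(* The dichotomy of the statement: Gamma is nonempty exactly when f is nonzero along some c_i. *)
have [[i0 ni0 nzi0]|allz] := pselect (exists2 i, (i < n)%N & nz i).
  have [i [ni nzi imax]] : exists i, [/\ (i < n)%N, nz i &
      forall j, (j < n)%N -> nz j -> (P j <= P i)%N].
    case: (@arg_maxnP _ (Ordinal ni0) (fun i : 'I_n => nz i) (fun i => P i) nzi0).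
    move=> i nzi imax; exists i; split => // j nj nzj.
    exact: (imax (Ordinal nj) nzj).
  pose L : R := 1 - N%:R / (P i)%:R.
  have PR j : (j < n)%N -> nz j -> 0 < (P j)%:R :> R.
    move=> nj nzj; rewrite ltr0n; apply: leq_trans (P_ge j nj nzj).
    by rewrite muln_gt0 N0.
  have Ln : n%:R / n.+1%:R <= L.
    rewrite /L lerBrDr -lerBrDl.
    have -> : 1 - n%:R / n.+1%:R = 1 / n.+1%:R :> R.
      rewrite -[X in X - _](@divff _ n.+1%:R) ?pnatr_eq0 // -mulrBl.
      by rewrite -natr1 addrAC subrr add0r.
    rewrite ler_pdivlMr ?ltr0n // mulrAC ler_pdivrMr ?PR // mul1r -natrM ler_nat.
    exact: P_ge.
  have Lexp : gradient_exponents f L.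
    apply: in_exponents => // j nj nzj; rewrite lerD2l lerN2.
    rewrite ler_wpM2l // lef_pV2 ?posrE ?PR // ler_nat; exact: imax.
  have [gamma gG gE] := Gamma_of i ni nzi.
  have [k1 [k2 [k10 k20 kP]]] := arc_exp i ni nzi.
  exists L; last split.
  - split => // l lexp.
    apply: (gradient_exponent_ge (phi := fun t => (c i t, t ^+ N)) Fa f0 _ lexp k20).
    + by move=> e e0; apply: arc_small.
    + by apply: near1_mono kP => t kt /kt /andP[].
    + exact: arc_nz.
  - by move=> G0; move: gG; rewrite G0.
  - move=> _; split.
      exists gamma => //; exists k1, k2; split => //; apply/near1_dnbhsP.
      by apply: near1_mono (near1_and gE kP) => t [-> kt].
    (* The roles are exchanged: L is now the exponent of the gradient inequality, and l the exponent
       of the arc on which it is tested. *)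
    move=> l [delta [_ dnz] [k3 [k4 [k30 k40 /near1_dnbhsP kl]]]].
    apply: (gradient_exponent_ge (phi := puiseux_arc delta) Fa f0 _ Lexp k40).
    + by move=> e e0; apply: puiseux_arc_small.
    + by apply: near1_mono kl => t kt /kt /andP[].
    + move=> vz; apply: dnz; apply/near1P; apply: near1_mono vz => t vt.
      have [t0|/vt //] := eqVneq t 0.
      by rewrite t0 puiseux_arc0.
have zi i : (i < n)%N -> near1 (fun t => F (c i t) (t ^+ N) = 0).
  by move=> ni; apply: oF => //; apply/negP => nzi; apply: allz; exists i.
(* Pointwise: near 0, a zero of f_x lies on some c_i by the factorization, and f vanishes on all of
   them; hence f vanishes along every polar branch. *)
have Gamma0 : Gamma f = set0.
  apply/seteqP; split => // gamma [/near1P polar nroot]; apply: nroot; apply/near1P.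
  have Fz : near2 (fun _ t => forall i, (i < n)%N -> F (c i t) (t ^+ N) = 0).
    have [r r0 H] := near1_big_and zi; exists r => // x t _; exact: H.
  have key : near2 (fun x y => Fx x y = 0 -> F x y = 0).
    apply: (near2_root N0); have := near2_and (near2_and Fz FxE) (an_unit Ua U0).
    apply: near2_mono => x t [[Fzt FxEt] [_ Uxt]].
    rewrite FxEt => /eqP; rewrite mulf_eq0 (negPf Uxt) /= prodf_seq_eq0.
    case/hasP => i _ /=; rewrite subr_eq0 => /eqP ->.
    exact: Fzt.
  have [r r0 H] := near2_and D12 key.
  apply: near1_mono (near1_and polar (puiseux_arc_small gamma r0)) => t.
  case: (puiseux_arc gamma t) => x y /= [dxy [xr yr]].
  by have [[dE _] kxy] := H x y xr yr; apply: kxy; rewrite -dE.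
pose L : R := n%:R / n.+1%:R; exists L; last by split => [_|/(_ Gamma0)//].
split.
  apply: in_exponents => // i ni nzi; exfalso; apply: allz; by exists i.
move=> l lexp.
have [u [ua u0 Fu]] := Fm.
have [M [r [M0 r0 FxM]]] := Fxv; have [M' [r' [M'0 r'0 FyM]]] := Fyv.
pose l2 := cnorm (u 0) / 2; have l20 : 0 < l2 by rewrite divr_gt0 // cnorm_gt0.
have L0 : 0 <= L by rewrite divr_ge0.
have l2L : 0 < l2 `^ L by apply: powR_gt0.
have MM : 0 < (M + M') / l2 `^ L by rewrite divr_gt0 // addr_gt0.
(* Along the x-axis |f| is comparable to |t|^(n+1) while the gradient is O(|t|^n), so the gradient
   is O(|f|^(n/(n+1))). *)
apply: (gradient_exponent_ge (phi := fun t => (t, 0)) Fa f0 _ lexp MM).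
- move=> e e0; exists e => // t te; split => //=.
  by have := cnorm0 R; rewrite /cnorm => ->; apply: ltW.
- have gE := near1_comp2 gradE an1_id (an1_cst 0) erefl erefl.
  have rr0 : 0 < Num.min r r' by rewrite lt_min r0.
  apply: near1_mono (near1_and (near1_and gE (near1_le rr0)) (near1_and Fu (an1_unit ua u0))).
  move=> t [[[_ _ g3] tr] [Fut [ut _]]] t0.
  move: tr; rewrite le_min => /andP[tr tr'].
  have tp : 0 < cnorm t by rewrite cnorm_gt0.
  have z0 : cnorm 0 <= cnorm t by rewrite cnorm0 ltW.
  have h1 : cnorm (Fx t 0) <= M * cnorm t ^+ n by apply: FxM => //; rewrite tp.
  have h2 : cnorm (Fy t 0) <= M' * cnorm t ^+ n by apply: FyM => //; rewrite tp.
  have h3 : l2 `^ L * cnorm t ^+ n <= cnorm (F t 0) `^ L.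
    rewrite Fut cnormM cnormX powRM ?exprn_ge0 ?cnorm_ge0 //.
    have -> : (cnorm t ^+ n.+1) `^ L = cnorm t ^+ n.
      have n1 : n.+1%:R != 0 :> R by rewrite pnatr_eq0.
      rewrite -(powR_mulrn n.+1 (cnorm_ge0 t)) -powRrM /L mulrCA divff // mulr1.
      exact/powR_mulrn/cnorm_ge0.
    rewrite mulrC ler_wpM2l ?exprn_ge0 ?cnorm_ge0 //.
    by apply: (ge0_ler_powR L0); rewrite ?nnegrE ?cnorm_ge0 ?(ltW l20).
  apply: (le_trans g3); apply: (le_trans (lerD h1 h2)); rewrite -mulrDl.
  rewrite -mulrA ler_wpM2l ?addr_ge0 ?(ltW M0) ?(ltW M'0) //.
  by rewrite mulrC ler_pdivlMr // mulrC.
- move=> Fz; case/eqP: u0; apply: (an1_eq0_at0 ua).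
  apply: near1_mono (near1_and Fz Fu) => t [Fzt Fut] t0.
  by move/eqP: (Fzt t0); rewrite -/(F t 0) Fut mulf_eq0 expf_eq0 (negPf t0) => /eqP.
Qed.
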